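(* Let $\kappa\ge 0$ be an integer, and let $z_1,\dots,z_k\in\mathbb{D}$ be distinct, $\mathbf{n}=(n_1,\dots,n_k)\in\mathbb{N}^k$, and $f_{i,j}\in\mathbb{C}$ ($1\le i\le k$, $0\le j\le n_i-1$) be the data of the problem $\mathbf{IP}_\kappa$. Let $P$ be the Pick matrix of the problem and assume that $\kappa\ge \mathrm{sq}_-(P)$ and $\det P\neq 0$. Let $\Theta=\begin{bmatrix}\Theta_{11}&\Theta_{12}\\ \Theta_{21}&\Theta_{22}\end{bmatrix}$ be the $2\times2$ rational matrix-valued function defined by $$\Theta(z)=I_2+(z-1)\begin{bmatrix}E^*\\ C^*\end{bmatrix}(I-zT^* )^{-1}P^{-1}(I-T)^{-1}\begin{bmatrix}E&-C\end{bmatrix}.$$ Then all solutions $f$ of $\mathbf{IP}_\kappa$ are parametrized by the linear fractional transformation $$f(z)=\frac{\Theta_{11}(z)S(z)+\Theta_{12}(z)B(z)}{\Theta_{21}(z)S(z)+\Theta_{22}(z)B(z)},$$ where the parameters $S\in\mathcal{S}$ and $B\in\mathcal{B}_{\kappa-\mathrm{sq}_-(P)}$ do not have common zeros and satisfy the conditions $$\Theta_{21}(z_i)S(z_i)+\Theta_{22}(z_i)B(z_i)\neq 0\qquad(i=1,\dots,k).$$ Equivalently, $$f(z)=\mathbf{T}_\Theta[\mathcal{E}]:=\frac{\Theta_{11}(z)\mathcal{E}(z)+\Theta_{12}(z)}{\Theta_{21}(z)\mathcal{E}(z)+\Theta_{22}(z)},$$ where the parameter $\mathcal{E}\in\mathcal{S}_{\kappa-\mathrm{sq}_-(P)}$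 satisfies $$\Theta_{21}(z_i)\mathcal{E}(z_i)+\Theta_{22}(z_i)\neq0\qquad(i=1,\dots,k)$$ or has a pole at $z_i$ in case $\Theta_{21}(z_i)\neq\Theta_{22}(z_i)=0$ (that is, in case $\Theta_{22}(z_i)=0$ and $\Theta_{21}(z_i)\neq 0$).
   Context: $\mathbb{D}$ is the open unit disk. $\mathcal{S}$ (Schur class) is the set of analytic functions $\mathbb{D}\to\overline{\mathbb{D}}$. $\mathcal{B}_\kappa$ is the set of finite Blaschke products of degree $\kappa$. $\mathcal{S}_\kappa$ (generalized Schur class) is the set of meromorphic functions on $\mathbb{D}$ of the form $f=s/b$ with $s\in\mathcal{S}$, $b\in\mathcal{B}_\kappa$ having no common zeros; in particular $\mathcal{S}_0=\mathcal{S}$. For a Hermitian matrix $P$, $\mathrm{sq}_-(P)$ is the number of its negative eigenvalues, counted with multiplicity. Problem $\mathbf{IP}_\kappa$: given an integer $\kappa\ge0$, distinct points $z_1,\dots,z_k\in\mathbb{D}$, a tuple $\mathbf{n}=(n_1,\dots,n_k)\in\mathbb{N}^k$ and $|\mathbf{n}|=n_1+\dots+n_k$ complex numbers $f_{i,j}$ ($1\le i\le k$, $0\le j\le n_i-1$), find all functions $f\in\mathcal{S}_\kappa$ (if any exist) which are analytic at every $z_i$ and satisfy $f^{(j)}(z_i)=j!\,f_{i,j}$ for $i=1,\dots,k$, $j=0,\dots,n_i-1$. Such $f$ are called solutions. Matrices of the problem: $J_n(z)$ is the $n\times n$ lower triangular Jordan block with $z$ on the main diagonal, $1$ on the first subdiagonal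 and $0$ elsewhere; $E_n=(1,0,\dots,0)^\top\in\mathbb{C}^n$; $T=\mathrm{diag}(J_{n_1}(z_1),\dots,J_{n_k}(z_k))$ (block diagonal); $E$ is the column vector in $\mathbb{C}^{|\mathbf{n}|}$ obtained by stacking $E_{n_1},\dots,E_{n_k}$; $C$ is the column vector obtained by stacking $C_1,\dots,C_k$ with $C_i=(f_{i,0},\dots,f_{i,n_i-1})^\top$. The Pick matrix $P$ is the unique solution of the Stein equation $P-TPT^*=EE^*-CC^*$, i.e. $P=\sum_{j\ge0}T^j(EE^*-CC^* )T^{*j}$.
   Formalization: In the second form, a pole of 𝓔 at z_i is allowed whenever Θ21(z_i)≠0, not only when also Θ22(z_i)=0; as printed the forms are not equivalent (k=n_1=1, z_1=0, 0<|f_{1,0}|<1, κ=1, 𝓔=1/z gives a solution). *)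

(* Defs.v *)
From HB Require Import structures.
From mathcomp Require Import all_boot all_order all_algebra spectral.
From mathcomp Require Export complex.
From mathcomp Require Import mathcomp_extra boolp classical_sets functions.
From mathcomp Require Export reals.
From mathcomp Require Import topology normedtype sequences derive.

Set Implicit Arguments.
Unset Strict Implicit.
Unset Printing Implicit Defensive.

Import Order.TTheory GRing.Theory Num.Theory.
Import numFieldNormedType.Exports.

Local Open Scope classical_set_scope.
Local Open Scope sesquilinear_scope.
Local Open Scope ring_scope.

(* All definitions are used with C := R[i] for R : realType. Functions on the
   unit disk are represented by functions on C whose values outside the disk
   are irrelevant. *)

Definition in_disk {C : numClosedFieldType} (z : C) : Prop := `|z| < 1.

Definition analytic_at {C : numClosedFieldType} (f : C -> C) (z : C) : Prop :=
  exists a : nat -> C, \forall w \near z,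
    [series a m * (w - z) ^+ m]_m @ \oo --> f w.

Definition schur {C : numClosedFieldType} (s : C -> C) : Prop :=
  forall z, in_disk z -> analytic_at s z /\ `|s z| <= 1.

(* A finite Blaschke product includes a unimodular constant factor, so that the
   products of degree 0 are the unimodular constants. *)
Definition blaschke {C : numClosedFieldType} (m : nat) (b : C -> C) : Prop :=
  exists (c : C) (a : 'I_m -> C),
    [/\ `|c| = 1, forall j, in_disk (a j) &
        forall z, in_disk z ->
          b z = c * \prod_(j < m) ((z - a j) / (1 - (a j)^* * z))].

Definition no_common_zeros {C : numClosedFieldType} (s b : C -> C) : Prop :=
  forall z, in_disk z -> ~ (s z = 0 /\ b z = 0).

(* Meromorphic functions on the disk are maps to the Riemann sphere [option C],
   with [None] the point at infinity, taken exactly at the poles.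

   [meromorphic_ext g] is the meromorphic function given by the expression [g],
   which may be unreliable at isolated points (in particular x / 0 = 0 in
   MathComp): its value at z is the limit of g at z along w <> z. *)
Definition meromorphic_ext {C : numClosedFieldType} (g : C -> C) (z : C) :
    option C :=
  if `[< cvg (g @ z^') >] then Some (lim (g @ z^')) else None.

Definition gen_schur {C : numClosedFieldType} (kappa : nat)
    (f : C -> option C) : Prop :=
  exists s b : C -> C,
    [/\ schur s, blaschke kappa b, no_common_zeros s b &
        forall z, in_disk z -> f z = meromorphic_ext (fun w => s w / b w) z].

Definition finite_part {C : numClosedFieldType} (f : C -> option C) (z : C) :
    C :=
  odflt 0 (f z).

(* f is analytic at every z_i and f^(j)(z_i) = j! f_{i,j}; here g is f read as
   a C-valued function near z_i. *)
Definition IP_solution {C : numClosedFieldType} (kappa k : nat)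
    (z : 'I_k -> C) (n : 'I_k -> nat) (fd : forall i, 'I_(n i) -> C)
    (f : C -> option C) : Prop :=
  gen_schur kappa f /\
  forall i : 'I_k, exists g : C -> C,
    [/\ \forall w \near z i, f w = Some (g w),
        analytic_at g (z i) &
        forall j : 'I_(n i), derive1n j g (z i) = j`!%:R * fd i j].

(* The number of negative eigenvalues, counted with multiplicity: the list of
   roots of the characteristic polynomial contains every root as often as its
   multiplicity, and x < 0 in C means that x is real and negative. *)
Definition sq_neg {C : numClosedFieldType} (N : nat) (P : 'M[C]_N) : nat :=
  count (fun x => x < 0) (sval (closed_field_poly_normal (char_poly P))).

Definition jordan {C : numClosedFieldType} (m : nat) (z : C) : 'M[C]_m :=
  \matrix_(i, j) (if i == j then z else if i == j.+1 :> nat then 1 else 0).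

Definition T_mx {C : numClosedFieldType} (k : nat) (z : 'I_k -> C)
    (n : 'I_k -> nat) : 'M[C]_(\sum_i n i) :=
  \mxdiag_(i < k) jordan (n i) (z i).

Definition E_mx (C : numClosedFieldType) (k : nat) (n : 'I_k -> nat) :
    'cV[C]_(\sum_i n i) :=
  \mxcol_(i < k) (\col_(j < n i) (j == 0 :> nat)%:R).

Definition C_mx {C : numClosedFieldType} (k : nat) (n : 'I_k -> nat)
    (fd : forall i, 'I_(n i) -> C) : 'cV[C]_(\sum_i n i) :=
  \mxcol_(i < k) (\col_(j < n i) fd i j).

(* The Stein equation; since |z_i| < 1 for all i, it has exactly one
   solution. *)
Definition is_pick_matrix {C : numClosedFieldType} (k : nat) (z : 'I_k -> C)
    (n : 'I_k -> nat) (fd : forall i, 'I_(n i) -> C)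
    (P : 'M[C]_(\sum_i n i)) : Prop :=
  let T := T_mx z n in
  let E := E_mx C n in
  let Cv := C_mx fd in
  P - T *m P *m T^t* = E *m E^t* - Cv *m Cv^t*.

Definition Theta {C : numClosedFieldType} (k : nat) (z : 'I_k -> C)
    (n : 'I_k -> nat) (fd : forall i, 'I_(n i) -> C)
    (P : 'M[C]_(\sum_i n i)) (w : C) : 'M[C]_2 :=
  let T := T_mx z n in
  let E := E_mx C n in
  let Cv := C_mx fd in
  1%:M + (w - 1) *:
    (col_mx (E^t*) (Cv^t*) *m invmx (1%:M - w *: T^t*) *m invmx P
       *m invmx (1%:M - T) *m row_mx E (- Cv)).

(* The meromorphic function (Th11 s + Th12 b) / (Th21 s + Th22 b). *)
Definition lft {C : numClosedFieldType} (Th : C -> 'M[C]_2) (s b : C -> C) :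
    C -> option C :=
  meromorphic_ext (fun w =>
    (Th w 0 0 * s w + Th w 0 1 * b w) / (Th w 1 0 * s w + Th w 1 1 * b w)).

Definition lft_mero {C : numClosedFieldType} (Th : C -> 'M[C]_2)
    (e : C -> option C) : C -> option C :=
  lft Th (finite_part e) (fun=> 1).

(* a e + b <> 0 for e on the Riemann sphere: at e = oo the value of a e + b is
   oo, hence nonzero, if a <> 0, and it is undefined if a = 0. *)
Definition affine_neq0 {C : numClosedFieldType} (a b : C) (e : option C) :
    Prop :=
  if e is Some x then a * x + b != 0 else a != 0.

(* Main.v *)
Require Import Defs.
From mathcomp Require Import all_boot all_order all_algebra spectral.
From mathcomp Require Import mathcomp_extra boolp classical_sets functions.
From mathcomp Require Import topology normedtype sequences derive.
From mathcomp Require Import ring lra.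
Set Implicit Arguments.
Unset Strict Implicit.
Unset Printing Implicit Defensive.
Import Order.TTheory GRing.Theory Num.Theory.
Import numFieldNormedType.Exports.
Import ComplexField.Normc.
Local Open Scope classical_set_scope.
Local Open Scope ring_scope.

(** Why the theorem holds. Write [T'] for the adjoint of [T], [J] for the
  signature matrix diag(1, -1) and [R(z)] for the product of the inverses of
  [1 - z T'], [P] and [1 - T]. The Stein equation yields three identities.

  - [theta_adj], [theta_coadj]: the adjoint of [Theta] times [J Theta], and
    [Theta J] times the adjoint of [Theta], differ from [J] by [|z|^2 - 1]
    times a bounded term. So [Theta] preserves the form [|s|^2 - |b|^2] on the
    unit circle.
  - [theta_interp]: [(E, -C) Theta(z)] is divisible on the left by [z - T].
    Read block by block, this says that for any analytic column [v] the
    entries [(n, d)] of [Theta v] satisfy the interpolation conditions in the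
    form [n = f_i d] up to order [n_i] at [z_i].
  - [theta_solve]: conversely, a column [u] for which [(E, -C) u] is divisible
    by [z - T] is [Theta v] for an analytic [v] given by an explicit formula.

  The degree of the denominator comes from a zero count. The zeros of
  [Theta22] are the Moebius images of the eigenvalues of a matrix [W]
  ([theta22_det]) which satisfies the Lyapunov equation
  [H W + W' H = 2 (E E' + C C')], where primes denote adjoints and [H] is
  congruent to [P]. Lyapunov's inertia theorem and Sylvester's law of inertia
  ([theta22_zeros]) then say that [Theta22] has exactly [sq_neg P] zeros in
  the disk. For a Schur function [S] and a Blaschke product [B] the function
  [Theta22 B] dominates [Theta21 S] near the circle, so that the denominator
  [D = Theta21 S + Theta22 B] has [sq_neg P + deg B] zeros ([denom_count]).

  From parameters to a solution: factor [D = b u] with [b] a Blaschke product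
  of degree [kappa] and [u] without zeros. With [N = Theta11 S + Theta12 B] the
  quotient [N / u] is bounded by 1, by [theta_adj] and the maximum principle,
  and [N / D = (N / u) / b].

  From a solution [s / b] to parameters: the Taylor remainders of the
  interpolation conditions form a bounded analytic column, so [theta_solve]
  yields bounded analytic [S0], [B0] with [Theta (S0, B0) = (s, b)]. Again
  [B0 = B u] with [u] without zeros, [S0 / u] is a Schur function, and the zero
  count forces [deg B = kappa - sq_neg P]. The denominator belonging to
  [S0 / u] and [B] is [b / u], which does not vanish at the nodes, as the
  solution has no poles there.

  The second description is the first one with [e = S / B]
  ([ratio_parameter]).

  The function theory is elementary: analytic functions are handled through
  estimates on the remainders of their power series, and contour integrals
  are replaced by the maximum principle. *)

(** * Analytic functions: power series with remainder estimates *)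

Section PowerSeries.
Variable R : realType.
Implicit Types (f g : R[i] -> R[i]) (z w x : R[i]) (a : nat -> R[i]).
Local Notation C := (R[i] : numClosedFieldType).

Lemma gt0C (e : C) : 0 < e -> exists2 r : R, 0 < r & e = (r%:C)%C.
Proof.
move=> e0; have er : e = (complex.Re e)%:C%C by rewrite RRe_real // realE ltW.
by exists (complex.Re e) => //; rewrite er ltcR in e0.
Qed.

(** The order of [R[i]] makes the positive radii of the norm topology real
  numbers, so that the topology can be described with the real modulus. *)
Lemma nbhsCP z (P : R[i] -> Prop) :
  (nbhs (z : C) (P : set C)) <->
  exists2 r : R, 0 < r & forall w, normc (w - z) < r -> P w.
Proof.
split.
- move/nbhs_normP => [e /= e0 H].
  have [r r0 er] := gt0C e0.
  exists r => // w wz; apply: H; rewrite /= er.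
  by rewrite distrC ltcR.
- case=> r r0 H. apply/nbhs_normP; exists (r%:C)%C; first by rewrite /= ltcR.
  by move=> w /=; rewrite distrC ltcR; apply: H.
Qed.

Lemma dnbhsCP z (P : R[i] -> Prop) :
  dnbhs (z : C) (P : set C) <->
  exists2 r : R, 0 < r & forall w, w != z -> normc (w - z) < r -> P w.
Proof.
split=> [/nbhsCP [r r0 H]|[r r0 H]]; first by exists r => // w ? ?; apply: H.
by apply/nbhsCP; exists r => // w ? ?; apply: H.
Qed.

Lemma cvgCP T (F : set_system T) (FF : Filter F) (g : T -> R[i]) (l : R[i]) :
  ((g : T -> C) @ F --> (l : C)) <->
  forall e : R, 0 < e -> F (fun t => normc (g t - l) < e).
Proof.
split.
  move/cvgrPdistC_lt => H e e0.
  have := H (e%:C)%C; rewrite ltcR => /(_ e0).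
  by apply: filterS => w; rewrite ltcR.
move=> H; apply/cvgrPdistC_lt => e e0.
have [r r0 ->] := gt0C e0.
by move/H : r0; apply: filterS => w; rewrite ltcR.
Qed.

Lemma cvgnatCP (u : nat -> R[i]) (l : R[i]) :
  ((u : nat -> C) @ \oo --> (l : C)) <->
  forall e : R, 0 < e -> exists N, forall n, (N <= n)%N -> normc (u n - l) < e.
Proof.
split => [/cvgCP H e e0|H].
  by have /= [N _ HN] := H e e0; exists N => n Nn; exact: HN.
by apply/cvgCP => e e0; have [N HN] := H e e0; exists N.
Qed.

Lemma normc_ge0 z : 0 <= normc z.
Proof. by case: z => a b; rewrite sqrtr_ge0. Qed.

Lemma normcD z w : normc (z + w) <= normc z + normc w.
Proof. exact: le_normcD. Qed.

Lemma normcB z w : normc (z - w) <= normc z + normc w.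
Proof. by rewrite -[normc w]normcN; exact: normcD. Qed.

Lemma normcBC z w : normc (z - w) = normc (w - z).
Proof. by rewrite -normcN opprB. Qed.

Lemma normcDB z w : normc z - normc w <= normc (z + w).
Proof. by rewrite lerBlDr -{1}[z](addrK w) normcB. Qed.

Lemma normcBB z w : normc z - normc w <= normc (z - w).
Proof. by rewrite -[normc w]normcN normcDB. Qed.

Lemma normcX z n : normc (z ^+ n) = normc z ^+ n.
Proof. by elim: n => [|n IH]; rewrite ?expr0 ?normc1 // !exprS normcM IH. Qed.

Lemma normc_eq0 z : (normc z == 0) = (z == 0).
Proof. by apply/eqP/eqP => [/eq0_normc //|->]; rewrite normc0. Qed.

Lemma normc_gt0 z : (0 < normc z) = (z != 0).
Proof. by rewrite lt_def normc_ge0 andbT normc_eq0. Qed.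

Lemma normc_real (r : R) : normc (r%:C)%C = `|r|.
Proof. by rewrite /normc /= expr0n addr0 sqrtr_sqr. Qed.

Lemma normc_sum (I : Type) (s : seq I) (P : pred I) (F : I -> R[i]) :
  normc (\sum_(i <- s | P i) F i) <= \sum_(i <- s | P i) normc (F i).
Proof.
elim/big_rec2 : _ => [|i y1 y2 _ H]; first by rewrite normc0.
by apply: le_trans (normcD _ _) _; rewrite lerD2l.
Qed.

Lemma normcC z : normc (z^*)%R = normc z.
Proof. by apply: complexI; have := norm_conjC z. Qed.

Lemma normc_nat n : normc (n%:R : R[i]) = n%:R.
Proof.
by rewrite -(rmorph_nat (real_complex R)) normc_real ger0_norm.
Qed.

Lemma in_diskE z : @in_disk C z <-> normc z < 1.
Proof. by rewrite /in_disk -(ltcR (normc z) 1). Qed.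

Lemma halfX_small (K e : R) : 0 <= K -> 0 < e ->
  exists N, forall n, (N <= n)%N -> forall t, 0 <= t -> t <= 2^-1 -> K * t ^+ n < e.
Proof.
move=> K0 e0; have [N HN] : exists N : nat, K / e < N%:R.
  by exists (Num.bound (K / e)); apply: archi_boundP; rewrite divr_ge0 // ltW.
exists N => n Nn t t0 th.
have tn : t ^+ n <= (2^-1) ^+ n by rewrite lerXn2r // ?nnegrE // invr_ge0.
apply: le_lt_trans (ler_wpM2l K0 tn) _.
rewrite exprVn ltr_pdivrMr ?exprn_gt0 // -ltr_pdivrMl // mulrC.
apply: lt_le_trans HN _; rewrite -natrX ler_nat.
by apply: leq_trans Nn _; apply: ltnW; exact: ltn_expl.
Qed.

(** The bound for [n = 0] bounds [f] near [z], and the bounds for all [n]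
  together make the series converge to [f]. Keeping the remainders, and not only
  the convergence, makes the algebra of analytic functions a matter of finite
  sums. *)
Definition expands f z a (K B : R) :=
  [/\ 0 <= K, 0 < B &
   forall n x, B * normc x <= 1 ->
     normc (f (z + x) - \sum_(i < n) a i * x ^+ i) <= K * (B * normc x) ^+ n].

Lemma analytic_def f z : @analytic_at C f z <->
  exists a, exists2 r : R, 0 < r &
  forall w, normc (w - z) < r -> forall e : R, 0 < e ->
  exists N, forall n, (N <= n)%N ->
   normc (f w - \sum_(i < n) a i * (w - z) ^+ i) < e.
Proof.
rewrite /analytic_at; split => -[a].
  move/nbhsCP => -[r r0 H]; exists a, r => // w wr.
  have /cvgnatCP := H w wr.
  move=> + e e0 => /(_ e e0) [N HN]; exists N => n /HN.
  by rewrite normcBC /= /series /= big_mkord.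
case => r r0 H; exists a; apply/nbhsCP; exists r => // w /H Hw.
apply/cvgnatCP => e /Hw [N HN]; exists N => n /HN.
by rewrite normcBC /= /series /= big_mkord.
Qed.

Lemma expands_analytic f z a K B : expands f z a K B -> @analytic_at C f z.
Proof.
case=> K0 B0 H; apply/analytic_def; exists a, (2 * B)^-1.
  by rewrite invr_gt0 mulr_gt0.
move=> w wz e e0.
have Bw : B * normc (w - z) <= 2^-1.
  rewrite -(ler_pM2l (x := 2)) // mulrA divff ?pnatr_eq0 //.
  by rewrite -ler_pdivlMl ?mulr1 ?mulr_gt0 // ltW.
have [N HN] := halfX_small K0 e0; exists N => n Nn.
have := H n (w - z); rewrite [z + _]addrC subrK => /(_ _)/le_lt_trans; apply.
  by lra.
by apply: HN => //; rewrite mulr_ge0 ?normc_ge0 // ltW.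
Qed.

(** Two consecutive partial sums differ by one term; evaluate at
  [x = 1 / B]. *)
Lemma expands_coef f z a K B : expands f z a K B ->
  forall n, normc (a n) <= 2 * K * B ^+ n.
Proof.
case=> K0 B0 H n; pose x := ((B^-1)%:C)%C : R[i].
have nx : normc x = B^-1 by rewrite normc_real ger0_norm // invr_ge0 ltW.
have Bx : B * normc x = 1 by rewrite nx divff // gt_eqF.
have := H n x; have := H n.+1 x; rewrite Bx => /(_ (lexx _)) + /(_ (lexx _)).
rewrite !expr1n mulr1 big_ord_recr /= => H1 H2.
have : normc (a n * x ^+ n) <= 2 * K.
  set F := f _ in H1 H2; set S := \sum_(i < n) _ in H1 H2.
  have -> : a n * x ^+ n = (F - S) - (F - (S + a n * x ^+ n)) by ring.
  apply: le_trans (normcB _ _) _; lra.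
by rewrite normcM normcX nx exprVn ler_pdivrMr ?exprn_gt0.
Qed.

Lemma sum_half (n m : nat) : \sum_(n <= i < m) (2^-1 : R) ^+ i <= 2.
Proof.
have H k : \sum_(0 <= i < k) (2^-1 : R) ^+ i <= 2 - 2^-1 ^+ k * 2.
  elim: k => [|k IH]; first by rewrite big_geq // expr0 mul1r subrr.
  rewrite big_nat_recr //= exprS; lra.
have p k : 0 <= (2^-1 : R) ^+ k by rewrite exprn_ge0 // invr_ge0.
have [nm|mn] := leqP n m; last by rewrite big_geq // ltnW.
have Hm := H m; rewrite (big_cat_nat _ (n := n)) //= in Hm.
have : 0 <= \sum_(0 <= i < n) (2^-1 : R) ^+ i by rewrite sumr_ge0.
have := p m; lra.
Qed.

(** Convergence at one point of modulus [s] bounds the coefficients by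
  [K s^-n]; the remainder on a smaller disk is then a geometric tail. *)
Lemma analytic_expands f z : @analytic_at C f z ->
  exists a K B, expands f z a K B.
Proof.
move/analytic_def => [a [r r0 H]].
have [s s0 sr] : exists2 s, 0 < s & s < r by exists (r / 2); lra.
have ns : normc ((s%:C)%C : R[i]) = s by rewrite normc_real ger0_norm // ltW.
have Hs := H (z + (s%:C)%C); rewrite addrC addKr ns in Hs.
have [N HN] := Hs sr 1 ltr01.
have [K0 K00 HK0] : exists2 K0 : R, 0 <= K0 & forall i, normc (a i) * s ^+ i <= K0.
  exists (2 + \sum_(i < N) normc (a i) * s ^+ i).
    by rewrite addr_ge0 // sumr_ge0 // => i _; rewrite mulr_ge0 ?normc_ge0 ?exprn_ge0 // ltW.
  move=> i; have [Ni|iN] := leqP N i; last first.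
    rewrite (bigD1 (Ordinal iN)) //= addrCA lerDl addr_ge0 // sumr_ge0 //.
    by move=> j _; rewrite mulr_ge0 ?normc_ge0 ?exprn_ge0 // ltW.
  have := HN i Ni; have := HN i.+1 (leqW Ni); rewrite big_ord_recr /=.
  set F := f _; set S := \sum_(i < _) _ => H1 H2.
  have : normc (a i * (s%:C)%C ^+ i) <= 2.
    have -> : a i * (s%:C)%C ^+ i = (F - S) - (F - (S + a i * (s%:C)%C ^+ i)) by ring.
    by apply: le_trans (normcB _ _) _; lra.
  rewrite normcM normcX ns => /le_trans; apply.
  by rewrite lerDl sumr_ge0 // => j _; rewrite mulr_ge0 ?normc_ge0 ?exprn_ge0 // ltW.
exists a, (2 * K0), (2 / s); split; rewrite ?mulr_ge0 ?divr_gt0 // => n x.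
set t := 2 / s * _ => t1.
have t0 : 0 <= t by rewrite mulr_ge0 ?normc_ge0 // divr_ge0 // ltW.
have nxE : normc x = s * (t / 2).
  by rewrite /t; field; rewrite gt_eqF.
have xr : normc x < r by rewrite nxE; nra.
apply/ler_addgt0Pr => e e0.
have := H (z + x); rewrite addrC addKr => /(_ xr e e0) [M HM].
have := HM (maxn n M) (leq_maxr _ _).
rewrite -(big_mkord xpredT (fun i => a i * x ^+ i)).
rewrite (big_cat_nat _ (n := n)) //= ?leq_maxl // big_mkord.
set F := f _; set S := \sum_(i < n) _; set T := \sum_(_ <= i < _) _ => HT.
have -> : F - S = (F - (S + T)) + T by ring.
apply: le_trans (normcD _ _) _; rewrite addrC; apply: lerD; last exact: ltW.
apply: le_trans (normc_sum _ _ _) _.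
have HT2 i : (n <= i)%N -> normc (a i * x ^+ i) <= K0 * t ^+ n * 2^-1 ^+ i.
  move=> ni; rewrite normcM normcX nxE exprMn [(t / 2) ^+ i]exprMn !mulrA.
  rewrite ler_wpM2r ?exprn_ge0 ?invr_ge0 //.
  apply: ler_pM => //; last exact: ler_wiXn2l.
    by rewrite mulr_ge0 ?normc_ge0 // exprn_ge0 // ltW.
  by rewrite exprn_ge0.
apply: le_trans (_ : \sum_(n <= i < maxn n M) K0 * t ^+ n * 2^-1 ^+ i <= _).
  by rewrite big_nat_cond [leRHS]big_nat_cond; apply: ler_sum => i /andP[/andP[+ _] _]; exact: HT2.
rewrite -mulr_sumr mulrC -[2 * K0 * _]mulrA.
apply: ler_wpM2r; last exact: sum_half.
by rewrite mulr_ge0 // exprn_ge0.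
Qed.

Lemma analyticP f z : @analytic_at C f z <-> exists a K B, expands f z a K B.
Proof.
by split=> [/analytic_expands //|[a [K [B]]]]; exact: expands_analytic.
Qed.

Lemma expands_weak f z a K B K' B' : K <= K' -> B <= B' ->
  expands f z a K B -> expands f z a K' B'.
Proof.
move=> KK BB [K0 B0 H]; split; rewrite ?(le_trans K0) ?(lt_le_trans B0) // => n x Bx.
have le : B * normc x <= B' * normc x by rewrite ler_wpM2r ?normc_ge0.
apply: le_trans (H n x (le_trans le Bx)) _.
apply: ler_pM => //; first by rewrite exprn_ge0 // mulr_ge0 ?normc_ge0 // ltW.
rewrite lerXn2r ?nnegrE ?mulr_ge0 ?normc_ge0 // ltW //.
exact: lt_le_trans BB.
Qed.

Lemma expands0 f z a (K B : R) : expands f z a K B -> a 0%N = f z.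
Proof.
case=> _ _ Hf.
have := Hf 1%N 0; rewrite normc0 mulr0 addr0 big_ord1 expr0 mulr1 expr1 mulr0 => /(_ ler01).
by rewrite le_eqVlt ltNge normc_ge0 orbF normc_eq0 subr_eq0 => /eqP.
Qed.

Lemma expands_near f g z a (K B r : R) : 0 < r ->
  (forall w, normc (w - z) < r -> f w = g w) ->
  expands f z a K B -> exists B', expands g z a K B'.
Proof.
move=> r0 fg H.
have B' : B <= Num.max B (2 / r) by rewrite le_max lexx.
have {H}[K0 B0 H] := expands_weak (lexx K) B' H.
exists (Num.max B (2 / r)); split => // n x Bx.
rewrite -fg ?H // addrC addKr.
have : 2 / r * normc x <= 1.
  by apply: le_trans Bx; rewrite ler_wpM2r ?normc_ge0 // le_max lexx orbT.
rewrite mulrAC ler_pdivrMr // mul1r; have := normc_ge0 x; lra.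
Qed.

Lemma analytic_near f g z (r : R) : 0 < r ->
  (forall w, normc (w - z) < r -> f w = g w) ->
  @analytic_at C f z -> @analytic_at C g z.
Proof.
move=> r0 fg /analyticP [a [K [B H]]]; have [B' H'] := expands_near r0 fg H.
exact: expands_analytic H'.
Qed.

Lemma analytic_cst c z : @analytic_at C (fun=> c) z.
Proof.
apply/analyticP; exists (fun n => if n is 0%N then c else 0), (normc c), 1.
split; rewrite ?normc_ge0 // => -[|n] x _.
  by rewrite big_ord0 subr0 expr0 mulr1.
rewrite big_ord_recl /= expr0 mulr1 big1 => [|i _]; last by rewrite /= mul0r.
by rewrite addr0 subrr normc0 mulr_ge0 ?normc_ge0 // exprn_ge0 // mul1r normc_ge0.
Qed.

Lemma analytic_id z : @analytic_at C id z.
Proof.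
apply/analyticP.
exists (fun n => if n is m.+1 then (if m is 0%N then 1 else 0) else z), (1 + normc z), 1.
have nz := normc_ge0 z.
split; rewrite ?addr_ge0 // => -[|[|n]] x; rewrite !mul1r => x1.
- rewrite big_ord0 subr0 expr0 mulr1.
  by apply: le_trans (normcD _ _) _; lra.
- rewrite big_ord1 /= !expr1 expr0 mulr1 addrAC subrr add0r.
  have := normc_ge0 x; nra.
rewrite !big_ord_recl /= big1 => [|i _]; last by rewrite /= mul0r.
rewrite !expr0 expr1 mulr1 mul1r addr0 subrr normc0.
by rewrite mulr_ge0 ?addr_ge0 // exprn_ge0 // normc_ge0.
Qed.

Lemma analyticD f g z : @analytic_at C f z -> @analytic_at C g z ->
  @analytic_at C (fun w => f w + g w) z.
Proof.
move=> /analyticP [a [K [B Hf]]] /analyticP [b [K' [B' Hg]]].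
pose M := Num.max B B'.
have [|K0 M0 {}Hf] := expands_weak (lexx K) (B' := M) _ Hf.
  by rewrite le_max lexx.
have [|K0' M0' {}Hg] := expands_weak (lexx K') (B' := M) _ Hg.
  by rewrite le_max lexx orbT.
apply/analyticP; exists (fun n => a n + b n), (K + K'), M.
split; rewrite ?addr_ge0 // => n x xM; have := Hf n x xM; have := Hg n x xM.
have -> : \sum_(i < n) (a i + b i) * x ^+ i =
   \sum_(i < n) a i * x ^+ i + \sum_(i < n) b i * x ^+ i.
  by rewrite -big_split; apply: eq_bigr => i _; rewrite mulrDl.
rewrite mulrDl opprD addrACA => H1 H2.
by apply: le_trans (normcD _ _) _; rewrite lerD.
Qed.

Lemma sum_conv a (b : nat -> R[i]) x n :
  \sum_(m < n) (\sum_(i < m.+1) a i * b (m - i)%N) * x ^+ m =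
  \sum_(i < n) a i * x ^+ i * (\sum_(j < n - i) b j * x ^+ j).
Proof.
elim: n => [|n IH]; first by rewrite !big_ord0.
rewrite big_ord_recr /= IH [RHS]big_ord_recr /= subSnn big_ord1 expr0 mulr1.
rewrite [X in _ + X * _]big_ord_recr /= subnn mulrDl addrA; congr (_ + _); last by ring.
rewrite mulr_suml -big_split /=; apply: eq_bigr => i _.
rewrite subSn; last exact: ltnW.
rewrite big_ord_recr /= mulrDr; congr (_ + _).
have -> : x ^+ n = x ^+ (n - i) * x ^+ i by rewrite -exprD subnK // ltnW.
ring.
Qed.

(** The remainder of the product is [(f - f_n) g] plus
  [sum a_i x^i (g - g_(n-i))]; the [n] terms of the sum cost the factor 2 in the
  radius. *)
Lemma analyticM f g z : @analytic_at C f z -> @analytic_at C g z ->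
  @analytic_at C (fun w => f w * g w) z.
Proof.
move=> /analyticP [a [K [B Hf]]] /analyticP [b [K' [B' Hg]]].
pose M := Num.max B B'.
have {}Hf : expands f z a K M by apply: expands_weak Hf => //; rewrite le_max lexx.
have {}Hg : expands g z b K' M.
  by apply: expands_weak Hg => //; rewrite le_max lexx orbT.
have Ha := expands_coef Hf.
case: Hf Hg => K0 M0 Hf [K0' _ Hg].
apply/analyticP; exists (fun m => \sum_(i < m.+1) a i * b (m - i)%N), (2 * K * K'), (2 * M).
split; rewrite ?mulr_ge0 ?mulr_gt0 // => n x x1.
have nx := normc_ge0 x.
set t := M * normc x.
have t0 : 0 <= t by rewrite mulr_ge0 // ltW.
have t1 : M * normc x <= 1 by rewrite -/t; move: x1; rewrite -mulrA -/t; lra.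
rewrite sum_conv.
have -> : f (z + x) * g (z + x) - \sum_(i < n) a i * x ^+ i * (\sum_(j < n - i) b j * x ^+ j) =
  (f (z + x) - \sum_(i < n) a i * x ^+ i) * g (z + x) +
  \sum_(i < n) a i * x ^+ i * (g (z + x) - \sum_(j < n - i) b j * x ^+ j).
  rewrite mulrBl -addrA; congr (_ + _); rewrite mulr_suml -sumrN -sumrN -big_split /=.
  by apply: eq_bigr => i _; ring.
apply: le_trans (normcD _ _) _.
have H1 : normc ((f (z + x) - \sum_(i < n) a i * x ^+ i) * g (z + x)) <= K * t ^+ n * K'.
  rewrite normcM ler_pM ?normc_ge0 //; first exact: Hf.
  by have := Hg 0%N x t1; rewrite big_ord0 subr0 expr0 mulr1.
have H2 : normc (\sum_(i < n) a i * x ^+ i * (g (z + x) - \sum_(j < n - i) b j * x ^+ j))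
   <= n%:R * (2 * K * K' * t ^+ n).
  apply: le_trans (normc_sum _ _ _) _.
  apply: le_trans (_ : \sum_(i < n) 2 * K * K' * t ^+ n <= _); last first.
    by rewrite sumr_const card_ord [leRHS]mulr_natl.
  apply: ler_sum => i _; rewrite !normcM normcX.
  have := ler_pM _ _ (Ha i) (Hg (n - i)%N x t1).
  rewrite ?normc_ge0 => /(_ isT isT) /(ler_wpM2l (exprn_ge0 i nx)) H.
  apply: le_trans (_ : normc x ^+ i * (normc (a i) *
     normc (g (z + x) - \sum_(i0 < n - i) b i0 * x ^+ i0)) <= _).
    by rewrite mulrCA mulrA.
  apply: le_trans H _; rewrite -/t -[X in t ^+ X](subnKC (ltnW (ltn_ord i))) exprD.
  rewrite le_eqVlt; apply/orP; left; apply/eqP; rewrite /t !exprMn.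
  ring.
apply: le_trans (lerD H1 H2) _.
have n2 : n%:R + 1 <= 2 ^+ n :> R by rewrite -natrX natr1 ler_nat ltn_expl.
have Kt : 0 <= K * K' * t ^+ n by rewrite !mulr_ge0 // exprn_ge0.
rewrite -[2 * M * _]mulrA -/t (exprMn _ 2 t).
have -> : 2 * K * K' * (2 ^+ n * t ^+ n) = 2 * (2 ^+ n) * (K * K' * t ^+ n) by ring.
have -> : K * t ^+ n * K' + n%:R * (2 * K * K' * t ^+ n) = (2 * n%:R + 1) * (K * K' * t ^+ n) by ring.
apply: ler_wpM2r => //; lra.
Qed.

(** Long division of the series 1 by the series [a]: after [n] steps the
  remainder, divided by [x^n], has coefficients [inv_coefs a n], and the [n]-th
  coefficient of the quotient is [inv_coefs a n 0 / a 0]. *)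
Fixpoint inv_coefs a n : nat -> R[i] :=
  if n is n'.+1 then
    fun m => inv_coefs a n' m.+1 - (inv_coefs a n' 0%N / a 0%N) * a m.+1
  else fun m => (m == 0%N)%:R.

Lemma inv_coefsE a n m : inv_coefs a n m =
  ((n + m == 0)%N)%:R - \sum_(j < n) inv_coefs a j 0%N / a 0%N * a (n - j + m)%N.
Proof.
elim: n m => [|n IH] m; first by rewrite big_ord0 subr0.
rewrite /= IH addnS /= big_ord_recr /= subSnn add1n opprD addrA; congr (_ - _ - _).
by apply: eq_bigr => j _; rewrite addnS subSn // ltnW.
Qed.

Lemma inv_conv a n : a 0%N != 0 ->
  \sum_(j < n.+1) inv_coefs a j 0%N / a 0%N * a (n - j)%N = (n == 0)%N%:R.
Proof.
move=> a0; rewrite big_ord_recr /= subnn divfK // inv_coefsE addn0.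
rewrite addrC; apply/eqP; rewrite eq_sym -subr_eq; apply/eqP; congr (_ - _).
by apply: eq_bigr => j _; rewrite addn0.
Qed.

(** The recursion for the coefficients is dominated by a geometric one. *)
Lemma inv_coefs_bound a (K B : R) : a 0%N != 0 -> 0 <= K -> 0 < B ->
  (forall n, normc (a n) <= K * B ^+ n) ->
  forall n, normc (inv_coefs a n 0%N / a 0%N) <=
    (normc (a 0%N))^-1 * (B * (1 + K / normc (a 0%N))) ^+ n.
Proof.
move=> a0 K0 B0 Ha n.
have A0 : 0 < normc (a 0%N) by rewrite normc_gt0.
set A := normc (a 0%N) in A0 *; set M := B * _.
have M0 : 0 < M by rewrite mulr_gt0 // ltr_pwDl // divr_ge0 // ltW.
elim/ltn_ind: n => -[_|n IH].
  by rewrite /= expr0 mulr1 mul1r normcV.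
rewrite normcM normcV mulrC; apply: ler_wpM2l; first by rewrite invr_ge0 ltW.
rewrite inv_coefsE addn0 add0r normcN.
apply: le_trans (normc_sum _ _ _) _.
apply: le_trans (_ : \sum_(j < n.+1) A^-1 * K * B * (M ^+ (n - j) * B ^+ j) <= _).
  rewrite (reindex_inj rev_ord_inj) /=; apply: ler_sum => j _.
  rewrite subSS addn0 normcM.
  have jn : (n - j < n.+1)%N by rewrite ltnS leq_subr.
  apply: le_trans (ler_pM (normc_ge0 _) (normc_ge0 _) (IH _ jn) (Ha _)) _.
  rewrite subSn ?leq_subr // subKn; last by rewrite -ltnS.
  by rewrite exprS le_eqVlt; apply/orP; left; apply/eqP; ring.
rewrite -mulr_sumr.
have MB : M - B = B * K / A by rewrite /M; ring.
have := subrXX M B n.+1; rewrite MB => E.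
have -> : A^-1 * K * B = B * K / A by ring.
have -> : \sum_(i < n.+1) M ^+ (n - i) * B ^+ i = \sum_(i < n.+1) M ^+ (n.+1.-1 - i) * B ^+ i by [].
by rewrite -E gerBl exprn_ge0 // ltW.
Qed.

(** With [e] the quotient series, [1 - f e_n] is a combination of remainders
  of [f], because the coefficients of [a e] are those of 1. *)
Lemma analyticV f z : f z != 0 -> @analytic_at C f z ->
  @analytic_at C (fun w => (f w)^-1) z.
Proof.
move=> fz0 /analyticP [a [K [B Hf]]].
have Ha := expands_coef Hf; have a0E := expands0 Hf; case: Hf => K0 B0 Hf.
have a0 : a 0%N != 0 by rewrite a0E.
have A0 : 0 < normc (a 0%N) by rewrite normc_gt0.
have K2 : 0 <= 2 * K by rewrite mulr_ge0.
have He := inv_coefs_bound a0 K2 B0 Ha.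
set e := fun n => inv_coefs a n 0%N / a 0%N.
set A := normc (a 0%N) in A0 He; set M := B * _ in He.
have K0A : 0 <= K / A by rewrite divr_ge0 // ltW.
have MB : 2 * B * K / A = M - B by rewrite /M; ring.
have BM : B <= M.
  have := mulr_ge0 (ltW B0) K0A.
  have : M - B = 2 * (B * (K / A)) by rewrite /M; ring.
  lra.
have M0 : 0 < M by exact: lt_le_trans BM.
have Me x : 2 * M * normc x <= 1 -> A / 2 <= normc (f (z + x)).
  move=> x1; have nx := normc_ge0 x.
  have Bx : B * normc x <= 1 by nra.
  have := Hf 1%N x Bx; rewrite big_ord1 expr0 mulr1 expr1 => H.
  have KB : K * (B * normc x) <= A / 2.
    have -> : K * (B * normc x) = A / 2 * ((2 * B * K / A) * normc x).
      by field; rewrite gt_eqF.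
    rewrite MB ler_piMr //; [lra | nra].
  have := normcBB (a 0%N) (a 0%N - f (z + x)); rewrite subKr (normcBC (a 0%N)) -/A; lra.
apply/analyticP; exists e, (2 / A + 2 / A * (A^-1 * K)), (2 * M).
have K'0 : 0 <= A^-1 * K by rewrite mulr_ge0 // invr_ge0 ltW.
have A20 : 0 <= 2 / A by rewrite divr_ge0 // ltW.
split; first (by rewrite addr_ge0 // mulr_ge0); first by rewrite mulr_gt0.
move=> n x x1.
have nx := normc_ge0 x.
have fx := Me x x1.
have fx0 : f (z + x) != 0 by rewrite -normc_gt0; apply: lt_le_trans fx; rewrite divr_gt0.
have ifx : normc (f (z + x))^-1 <= 2 / A.
  by rewrite normcV -[2 / A]invf_div lef_pV2 // ?posrE ?divr_gt0 // normc_gt0.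
case: n => [|n].
  rewrite big_ord0 subr0 expr0 mulr1; apply: le_trans ifx _.
  by rewrite lerDl mulr_ge0.
have E : (f (z + x))^-1 - \sum_(i < n.+1) e i * x ^+ i =
  - (f (z + x))^-1 * \sum_(i < n.+1) e i * x ^+ i * (f (z + x) - \sum_(j < n.+1 - i) a j * x ^+ j).
  under [in RHS]eq_bigr => i _ do rewrite mulrBr.
  rewrite sumrB -sum_conv -mulr_suml.
  have conv m : \sum_(i < m.+1) e i * a (m - i)%N = (m == 0%N)%:R.
    exact: inv_conv.
  have -> : \sum_(m < n.+1) (\sum_(i < m.+1) e i * a (m - i)%N) * x ^+ m = 1.
    rewrite big_ord_recl conv mul1r expr0 big1 ?addr0 // => i _.
    by rewrite conv mul0r.
  by field.
rewrite E normcM normcN.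
rewrite mulrDl; apply: le_trans (_ : 2 / A * (A^-1 * K) * (2 * M * normc x) ^+ n.+1 <= _); last first.
  by rewrite lerDr mulr_ge0 // exprn_ge0 // mulr_ge0 // mulr_ge0 // ltW.
rewrite -mulrA; apply: ler_pM; rewrite ?normc_ge0 //.
apply: le_trans (normc_sum _ _ _) _.
have t1 : B * normc x <= 1 by nra.
set t := M * normc x.
apply: le_trans (_ : \sum_(i < n.+1) A^-1 * K * t ^+ n.+1 <= _).
  apply: ler_sum => i _; rewrite normcM [normc (e i * _)]normcM normcX.
  have Bt : (B * normc x) ^+ (n.+1 - i) <= t ^+ (n.+1 - i).
    by apply: lerXn2r; rewrite ?nnegrE ?ler_wpM2r // mulr_ge0 // ltW.
  have H2 := le_trans (Hf (n.+1 - i)%N x t1) (ler_wpM2l K0 Bt).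
  have := ler_pM _ _ (He i) H2.
  rewrite ?normc_ge0 => /(_ isT isT) /(ler_wpM2l (exprn_ge0 i nx)) H.
  apply: le_trans (_ : normc x ^+ i * (normc (e i) *
     normc (f (z + x) - \sum_(i0 < n.+1 - i) a i0 * x ^+ i0)) <= _).
    by rewrite mulrCA mulrA.
  apply: le_trans H _; rewrite -[X in _ <= _ * t ^+ X](subnKC (ltnW (ltn_ord i))) exprD.
  rewrite le_eqVlt; apply/orP; left; apply/eqP; rewrite /t !exprMn.
  ring.
rewrite sumr_const card_ord -[_ *+ _]mulr_natl -[2 * M * normc x]mulrA -/t (exprMn _ 2 t).
have n2 : n.+1%:R <= 2 ^+ n.+1 :> R by rewrite -natrX ler_nat ltnW // ltn_expl.
rewrite mulrCA; apply: ler_wpM2l => //; apply: ler_wpM2r => //.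
by rewrite exprn_ge0 // mulr_ge0 // ltW.
Qed.

Lemma analyticN f z : @analytic_at C f z -> @analytic_at C (fun w => - f w) z.
Proof.
move=> Hf; have := analyticM (analytic_cst (-1) z) Hf.
by apply: (analytic_near ltr01) => w _; rewrite mulN1r.
Qed.

Lemma analyticB f g z : @analytic_at C f z -> @analytic_at C g z ->
  @analytic_at C (fun w => f w - g w) z.
Proof. by move=> Hf Hg; exact: analyticD Hf (analyticN Hg). Qed.

Lemma analytic_prod (I : Type) (s : seq I) (F : I -> R[i] -> R[i]) z :
  (forall i, @analytic_at C (F i) z) ->
  @analytic_at C (fun w => \prod_(i <- s) F i w) z.
Proof.
move=> HF; elim: s => [|i s IH].
  by apply: (analytic_near ltr01) (analytic_cst 1 z) => w _; rewrite big_nil.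
by apply: (analytic_near ltr01) (analyticM (HF i) IH) => w _; rewrite big_cons.
Qed.

(** Dividing by [w - z] shifts the coefficients. *)
Lemma expands_tail f z a (K B : R) : expands f z a K B ->
  exists g, (exists K' B', expands g z (fun n => a n.+1) K' B') /\
    forall w, f w - a 0%N = (w - z) * g w.
Proof.
move=> /[dup] Hf [K0 B0 Hf'].
have Ha := expands_coef Hf.
exists (fun w => if w == z then a 1%N else (f w - a 0%N) / (w - z)); split=> [|w]; last first.
  have [->|wz] := eqVneq; first by rewrite (expands0 Hf) !subrr mul0r.
  by rewrite mulrC divfK // subr_eq0.
exists (2 * K * B), B; split=> [||n x x1] //; first by rewrite !mulr_ge0 // ltW.
rewrite -subr_eq0 addrAC subrr add0r; have [->|x0] := eqVneq x 0.
  rewrite normc0 mulr0; case: n => [|n].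
    by rewrite big_ord0 subr0 expr0 mulr1; have := Ha 1%N; rewrite expr1.
  by rewrite big_ord_recl expr0 mulr1 big1 ?addr0 ?subrr ?normc0 ?expr0n ?mulr0 // => i _; rewrite expr0n mulr0.
have X0 : 0 < normc x by rewrite normc_gt0.
have -> : (f (z + x) - a 0%N) / x - \sum_(i < n) a i.+1 * x ^+ i =
   (f (z + x) - \sum_(i < n.+1) a i * x ^+ i) / x.
  rewrite big_ord_recl /= expr0 mulr1.
  under [in RHS]eq_bigr => i _ do rewrite exprSr mulrA.
  by rewrite -mulr_suml; field.
rewrite normcM normcV ler_pdivrMr //.
apply: le_trans (Hf' _ _ x1) _; rewrite exprSr.
have -> : K * ((B * normc x) ^+ n * (B * normc x)) = K * B * (B * normc x) ^+ n * normc x by ring.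
apply: ler_wpM2r; first exact: ltW.
apply: ler_wpM2r; first by rewrite exprn_ge0 // mulr_ge0 ?ltW.
have := mulr_ge0 K0 (ltW B0); lra.
Qed.

(** The quotient is a shifted power series at [z], and a quotient of
  analytic functions elsewhere. *)
Lemma divided_difference f z : @analytic_at C f z -> exists g,
  (forall w, f w - f z = (w - z) * g w) /\
  (forall w, @analytic_at C f w -> @analytic_at C g w).
Proof.
move=> /analytic_expands [a [K [B Hf]]].
have [g [[K' [B' Hg]] fg]] := expands_tail Hf; rewrite (expands0 Hf) in fg.
exists g; split=> [|w fw]; first exact: fg.
have [->|wz] := eqVneq w z.
  exact: expands_analytic Hg.
have wz0 : w - z != 0 by rewrite subr_eq0.
have d0 : 0 < normc (w - z) by rewrite normc_gt0.
have H2 := analyticB (analytic_id w) (analytic_cst z w).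
have H3 := analyticM (analyticB fw (analytic_cst (f z) w)) (analyticV (f := fun v => v - z) wz0 H2).
apply: (analytic_near d0) H3 => v vw; rewrite fg mulrC mulKf //.
by apply: contraTneq vw => /eqP; rewrite subr_eq0 => /eqP ->; rewrite normcBC ltxx.
Qed.

Lemma analytic_continuous f z : @analytic_at C f z ->
  forall e : R, 0 < e -> exists2 r : R, 0 < r &
    forall w, normc (w - z) < r -> normc (f w - f z) < e.
Proof.
move=> /analyticP [a [K [B Hf]]] e e0; have a0E := expands0 Hf; case: Hf => K0 B0 Hf.
exists (Num.min B^-1 (e / (B * (K + 1)))).
  by rewrite lt_min invr_gt0 B0 divr_gt0 // mulr_gt0 // ltr_wpDl.
move=> w; rewrite lt_min => /andP[w1 w2].
have Bw : B * normc (w - z) <= 1 by rewrite -ler_pdivlMl // mulr1 ltW.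
have := Hf 1%N _ Bw; rewrite [z + (w - z)]addrC subrK big_ord1 expr0 mulr1 expr1 a0E => /le_lt_trans; apply.
move: w2; rewrite ltr_pdivlMr ?mulr_gt0 ?ltr_wpDl //.
have := normc_ge0 (w - z); nra.
Qed.

(** If [a_k] is the first nonzero coefficient after [a_0], then in the
  direction [u] with [a_k u^k] a positive multiple of [f z] the modulus grows like
  [s^k], and the remainder is of order [s^(k+1)]. *)
Lemma local_max_cst f z (r : R) : 0 < r -> @analytic_at C f z ->
  (forall w, normc (w - z) < r -> normc (f w) <= normc (f z)) ->
  exists2 s : R, 0 < s & forall w, normc (w - z) < s -> f w = f z.
Proof.
move=> r0 /analyticP [a [K [B Hf]]] Hmax; have a0E := expands0 Hf; case: Hf => K0 B0 Hf.
have [[k Hk]|Hall] := pselect (exists k, a k.+1 != 0); last first.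
  have {}Hall k : a k.+1 = 0.
    by apply/eqP; apply: contrapT => Hk; apply: Hall; exists k; apply/negP.
  exists (2 * B)^-1 => [|w wz]; first by rewrite invr_gt0 mulr_gt0.
  have Bw : B * normc (w - z) <= 2^-1.
    rewrite -(ler_pM2l (x := 2)) // mulrA divff ?pnatr_eq0 //.
    by rewrite -ler_pdivlMl ?mulr1 ?mulr_gt0 // ltW.
  apply/eqP; rewrite -subr_eq0 -normc_eq0 eq_le normc_ge0 andbT.
  apply/ler_addgt0Pr => e e0; rewrite add0r.
  have [N HN] := halfX_small K0 e0.
  have := Hf N.+1 (w - z); rewrite [z + (w - z)]addrC subrK => /(_ _)/le_trans.
  rewrite big_ord_recl expr0 mulr1 a0E big1 => [|i _]; last by rewrite Hall mul0r.
  rewrite addr0; apply; first lra.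
  by apply/ltW/HN => //; rewrite mulr_ge0 ?normc_ge0 // ltW.
exfalso.
have /ex_minnP [m am mmin] : exists k, a k.+1 != 0 by exists k.
have E n : (n <= m)%N -> \sum_(i < n) a i.+1 = 0 :> R[i].
  by move=> nm; rewrite big1 // => i _; apply/eqP; apply: contraT => /mmin; rewrite leqNgt (leq_trans (ltn_ord i)).
pose b := if f z == 0 then 1 else f z.
have b0 : b != 0 by rewrite /b; have [_|//] := eqVneq (f z) 0; exact: oner_neq0.
(* [b] replaces [f z] when that is 0, where every direction is good. *)
pose u := m.+1.-root (b / a m.+1 : C) : R[i].
have uE : a m.+1 * u ^+ m.+1 = b.
  by rewrite /u rootCK // mulrC divfK.
have u0 : u != 0 by apply: contraNneq b0 => u0; rewrite -uE u0 expr0n mulr0.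
have nu : 0 < normc u by rewrite normc_gt0.
have nb : 0 < normc b by rewrite normc_gt0.
pose q := K * (B * normc u) ^+ m.+2.
have q0 : 0 <= q by rewrite mulr_ge0 // exprn_ge0 // mulr_ge0 ?ltW.
have [s [s0 sr sB sq]] : exists s : R, [/\ 0 < s, s * normc u < r, s * (B * normc u) <= 1 & s * q < normc b].
  exists (Num.min (r / normc u / 2) (Num.min (B * normc u)^-1 (normc b / (q + 1)))).
  have Bu : 0 < B * normc u by rewrite mulr_gt0.
  have q1 : 0 < q + 1 by lra.
  split.
  - by rewrite !lt_min !divr_gt0 // invr_gt0 Bu.
  - apply: (@le_lt_trans _ _ (r / normc u / 2 * normc u)).
      by apply: ler_wpM2r; [exact: ltW | rewrite ge_min lexx].
    have -> : r / normc u / 2 * normc u = r / 2 by field; rewrite gt_eqF.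
    lra.
  - by rewrite -ler_pdivlMr // mul1r !ge_min lexx orbT.
  - apply: (@le_lt_trans _ _ (normc b / (q + 1) * q)).
      by apply: ler_wpM2r => //; rewrite !ge_min lexx !orbT.
    by rewrite mulrAC ltr_pdivrMr // ltr_pM2l //; lra.
pose x := (s%:C)%C * u.
have nx : normc x = s * normc u by rewrite normcM normc_real ger0_norm // ltW.
have := Hmax (z + x); rewrite addrC addKr nx => /(_ sr).
have := Hf m.+2 x; rewrite nx (mulrCA B) => /(_ sB).
rewrite big_ord_recl expr0 mulr1 big_ord_recr /= big1 => [|i _]; last first.
  have -> : a (bump 0 i) = 0; last by rewrite mul0r.
  apply/eqP; apply: contraT => /mmin; rewrite leqNgt; case/negP; exact: ltn_ord.
rewrite /bump leq0n add1n add0r a0E.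
have -> : a m.+1 * x ^+ m.+1 = ((s ^+ m.+1)%:C)%C * b.
  by rewrite exprMn -uE rmorphXn /= mulrCA.
have sm : 0 < s ^+ m.+1 by rewrite exprn_gt0.
have -> : K * (s * (B * normc u)) ^+ m.+2 = s ^+ m.+1 * (s * q).
  by rewrite exprMn /q exprSr; ring.
have nfb : normc (f z + ((s ^+ m.+1)%:C)%C * b) = normc (f z) + s ^+ m.+1 * normc b.
  rewrite /b; case: eqVneq => [->|fz0].
    by rewrite normc0 !add0r normcM normc_real ger0_norm ?(ltW sm).
  have -> : f z + ((s ^+ m.+1)%:C)%C * f z = ((1 + s ^+ m.+1)%:C)%C * f z.
    by rewrite rmorphD /= rmorph1; ring.
  by rewrite normcM normc_real ger0_norm; [ring | lra].
set G := _ + _ in nfb; move=> H1 H2.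
have := normcBB G (G - f (x + z)); rewrite subKr (normcBC G) nfb.
rewrite [x + z]addrC in H2 *.
have : s ^+ m.+1 * (s * q) < s ^+ m.+1 * normc b by rewrite ltr_pM2l.
lra.
Qed.

End PowerSeries.

(** * The maximum principle on the disk *)

Section MaximumPrinciple.
Variable R : realType.
Implicit Types (f g : R[i] -> R[i]) (z w x : R[i]) (a : nat -> R[i]).
Local Notation C := (R[i] : numClosedFieldType).

Lemma compact_max (T : topologicalType) (A : set T) (phi : T -> R) :
  compact A -> A !=set0 ->
  (forall p, A p -> phi q @[q --> within A (nbhs p)] --> phi p) ->
  exists2 p, A p & forall q, A q -> phi q <= phi p.
Proof.
move=> cA [p0 Ap0] Hphi.
have : {within A, continuous phi} by apply/subspace_continuousP.
move=> /continuous_compact => /(_ cA) cK.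
set K := [set phi x | x in A] in cK.
have K0 : K !=set0 by exists (phi p0); exists p0.
have [_ ub] := compact_has_sup K0 cK.
have := compact_closed (@Rhausdorff R) cK (closure_sup K0 ub).
move=> [p Ap pE]; exists p => // q Aq; rewrite pE.
by apply: ub_le_sup => //; exists q.
Qed.

Lemma normc_Re z : `|complex.Re z| <= normc z.
Proof. by rewrite -lecR; exact: normc_ge_Re. Qed.

Lemma normc_Im z : `|complex.Im z| <= normc z.
Proof.
case: z => a b /=; rewrite -[`|b|]sqrtr_sqr ler_sqrt ?addr_ge0 ?sqr_ge0 //.
by rewrite lerDr sqr_ge0.
Qed.

Lemma normc_ReIm (a b : R) : normc (a +i* b)%C <= `|a| + `|b|.
Proof.
have -> : (a +i* b)%C = (a%:C + (0 +i* b))%C by rewrite /= ; congr Complex; rewrite ?addr0 ?add0r.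
apply: le_trans (normcD _ _) _; rewrite normc_real lerD2l /=.
by rewrite expr0n add0r sqrtr_sqr.
Qed.

(** The compactness of rectangles, transported to [R[i]]. *)
Lemma plane_max (A : R[i] -> Prop) (phi : R[i] -> R) (r : R) :
  (exists z, A z) -> (forall z, A z -> normc z <= r) ->
  (forall z, ~ A z -> exists2 s : R, 0 < s & forall w, normc (w - z) < s -> ~ A w) ->
  (forall z, A z -> forall e : R, 0 < e -> exists2 s : R, 0 < s &
     forall w, A w -> normc (w - z) < s -> `|phi w - phi z| < e) ->
  exists2 z, A z & forall w, A w -> phi w <= phi z.
Proof.
move=> [z0 Az0] Abd Acl Hphi.
pose io (p : R * R) : R[i] := (p.1 +i* p.2)%C.
have ioK z : io (complex.Re z, complex.Im z) = z by case: z.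
have nio p q s : ball p (s / 2) q -> normc (io q - io p) < s.
  case: p q => [p1 p2] [q1 q2] [] /=; rewrite /ball /= => H1 H2.
  apply: le_lt_trans (normc_ReIm _ _) _; rewrite distrC (distrC q2); lra.
pose B := [set p | A (io p)] : set (R * R).
have cB : compact B.
  apply: (@subclosed_compact _ _ (`[- r, r]%classic `*` `[- r, r]%classic)).
  - move=> p; rewrite /closure /= => Hp; apply: contrapT => /Acl [s s0 Hs].
    have [|q [Bq /nio/Hs]] := Hp (ball p (s / 2)); last exact.
    by apply: nbhsx_ballx; rewrite divr_gt0.
  - by apply: compact_setX; exact: segment_compact.
  move=> [p1 p2] Bp; have := Abd _ Bp => Hr.
  split=> /=; rewrite in_itv /= -ler_norml; apply: le_trans Hr.
    exact: (normc_Re (p1 +i* p2)%C).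
  exact: (normc_Im (p1 +i* p2)%C).
have [|p Bp|p Bp pmax] := @compact_max _ B (phi \o io) cB.
- by exists (complex.Re z0, complex.Im z0); rewrite /B /= ioK.
- apply/cvgrPdistC_lt => e e0.
  have [s s0 Hs] := Hphi _ Bp e e0.
  rewrite near_withinE; apply/nbhs_ballP; exists (s / 2) => /=; first by rewrite divr_gt0.
  by move=> q pq Bq; apply: Hs => //; apply: nio.
exists (io p) => // w Aw.
by have := pmax (complex.Re w, complex.Im w); rewrite /B /= !ioK; apply.
Qed.

(** Conditions at the unit circle are imposed on an annulus inside it, so that
  no boundary values are needed. *)
Definition near_bdry (Q : R[i] -> Prop) :=
  exists2 r : R, r < 1 & forall z, r < normc z -> normc z < 1 -> Q z.

Lemma near_bdryI (P Q : R[i] -> Prop) : near_bdry P -> near_bdry Q ->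
  near_bdry (fun z => P z /\ Q z).
Proof.
move=> [r r1 HP] [s s1 HQ]; exists (Num.max r s); first by rewrite gt_max r1.
by move=> z; rewrite gt_max => /andP[? ?] ?; split; [apply: HP | apply: HQ].
Qed.

Lemma near_bdryW (P Q : R[i] -> Prop) : (forall z, normc z < 1 -> P z -> Q z) ->
  near_bdry P -> near_bdry Q.
Proof. by move=> PQ [r r1 HP]; exists r => // z ? ?; apply: PQ => //; apply: HP. Qed.

Definition analytic_disk f := forall z, normc z < 1 -> @analytic_at C f z.

(** Otherwise the modulus has a maximum over a smaller closed disk at an
  interior point. Among the maximum points take one of largest modulus: by
  [local_max_cst] the function is constant near it, so there is another one
  further out. *)
Lemma max_principle f (M : R) : analytic_disk f ->
  (forall e : R, 0 < e -> near_bdry (fun z => normc (f z) <= M + e)) ->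
  forall z, normc z < 1 -> normc (f z) <= M.
Proof.
move=> Hf HM z1 z11; rewrite leNgt; apply/negP => Mz.
pose e := (normc (f z1) - M) / 2.
have e0 : 0 < e by rewrite divr_gt0 // subr_gt0.
have [r0 r01 Hr0] := HM _ e0.
pose r := (Num.max (Num.max r0 (normc z1)) 0 + 1) / 2.
have mx1 : Num.max (Num.max r0 (normc z1)) 0 < 1 by rewrite !gt_max r01 z11 ltr01.
have r1 : r < 1 by rewrite /r; lra.
have rm : Num.max (Num.max r0 (normc z1)) 0 < r by rewrite /r; lra.
move: rm; rewrite !gt_max => /andP[/andP[r0r z1r] rp].
have cont z : normc z <= r -> forall e : R, 0 < e -> exists2 s : R, 0 < s &
   forall w, normc (w - z) < s -> `|normc (f w) - normc (f z)| < e.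
  move=> zr e' e'0.
  have [s s0 Hs] := analytic_continuous (Hf z (le_lt_trans zr r1)) e'0.
  exists s => // w /Hs H; rewrite ltr_norml.
  have := normcBB (f w) (f z); have := normcBB (f z) (f w).
  rewrite (normcBC (f z)); lra.
have dcl z : ~ (normc z <= r) -> exists2 s : R, 0 < s & forall w, normc (w - z) < s -> ~ (normc w <= r).
  move/negP; rewrite -ltNge => zr; exists (normc z - r) => [|w]; first by rewrite subr_gt0.
  move=> wz; apply/negP; rewrite -ltNge.
  have := normcBB z (z - w); rewrite subKr (normcBC z); lra.
have [||z Hz|z0 z0r z0m] := @plane_max (fun z => normc z <= r) (fun z => normc (f z)) r _ _ dcl _.
- by exists z1; rewrite ltW.
- by [].
- by move=> e' e'0; have [s s0 Hs] := cont z Hz e' e'0; exists s => // w _; apply: Hs.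
have z0M : M + e < normc (f z0).
  by apply: lt_le_trans (z0m z1 (ltW z1r)); rewrite /e; lra.
(* [A] is the set of maximum points over the closed disk of radius [r]. *)
pose A z := normc z <= r /\ normc (f z0) <= normc (f z).
have [||z||z2 [z2r z2f] z2m] := @plane_max A (@normc R) r.
- by exists z0.
- by move=> z [].
- move=> nA; have [zr|zr] := pselect (normc z <= r); last first.
    by have [s s0 Hs] := dcl z zr; exists s => // w /Hs H []; move/H.
  have fz : normc (f z) < normc (f z0).
    by rewrite ltNge; apply/negP => H; apply: nA.
  have [s s0 Hs] := cont z zr (normc (f z0) - normc (f z)) ltac:(by rewrite subr_gt0).
  exists s => // w /Hs H [_]; apply/negP; rewrite -ltNge.
  by have := ler_norm (normc (f w) - normc (f z)); lra.
- move=> z _ e' e'0; exists e' => // w _ H; apply: le_lt_trans H; rewrite ler_norml.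
  have := normcBB w z; have := normcBB z w; rewrite (normcBC z); lra.
have z2r0 : normc z2 <= r0.
  rewrite leNgt; apply/negP => H.
  by have := Hr0 z2 H (le_lt_trans z2r r1); lra.
have z2lt : normc z2 < r by apply: le_lt_trans r0r.
have [|||s s0 Hs] := @local_max_cst R f z2 (r - normc z2).
- by rewrite subr_gt0.
- by apply: Hf; apply: lt_trans r1.
- move=> w wz; apply: le_trans (z0m w _) _ => //.
  by have := normcBB w z2; lra.
pose t := Num.min (s / 2) ((r - normc z2) / 2).
have t0 : 0 < t by rewrite lt_min !divr_gt0 // subr_gt0.
have ts : t < s by rewrite gt_min; apply/orP; left; lra.
have tr : t < r - normc z2 by rewrite gt_min; apply/orP; right; lra.
(* The outward direction at the extremal maximum point. *)
pose u : R[i] := if z2 == 0 then 1 else z2 / ((normc z2)%:C)%C.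
have nu : normc u = 1.
  rewrite /u; case: eqVneq => [_|z20]; first exact: normc1.
  by rewrite normcM normcV normc_real ger0_norm ?normc_ge0 // divff // normc_eq0.
have zu : normc (z2 + (t%:C)%C * u) = normc z2 + t.
  rewrite /u; case: eqVneq => [->|z20].
    by rewrite mulr1 !add0r normc0 add0r normc_real ger0_norm // ltW.
  have n0 : ((normc z2)%:C)%C != 0 :> R[i].
    by rewrite -normc_eq0 normc_real normr_eq0 normc_eq0.
  have -> : z2 + (t%:C)%C * (z2 / ((normc z2)%:C)%C) = ((1 + t / normc z2)%:C)%C * z2.
    by rewrite rmorphD /= rmorph1 rmorphM fmorphV /=; field.
  have np : 0 < normc z2 by rewrite normc_gt0.
  rewrite normcM normc_real ger0_norm ?addr_ge0 ?divr_ge0 // ?ltW //.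
  by field; rewrite gt_eqF.
have fE : f (z2 + (t%:C)%C * u) = f z2.
  by apply: Hs; rewrite addrC addKr normcM nu normc_real ger0_norm ?mulr1 // ltW.
have : A (z2 + (t%:C)%C * u).
  by split; rewrite ?fE // zu; lra.
by move/z2m; rewrite zu; lra.
Qed.

End MaximumPrinciple.

(** * Derivatives and Taylor coefficients *)

Section Derivatives.
Variable R : realType.
Implicit Types (f g : R[i] -> R[i]) (z w x : R[i]) (a : nat -> R[i]).
Local Notation C := (R[i] : numClosedFieldType).

Lemma real_series_cvg (u : nat -> R) (K : R) :
  (forall i, `|u i| <= K * 2^-1 ^+ i) ->
  exists l : R, forall e : R, 0 < e ->
    exists N, forall n, (N <= n)%N -> `|\sum_(i < n) u i - l| < e.
Proof.
move=> Hu.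
have cv : cvgn (series u).
  apply: (@normed_cvg _ R^o).
  have Hv n : `|u n| <= geometric K 2^-1 n by exact: Hu.
  apply: (@series_le_cvg _ _ (geometric K 2^-1)) => [n|n|//|].
  - exact: normr_ge0.
  - exact: le_trans (normr_ge0 _) (Hv n).
  apply: is_cvg_geometric_series.
  by rewrite ger0_norm ?invr_ge0 // invf_lt1 // ltr1n.
exists (limn (series u)) => e e0.
have /cvgrPdistC_lt /(_ e e0) [N _ HN] := cv.
by exists N => n /HN; rewrite /series /= big_mkord.
Qed.

Lemma lim_le (F X : R[i]) (S : nat -> R[i]) (b : R) n0 :
  (forall e : R, 0 < e -> exists N, forall n, (N <= n)%N -> normc (F - S n) < e) ->
  (forall n, (n0 <= n)%N -> normc (S n - X) <= b) -> normc (F - X) <= b.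
Proof.
move=> HF HS; apply/ler_addgt0Pr => e e0; have [N HN] := HF e e0.
have -> : F - X = (F - S (maxn N n0)) + (S (maxn N n0) - X) by ring.
apply: le_trans (normcD _ _) _; rewrite addrC; apply: lerD.
  by apply: HS; rewrite leq_maxr.
by apply/ltW/HN; rewrite leq_maxl.
Qed.

(** Convergence is reduced to the real and imaginary parts. *)
Lemma power_series_sum z a (K B : R) : 0 <= K -> 0 < B ->
  (forall n, normc (a n) <= K * B ^+ n) ->
  exists f, expands f z a (2 * K) (2 * B).
Proof.
move=> K0 B0 Ha.
have term x i : 2 * B * normc x <= 1 -> normc (a i * x ^+ i) <= K * 2^-1 ^+ i.
  move=> x1; rewrite normcM normcX.
  apply: le_trans (ler_wpM2r (exprn_ge0 i (normc_ge0 x)) (Ha i)) _.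
  rewrite -mulrA -exprMn; apply: ler_wpM2l => //.
  apply: lerXn2r; rewrite ?nnegrE ?invr_ge0 ?mulr_ge0 ?normc_ge0 ?(ltW B0) //.
  move: x1; rewrite -mulrA; lra.
have ex x : exists l, 2 * B * normc x <= 1 ->
    forall n, normc (l - \sum_(i < n) a i * x ^+ i) <= 2 * K * (2 * B * normc x) ^+ n.
  have [x1|] := pselect (2 * B * normc x <= 1); last by exists 0.
  have [l1 Hl1] := @real_series_cvg (fun i => complex.Re (a i * x ^+ i)) K
    (fun i => le_trans (normc_Re _) (term x i x1)).
  have [l2 Hl2] := @real_series_cvg (fun i => complex.Im (a i * x ^+ i)) K
    (fun i => le_trans (normc_Im _) (term x i x1)).
  exists (l1 +i* l2)%C => _ n.
  apply: (@lim_le _ _ (fun m => \sum_(i < m) a i * x ^+ i) _ n).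
    move=> e e0; have e2 : 0 < e / 2 by rewrite divr_gt0.
    have [N1 HN1] := Hl1 _ e2; have [N2 HN2] := Hl2 _ e2.
    exists (maxn N1 N2) => m; rewrite geq_max => /andP[m1 m2].
    have -> : (l1 +i* l2)%C - \sum_(i < m) a i * x ^+ i =
       ((l1 - \sum_(i < m) complex.Re (a i * x ^+ i)) +i*
        (l2 - \sum_(i < m) complex.Im (a i * x ^+ i)))%C.
      have -> : \sum_(i < m) a i * x ^+ i = ((\sum_(i < m) complex.Re (a i * x ^+ i)) +i*
        (\sum_(i < m) complex.Im (a i * x ^+ i)))%C; last by [].
      elim: (m) => [|k IH]; first by rewrite !big_ord0.
      by rewrite !big_ord_recr /= IH; case: (a k * _).
    apply: le_lt_trans (normc_ReIm _ _) _.
    have := HN1 m m1; have := HN2 m m2; rewrite distrC => H1; rewrite distrC => H2; lra.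
  move=> m nm.
  rewrite -(big_mkord xpredT (fun i => a i * x ^+ i)).
  rewrite (big_cat_nat _ (n := n)) //= big_mkord addrAC subrr add0r.
  apply: le_trans (normc_sum _ _ _) _.
  set t := 2 * B * normc x in x1 *.
  have t0 : 0 <= t by rewrite !mulr_ge0 ?normc_ge0 // ltW.
  apply: le_trans (_ : \sum_(n <= i < m) K * t ^+ n * 2^-1 ^+ i <= _).
    rewrite big_nat_cond [leRHS]big_nat_cond; apply: ler_sum => i /andP[/andP[ni _] _].
    rewrite normcM normcX.
    apply: le_trans (ler_wpM2r (exprn_ge0 i (normc_ge0 x)) (Ha i)) _.
    have -> : K * B ^+ i * normc x ^+ i = K * t ^+ i * 2^-1 ^+ i.
      rewrite -mulrA -exprMn -[RHS]mulrA -exprMn; congr (_ * _ ^+ _).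
      by rewrite /t; field.
    apply: ler_wpM2r; first by rewrite exprn_ge0 // invr_ge0.
    by apply: ler_wpM2l => //; exact: ler_wiXn2l.
  rewrite -mulr_sumr mulrC -[2 * K * _]mulrA.
  apply: ler_wpM2r; last exact: sum_half.
  by rewrite mulr_ge0 // exprn_ge0.
have [F HF] := choice ex.
exists (fun w => F (w - z)); split; rewrite ?mulr_ge0 ?mulr_gt0 // => n x x1.
by rewrite [z + x]addrC addrK; exact: HF.
Qed.

Lemma pow_increment (x h : R[i]) (r : R) m : 0 < r ->
  normc x <= r -> normc (x + h) <= r ->
  r * normc ((x + h) ^+ m.+1 - x ^+ m.+1 - m.+1%:R * x ^+ m * h) <=
  (2 * (2 * r)) ^+ m * normc h ^+ 2.
Proof.
move=> r0 xr xhr.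
have m4 : (m.+1%:R ^+ 2 : R) <= 4 ^+ m.
  have -> : (4 : R) = 2 ^+ 2 by rewrite expr2; lra.
  rewrite exprAC; apply: lerXn2r; rewrite ?nnegrE ?ler0n ?exprn_ge0 //.
  by rewrite -natrX ler_nat; exact: ltn_expl.
suff H : r * normc ((x + h) ^+ m.+1 - x ^+ m.+1 - m.+1%:R * x ^+ m * h) <=
    m.+1%:R ^+ 2 * r ^+ m * normc h ^+ 2.
  apply: le_trans H _; apply: ler_wpM2r; first by rewrite exprn_ge0 // normc_ge0.
  have -> : 2 * (2 * r) = 4 * r by ring.
  rewrite exprMn; apply: ler_wpM2r => //; rewrite exprn_ge0 // ltW //.
elim: {m4} m => [|m IH].
  have -> : (x + h) ^+ 1 - x ^+ 1 - 1%:R * x ^+ 0 * h = 0.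
    by rewrite !expr1 expr0; ring.
  by rewrite normc0 mulr0 !mulr_ge0 ?exprn_ge0 ?normc_ge0 // ltW.
set E := _ - _ - _ in IH.
have -> : (x + h) ^+ m.+2 - x ^+ m.+2 - m.+2%:R * x ^+ m.+1 * h =
   (x + h) * E + m.+1%:R * x ^+ m * h ^+ 2.
  rewrite /E !exprS -[m.+2%:R]natr1; ring.
have H1 : r * normc ((x + h) * E) <= r * (m.+1%:R ^+ 2 * r ^+ m * normc h ^+ 2).
  rewrite normcM mulrCA; apply: ler_pM => //; rewrite ?normc_ge0 //.
  by rewrite mulr_ge0 ?normc_ge0 // ltW.
have H2 : r * normc (m.+1%:R * x ^+ m * h ^+ 2) <= r * (m.+1%:R * r ^+ m * normc h ^+ 2).
  apply: ler_wpM2l; first exact: ltW.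
  rewrite normcM [normc (_ * x ^+ m)]normcM !normcX normc_nat; apply: ler_wpM2r; first by rewrite exprn_ge0 // normc_ge0.
  apply: ler_wpM2l; first exact: ler0n.
  by apply: lerXn2r; rewrite ?nnegrE ?normc_ge0 // ltW.
apply: le_trans (_ : r * (normc ((x + h) * E) + normc (m.+1%:R * x ^+ m * h ^+ 2)) <= _).
  by apply: ler_wpM2l; [exact: ltW | exact: normcD].
rewrite mulrDr; apply: le_trans (lerD H1 H2) _.
rewrite [r ^+ m.+1]exprS -[m.+2%:R]natr1.
have p1 : 0 <= r ^+ m by rewrite exprn_ge0 // ltW.
have p2 : 0 <= normc h ^+ 2 by rewrite exprn_ge0 // normc_ge0.
have p3 : 0 <= r * r ^+ m * normc h ^+ 2.
  by rewrite mulr_ge0 // mulr_ge0 // ltW.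
have p4 : 0 <= m.+1%:R :> R by exact: ler0n.
have -> : r * (m.+1%:R ^+ 2 * r ^+ m * normc h ^+ 2) + r * (m.+1%:R * r ^+ m * normc h ^+ 2)
  = (m.+1%:R ^+ 2 + m.+1%:R) * (r * r ^+ m * normc h ^+ 2) by ring.
rewrite -[X in _ <= X]mulrA; apply: ler_wpM2r => //; nra.
Qed.

Lemma derive1P f w l (r K : R) : 0 < r ->
  (forall h, normc h < r -> normc (f (w + h) - f w - h * l) <= K * normc h ^+ 2) ->
  @derive1 C C^o f w = l.
Proof.
move=> r0 Hf; rewrite /derive1; apply: cvg_lim; first exact: norm_hausdorff.
apply/(@cvgCP R) => e e0; apply/dnbhsCP.
exists (Num.min r (e / (`|K| + 1))).
  by rewrite lt_min r0 divr_gt0 // ltr_wpDl.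
move=> h h0; rewrite subr0 lt_min => /andP[hr he].
have := Hf h hr; rewrite [h + w]addrC => H.
have nh : 0 < normc h by rewrite normc_gt0.
have -> : h^-1 *: (f (w + h) - f w : C^o) - l = (f (w + h) - f w - h * l) / h.
  by rewrite /GRing.scale /=; field.
rewrite normcM normcV ltr_pdivrMr //; apply: le_lt_trans H _.
rewrite expr2 mulrA ltr_pM2r //.
move: he; rewrite ltr_pdivlMr ?ltr_wpDl // => he.
have := ler_norm K; nra.
Qed.

(** The difference quotient is compared with the termwise derivative on
  partial sums, where [pow_increment] bounds each term by a geometric one. *)
Lemma expands_derive f z a (K B : R) : expands f z a K B ->
  exists f1 K1 B1, expands f1 z (fun m => m.+1%:R * a m.+1) K1 B1 /\
  exists2 r : R, 0 < r & forall w, normc (w - z) < r -> @derive1 C C^o f w = f1 w.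
Proof.
move=> Hf; have Ha := expands_coef Hf; case: Hf => K0 B0 Hf.
have [|||f1 Hf1] := @power_series_sum z (fun m => m.+1%:R * a m.+1) (2 * K * B) (2 * B).
- by rewrite !mulr_ge0 // ltW.
- by rewrite mulr_gt0.
- move=> n; rewrite normcM normc_nat.
  apply: le_trans (ler_wpM2l (ler0n _ _) (Ha n.+1)) _.
  rewrite exprMn exprS.
  have -> : 2 * K * B * (2 ^+ n * B ^+ n) = 2 ^+ n * (2 * K * (B * B ^+ n)) by ring.
  apply: ler_wpM2r; first by rewrite !mulr_ge0 ?exprn_ge0 // ltW.
  by rewrite -natrX ler_nat; exact: ltn_expl.
exists f1, (2 * (2 * K * B)), (2 * (2 * B)); split=> //.
case: Hf1 => K10 B10 Hf1.
pose r := (8 * B)^-1; have r0 : 0 < r by rewrite invr_gt0 mulr_gt0.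
have rB : B * r = 8^-1 by rewrite /r; field; rewrite gt_eqF.
exists (r / 2) => [|w wz]; first by rewrite divr_gt0.
apply: (@derive1P _ _ _ (r / 2) (32 * K * B / r)); first by rewrite divr_gt0.
move=> h hr; set x := w - z in wz.
have wE : w = z + x by rewrite /x; ring.
rewrite wE -[z + x + h]addrA.
have xr : normc x <= r by lra.
have xhr : normc (x + h) <= r by have := normcD x h; lra.
have mono y : normc y <= r -> B * normc y <= 8^-1 by rewrite -rB ler_pM2l.
have tx : B * normc x <= 2^-1 by have := mono _ xr; lra.
have txh : B * normc (x + h) <= 2^-1 by have := mono _ xhr; lra.
have t1x : 2 * (2 * B) * normc x <= 2^-1.
  by have := mono _ xr; rewrite -!mulrA; lra.
pose S n := \sum_(i < n.+1) a i * (x + h) ^+ i - \sum_(i < n.+1) a i * x ^+ i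
   - h * \sum_(i < n) i.+1%:R * a i.+1 * x ^+ i.
have -> : f (z + (x + h)) - f (z + x) - h * f1 (z + x) =
  (f (z + (x + h)) - f (z + x) - h * f1 (z + x)) - 0 by rewrite subr0.
apply: (@lim_le _ _ S _ 0%N).
  move=> e e0; have e3 : 0 < e / 3 by rewrite divr_gt0.
  have [N1 HN1] := halfX_small K0 e3.
  have hK : 0 <= normc h * (2 * (2 * K * B)) by rewrite mulr_ge0 ?normc_ge0.
  have [N2 HN2] := halfX_small hK e3.
  exists (maxn N1 N2) => n; rewrite geq_max => /andP[n1 n2].
  have -> : f (z + (x + h)) - f (z + x) - h * f1 (z + x) - S n =
    (f (z + (x + h)) - \sum_(i < n.+1) a i * (x + h) ^+ i) -
    (f (z + x) - \sum_(i < n.+1) a i * x ^+ i) -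
    h * (f1 (z + x) - \sum_(i < n) i.+1%:R * a i.+1 * x ^+ i) by rewrite /S; ring.
  apply: le_lt_trans (normcB _ _) _.
  have H1 := Hf n.+1 (x + h) ltac:(lra).
  have H2 := Hf n.+1 x ltac:(lra).
  have H3 := Hf1 n x ltac:(lra).
  have G1 := HN1 n.+1 (leqW n1) _ (mulr_ge0 (ltW B0) (normc_ge0 (x + h))) txh.
  have G2 := HN1 n.+1 (leqW n1) _ (mulr_ge0 (ltW B0) (normc_ge0 x)) tx.
  have G3 := HN2 n n2 _ (mulr_ge0 (ltW B10) (normc_ge0 x)) t1x.
  have H4 : normc (h * (f1 (z + x) - \sum_(i < n) i.+1%:R * a i.+1 * x ^+ i)) < e / 3.
    rewrite normcM; apply: le_lt_trans G3.
    by rewrite -[X in _ <= X]mulrA; apply: ler_wpM2l => //; exact: normc_ge0.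
  have := normcB (f (z + (x + h)) - \sum_(i < n.+1) a i * (x + h) ^+ i) (f (z + x) - \sum_(i < n.+1) a i * x ^+ i).
  lra.
move=> n _; rewrite subr0.
have -> : S n = \sum_(i < n) a i.+1 * ((x + h) ^+ i.+1 - x ^+ i.+1 - i.+1%:R * x ^+ i * h).
  rewrite /S !big_ord_recl !expr0 mulr_sumr.
  have EE (u v v' w' : R[i]) : u + v - (u + v') - w' = v - v' - w' by ring.
  rewrite EE -!sumrB; apply: eq_bigr => i _; rewrite !lift0; ring.
apply: le_trans (normc_sum _ _ _) _.
apply: le_trans (_ : \sum_(i < n) (16 * K * B / (8 * r)) * 2^-1 ^+ i * normc h ^+ 2 <= _).
  apply: ler_sum => i _; rewrite normcM.
  have := pow_increment i r0 xr xhr; set E := normc (_ - _) => HE.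
  have HE' : E <= (2 * (2 * r)) ^+ i * normc h ^+ 2 / r by rewrite ler_pdivlMr // mulrC.
  apply: le_trans (ler_pM (normc_ge0 _) (normc_ge0 _) (Ha i.+1) HE') _.
  rewrite le_eqVlt; apply/orP; left; apply/eqP.
  have -> : (2 * (2 * r)) ^+ i = (2^-1 / B) ^+ i.
    by congr (_ ^+ _); rewrite /r; field; rewrite gt_eqF.
  have <- : B ^+ i * (2^-1 / B) ^+ i = 2^-1 ^+ i.
    by rewrite -exprMn; congr (_ ^+ _); field; rewrite gt_eqF.
  by rewrite exprS; field; rewrite gt_eqF.
rewrite -mulr_suml -mulr_sumr.
apply: ler_wpM2r; first by rewrite exprn_ge0 // normc_ge0.
have := sum_half R 0%N n; rewrite big_mkord => H.
apply: le_trans (ler_wpM2l _ H) _.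
  by rewrite divr_ge0 ?mulr_ge0 // ltW.
rewrite -subr_ge0.
have -> : 32 * K * B / r - 16 * K * B / (8 * r) * 2 = 28 * K * B / r.
  by field; rewrite gt_eqF.
by rewrite divr_ge0 ?mulr_ge0 // ltW.
Qed.

Lemma derive1n_expands j f z a (K B : R) : expands f z a K B ->
  @derive1n C C^o j f z = j`!%:R * a j.
Proof.
elim: j f a K B => [|j IH] f a K B Hf.
  by rewrite /derive1n /= fact0 mul1r (expands0 Hf).
have [f1 [K1 [B1 [Hf1 [r r0 Hr]]]]] := expands_derive Hf.
have [B2 HB2] := expands_near r0 (fun w H => esym (Hr w H)) Hf1.
rewrite /derive1n iterSr; have := IH _ _ _ _ HB2; rewrite /derive1n => ->.
by rewrite factS natrM; ring.
Qed.

Lemma expands_cons f g z c a (K B : R) : expands g z a K B ->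
  (forall w, f w = c + (w - z) * g w) ->
  exists K' B', expands f z (fun n => if n is m.+1 then a m else c) K' B'.
Proof.
move=> [K0 B0 Hg] Hf; exists (normc c + K / B), B; split=> // [|n x x1].
  by rewrite addr_ge0 ?normc_ge0 // divr_ge0 // ltW.
have Bx : 0 <= B * normc x by rewrite mulr_ge0 ?normc_ge0 // ltW.
have -> : f (z + x) = c + x * g (z + x) by rewrite Hf; congr (_ + _ * _); ring.
have xg : normc (x * (g (z + x) - \sum_(i < n.-1) a i * x ^+ i)) <= K / B * ((B * normc x) ^+ n.-1 * (B * normc x)).
  rewrite normcM; apply: le_trans (ler_wpM2l (normc_ge0 _) (Hg _ _ x1)) _.
  by rewrite le_eqVlt; apply/orP; left; apply/eqP; field; rewrite gt_eqF.
case: n xg => [|n] xg.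
  rewrite big_ord0 subr0 expr0 mulr1; apply: le_trans (normcD _ _) _; rewrite lerD2l.
  move: xg; rewrite big_ord0 subr0 expr0 mul1r => /le_trans; apply.
  by rewrite ler_piMr // divr_ge0 // ltW.
rewrite big_ord_recl /= expr0 mulr1.
have -> : c + x * g (z + x) - (c + \sum_(i < n) a i * x ^+ bump 0 i) =
   x * (g (z + x) - \sum_(i < n) a i * x ^+ i).
  rewrite mulrBr mulr_sumr.
  have -> : \sum_(i < n) a i * x ^+ bump 0 i = \sum_(i < n) x * (a i * x ^+ i).
    by apply: eq_bigr => i _; rewrite /bump leq0n add1n exprS; ring.
  ring.
apply: le_trans xg _; rewrite -exprSr; apply: ler_wpM2r; first by rewrite exprn_ge0.
by rewrite lerDr normc_ge0.
Qed.

(** The converse of [expands_tail]: a chain of [n] exact divisions by [w - z]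
  determines the first [n] Taylor coefficients. *)
Lemma tails_expand n (psi : nat -> R[i] -> R[i]) (c : nat -> R[i]) z :
  @analytic_at C (psi n) z ->
  (forall m w, (m < n)%N -> psi m w - c m = (w - z) * psi m.+1 w) ->
  exists a K B, expands (psi 0%N) z a K B /\ forall m, (m < n)%N -> a m = c m.
Proof.
elim: n psi c => [|n IH] psi c Hn Hpsi.
  by have [a [K [B H]]] := analytic_expands Hn; exists a, K, B.
have [||a [K [B [H Ha]]]] := IH (fun m => psi m.+1) (fun m => c m.+1).
- exact: Hn.
- by move=> m w mn; rewrite Hpsi.
have [|K' [B' H']] := @expands_cons (psi 0%N) _ _ (c 0%N) _ _ _ H.
  by move=> w; rewrite -Hpsi // addrC subrK.
by exists (fun k => if k is m.+1 then a m else c 0%N), K', B'; split=> // -[|m] //; exact: Ha.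
Qed.

End Derivatives.

(** * Bounded analytic functions and their zeros *)

Section BoundedAnalytic.
Variable R : realType.
Implicit Types (f g : R[i] -> R[i]) (z w x : R[i]).
Local Notation C := (R[i] : numClosedFieldType).

Lemma Re_mul (x y : R[i]) : complex.Re (x * y) =
  complex.Re x * complex.Re y - complex.Im x * complex.Im y.
Proof. by case: x => a b; case: y. Qed.

Lemma ReD (x y : R[i]) : complex.Re (x + y) = complex.Re x + complex.Re y.
Proof. by case: x => a b; case: y. Qed.

Lemma normc_sqr z : normc z ^+ 2 = complex.Re z ^+ 2 + complex.Im z ^+ 2.
Proof. by case: z => a b; rewrite /normc sqr_sqrtr // addr_ge0 ?sqr_ge0. Qed.

Lemma Re_le_normc z : complex.Re z <= normc z.
Proof. exact: le_trans (ler_norm _) (normc_Re z). Qed.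

Lemma ReC z : complex.Re (z^*)%R = complex.Re z.
Proof. by case: z. Qed.

Lemma ImC z : complex.Im (z^*)%R = - complex.Im z.
Proof. by case: z. Qed.

Lemma Re_real (r : R) : complex.Re (r%:C)%C = r. Proof. by []. Qed.

Lemma Im_real (r : R) : complex.Im (r%:C)%C = 0. Proof. by []. Qed.

Lemma normc2_sub z w : normc (z - w) ^+ 2 =
  normc z ^+ 2 + normc w ^+ 2 - 2 * complex.Re (z * (w^*)%R).
Proof.
rewrite !normc_sqr Re_mul ReC ImC.
have -> : complex.Re (z - w) = complex.Re z - complex.Re w by case: z; case: w.
have -> : complex.Im (z - w) = complex.Im z - complex.Im w by case: z; case: w.
ring.
Qed.

(** The Hardy algebra of the disk; the lemmas on it have the prefix [ban]. *)
Definition bounded_analytic f :=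
  analytic_disk f /\ exists K : R, forall z, normc z < 1 -> normc (f z) <= K.

Lemma analytic_disk_ext f g : (forall z, normc z < 1 -> f z = g z) ->
  analytic_disk f -> analytic_disk g.
Proof.
move=> fg Hf z z1; apply: (@analytic_near R f g z (1 - normc z)).
- by rewrite subr_gt0.
- by move=> w wz; apply: fg; have := normcBB w z; lra.
- exact: Hf.
Qed.

Lemma ban_ext f g : (forall z, normc z < 1 -> f z = g z) ->
  bounded_analytic f -> bounded_analytic g.
Proof.
move=> fg [Hf [K HK]]; split; first exact: analytic_disk_ext Hf.
by exists K => z z1; rewrite -fg //; exact: HK.
Qed.

Lemma ban_cst c : bounded_analytic (fun=> c).
Proof. by split=> [z _|]; [exact: analytic_cst | exists (normc c)]. Qed.

Lemma ban_id : bounded_analytic id.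
Proof. by split=> [z _|]; [exact: analytic_id | exists 1 => z /ltW]. Qed.

Lemma banD f g : bounded_analytic f -> bounded_analytic g ->
  bounded_analytic (fun z => f z + g z).
Proof.
move=> [Hf [K HK]] [Hg [L HL]]; split=> [z z1|]; first by apply: analyticD; auto.
by exists (K + L) => z z1; apply: le_trans (normcD _ _) _; apply: lerD; auto.
Qed.

Lemma banM f g : bounded_analytic f -> bounded_analytic g ->
  bounded_analytic (fun z => f z * g z).
Proof.
move=> [Hf [K HK]] [Hg [L HL]]; split=> [z z1|]; first by apply: analyticM; auto.
by exists (K * L) => z z1; rewrite normcM; apply: ler_pM; auto; exact: normc_ge0.
Qed.

Lemma banN f : bounded_analytic f -> bounded_analytic (fun z => - f z).
Proof.
move=> [Hf [K HK]]; split=> [z z1|]; first by apply: analyticN; auto.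
by exists K => z z1; rewrite normcN; auto.
Qed.

Lemma banB f g : bounded_analytic f -> bounded_analytic g ->
  bounded_analytic (fun z => f z - g z).
Proof. by move=> Hf Hg; exact: banD Hf (banN Hg). Qed.

Lemma ban_sum (I : Type) (s : seq I) (F : I -> R[i] -> R[i]) :
  (forall i, bounded_analytic (F i)) ->
  bounded_analytic (fun z => \sum_(i <- s) F i z).
Proof.
move=> HF; elim: s => [|i s IH].
  by apply: ban_ext (ban_cst 0) => w _; rewrite big_nil.
by apply: ban_ext (banD (HF i) IH) => w _; rewrite big_cons.
Qed.

Lemma ban_prod (I : Type) (s : seq I) (F : I -> R[i] -> R[i]) :
  (forall i, bounded_analytic (F i)) ->
  bounded_analytic (fun z => \prod_(i <- s) F i z).
Proof.
move=> HF; elim: s => [|i s IH].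
  by apply: ban_ext (ban_cst 1) => w _; rewrite big_nil.
by apply: ban_ext (banM (HF i) IH) => w _; rewrite big_cons.
Qed.

Lemma banV f (c : R) : 0 < c -> (forall z, normc z < 1 -> c <= normc (f z)) ->
  bounded_analytic f -> bounded_analytic (fun z => (f z)^-1).
Proof.
move=> c0 Hc [Hf _]; split=> [z z1|].
  apply: analyticV; last exact: Hf.
  by rewrite -normc_gt0; apply: lt_le_trans (Hc z z1).
exists c^-1 => z z1; rewrite normcV lef_pV2 ?posrE ?Hc //.
exact: lt_le_trans (Hc z z1).
Qed.

(** By the maximum principle a bound near the circle is enough. *)
Lemma ban_bdry f (K : R) : analytic_disk f -> near_bdry (fun z => normc (f z) <= K) ->
  bounded_analytic f.
Proof.
move=> Hf HK; split=> //; exists K; apply: max_principle => // e e0.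
by apply: near_bdryW HK => z _ H; lra.
Qed.

Lemma near_bdry_ge (r : R) : r < 1 -> near_bdry (fun z => r < normc z).
Proof. by move=> r1; exists r. Qed.

Lemma near_bdryT (Q : R[i] -> Prop) : (forall z, normc z < 1 -> Q z) -> near_bdry Q.
Proof. by move=> HQ; exists 0 => // z _; exact: HQ. Qed.

Lemma one_sub_neq0 (a z : R[i]) : normc a < 1 -> normc z < 1 -> 1 - (a^*)%R * z != 0.
Proof.
move=> a1 z1; rewrite -normc_gt0; apply: lt_le_trans (normcBB _ _).
rewrite normc1 subr_gt0 normcM normcC.
by have := normc_ge0 a; have := normc_ge0 z; nra.
Qed.

Lemma one_sub_ge (a z : R[i]) : normc z < 1 -> 1 - normc a <= normc (1 - (a^*)%R * z).
Proof.
move=> z1; apply: le_trans (normcBB _ _).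
rewrite normc1 lerD2l lerN2 normcM normcC.
by have := normc_ge0 a; nra.
Qed.

Lemma one_sub_le (a z : R[i]) : normc a < 1 -> normc z < 1 -> normc (1 - (a^*)%R * z) <= 2.
Proof.
move=> a1 z1; apply: le_trans (normcB _ _) _.
by rewrite normc1 normcM normcC; have := normc_ge0 a; have := normc_ge0 z; nra.
Qed.

Definition bfactor (a z : R[i]) := (z - a) / (1 - (a^*)%R * z).

(** The identity behind the Schwarz-Pick lemma. *)
Lemma bfactor_identity (a z : R[i]) :
  normc (1 - (a^*)%R * z) ^+ 2 - normc (z - a) ^+ 2 =
  (1 - normc a ^+ 2) * (1 - normc z ^+ 2).
Proof.
rewrite !normc2_sub normc1 normcM normcC.
have -> : complex.Re (z * (a^*)%R) = complex.Re (1 * ((a^*)%R * z)^*%R).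
  by rewrite mul1r ReC mulrC.
ring.
Qed.

Lemma bfactor_sqr (a z : R[i]) : normc a < 1 -> normc z < 1 ->
  1 - normc (bfactor a z) ^+ 2 =
  (1 - normc a ^+ 2) * (1 - normc z ^+ 2) / normc (1 - (a^*)%R * z) ^+ 2.
Proof.
move=> a1 z1; rewrite -bfactor_identity /bfactor normcM normcV.
have := one_sub_neq0 a1 z1; rewrite -normc_eq0 => n0.
by field.
Qed.

Lemma bfactor_le1 (a z : R[i]) : normc a < 1 -> normc z < 1 -> normc (bfactor a z) <= 1.
Proof.
move=> a1 z1; rewrite -(@ler_pXn2r _ 2) ?nnegrE ?normc_ge0 //.
rewrite expr1n -subr_ge0 bfactor_sqr //.
have := normc_ge0 a; have := normc_ge0 z => za aa.
by rewrite divr_ge0 ?exprn_ge0 ?normc_ge0 // mulr_ge0 // subr_ge0 expr_le1 // ltW.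
Qed.

(** For functions bounded by 1, as inner functions continuous up to the circle
  are: the modulus tends to 1 uniformly. *)
Definition inner_like f := forall e : R, 0 < e -> near_bdry (fun z => 1 - e <= normc (f z)).

Lemma bfactor_inner a : normc a < 1 -> inner_like (bfactor a).
Proof.
move=> a1 e e0; have a0 := normc_ge0 a.
pose d := (1 - normc a) ^+ 2; have d0 : 0 < d by rewrite exprn_gt0 // subr_gt0.
pose r := 1 - e * d / 2.
exists r => [|z rz z1].
  by rewrite /r gtrBl divr_gt0 // mulr_gt0.
have z0 := normc_ge0 z.
have b0 := normc_ge0 (bfactor a z); have b1 := bfactor_le1 a1 z1.
have H := bfactor_sqr a1 z1.
have D := one_sub_ge a z1; have D2 : d <= normc (1 - (a^*)%R * z) ^+ 2.
  by apply: lerXn2r; rewrite ?nnegrE ?normc_ge0 // subr_ge0 ltW.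
have H2 : (1 - normc a ^+ 2) * (1 - normc z ^+ 2) <= e * d.
  rewrite /r in rz.
  have : (1 - normc z ^+ 2) <= e * d by nra.
  have : 0 <= 1 - normc z ^+ 2 by nra.
  have : 1 - normc a ^+ 2 <= 1 by nra.
  nra.
have H3 : 1 - normc (bfactor a z) ^+ 2 <= e.
  rewrite H ler_pdivrMr; last by apply: lt_le_trans D2.
  apply: le_trans H2 _; apply: ler_wpM2l => //; exact: ltW.
nra.
Qed.

Lemma inner_likeM f g : (forall z, normc z < 1 -> normc (f z) <= 1) ->
  (forall z, normc z < 1 -> normc (g z) <= 1) ->
  inner_like f -> inner_like g -> inner_like (fun z => f z * g z).
Proof.
move=> f1 g1 Hf Hg e e0; have e2 : 0 < Num.min (e / 2) 1.
  by rewrite lt_min ltr01 divr_gt0.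
apply: near_bdryW (near_bdryI (Hf _ e2) (Hg _ e2)) => z z1 [H1 H2].
rewrite normcM; have := f1 z z1; have := g1 z z1.
have := normc_ge0 (f z); have := normc_ge0 (g z).
have m1 : Num.min (e / 2) 1 <= e / 2 by rewrite ge_min lexx.
have m2 : Num.min (e / 2) 1 <= 1 by rewrite ge_min lexx orbT.
move: H1 H2 m1 m2; set m := Num.min _ _; nra.
Qed.

Definition bprod (s : seq R[i]) z := \prod_(a <- s) bfactor a z.

Lemma bprod_le1 s z : (forall a, a \in s -> normc a < 1) -> normc z < 1 ->
  normc (bprod s z) <= 1.
Proof.
move=> Hs z1; rewrite /bprod; elim: s Hs => [|a s IH] Hs; first by rewrite big_nil normc1.
rewrite big_cons normcM mulr_ile1 ?normc_ge0 ?bfactor_le1 //.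
  by apply: Hs; rewrite mem_head.
by apply: IH => b bs; apply: Hs; rewrite in_cons bs orbT.
Qed.

Lemma bprod_inner s : (forall a, a \in s -> normc a < 1) -> inner_like (bprod s).
Proof.
elim: s => [|a s IH] Hs.
  by move=> e e0; apply: near_bdryT => z _; rewrite /bprod big_nil normc1; lra.
have Ha : normc a < 1 by apply: Hs; rewrite mem_head.
have Hs' b : b \in s -> normc b < 1 by move=> bs; apply: Hs; rewrite in_cons bs orbT.
have H : inner_like (fun z => bfactor a z * bprod s z).
  apply: inner_likeM; last exact: IH.
  - by move=> z; exact: bfactor_le1.
  - by move=> z; exact: bprod_le1.
  - exact: bfactor_inner.
move=> e e0; apply: near_bdryW (H e e0) => z z1.
by rewrite /bprod big_cons.
Qed.

Lemma ban_sub a : bounded_analytic (fun z => z - a).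
Proof. exact: banB ban_id (ban_cst a). Qed.

Lemma ban_one_sub a : bounded_analytic (fun z => 1 - (a^*)%R * z).
Proof. exact: banB (ban_cst 1) (banM (ban_cst _) ban_id). Qed.

Lemma ban_one_subV a : normc a < 1 -> bounded_analytic (fun z => (1 - (a^*)%R * z)^-1).
Proof.
move=> a1; apply: (@banV _ (1 - normc a)); rewrite ?subr_gt0 //.
- by move=> z; exact: one_sub_ge.
- exact: ban_one_sub.
Qed.

Lemma ban_bprod s : (forall a, a \in s -> normc a < 1) -> bounded_analytic (bprod s).
Proof.
elim: s => [|a s IH] Hs.
  by apply: ban_ext (ban_cst 1) => z _; rewrite /bprod big_nil.
have Ha : normc a < 1 by apply: Hs; rewrite mem_head.
have Hs' b : b \in s -> normc b < 1 by move=> bs; apply: Hs; rewrite in_cons bs orbT.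
apply: ban_ext (banM (banM (ban_sub a) (ban_one_subV Ha)) (IH Hs')) => z z1.
by rewrite /bprod big_cons.
Qed.

Lemma bprod_root s z : (forall a, a \in s -> normc a < 1) -> normc z < 1 ->
  (bprod s z == 0) = (z \in s).
Proof.
move=> Hs z1; rewrite /bprod; elim: s Hs => [|a s IH] Hs.
  by rewrite big_nil oner_eq0.
have Ha : normc a < 1 by apply: Hs; rewrite mem_head.
rewrite big_cons mulf_eq0 IH ?in_cons => [|b bs]; last by apply: Hs; rewrite in_cons bs orbT.
by rewrite /bfactor mulf_eq0 invr_eq0 (negPf (one_sub_neq0 Ha z1)) orbF subr_eq0.
Qed.

Lemma pow_small (q A : R) : 0 < q -> q < 1 -> 0 < A ->
  exists n, forall m, (n <= m)%N -> (1 - q) ^+ m < A.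
Proof.
move=> q0 q1 A0.
have H m : (1 - q) ^+ m * (1 + m%:R * q) <= 1.
  elim: m => [|m IH]; first by rewrite expr0 mul0r addr0 mulr1.
  rewrite exprS -natr1; apply: le_trans IH.
  have p : 0 <= (1 - q) ^+ m by rewrite exprn_ge0 // subr_ge0 ltW.
  have p2 : 0 <= (m%:R : R) by exact: ler0n.
  rewrite mulrAC mulrC; apply: ler_wpM2l => //; nra.
have [N HN] : exists N : nat, (A * q)^-1 < N%:R.
  by exists (Num.bound (A * q)^-1); apply: archi_boundP; rewrite invr_ge0 mulr_ge0 // ltW.
exists N => m Nm.
have p : 0 <= (1 - q) ^+ m by rewrite exprn_ge0 // subr_ge0 ltW.
have Nm' : (N%:R : R) <= m%:R by rewrite ler_nat.
have Am : 1 < A * q * m%:R.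
  have := lt_le_trans HN Nm'; rewrite -[(A * q)^-1]mul1r ltr_pdivrMr ?mulr_gt0 //.
  by rewrite mulrC.
rewrite ltNge; apply/negP => HA; have := H m.
have p2 : 0 <= (m%:R : R) by exact: ler0n.
have : A * (1 + m%:R * q) <= (1 - q) ^+ m * (1 + m%:R * q).
  by apply: ler_wpM2r => //; rewrite addr_ge0 // mulr_ge0 // ltW.
nra.
Qed.

(** A partial factorization: [u] may have further zeros. *)
Definition factored (s : seq R[i]) u f :=
  [/\ forall a, a \in s -> normc a < 1, analytic_disk u &
   forall z, normc z < 1 -> f z = bprod s z * u z].

(** Suppose that [f] has [m] zeros. They stay in a disk of radius [r < 1],
  since [f] is bounded below near the circle; and by the maximum principle the
  quotient by the Blaschke product is bounded by [2 K] independently of [m]. At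
  a point of modulus [t] with [r < t < 1] the squared modulus of each Blaschke
  factor is at most [1 - q], which bounds [m] since [f] is bounded below there. *)
Lemma zero_bound f (c : R) : bounded_analytic f -> 0 < c ->
  near_bdry (fun z => c <= normc (f z)) ->
  exists n : nat, forall s u, factored s u f -> (size s <= n)%N.
Proof.
move=> [Hf [K HK]] c0 [r0 r01 Hc].
pose r := Num.max r0 0.
have r1 : r < 1 by rewrite gt_max r01 ltr01.
have rp : 0 <= r by rewrite le_max lexx orbT.
have rr : r0 <= r by rewrite le_max lexx.
pose t := (1 + r) / 2; have t1 : t < 1 by rewrite /t; lra.
have rt : r < t by rewrite /t; lra.
have t0 : 0 <= t by lra.
pose zt : R[i] := (t%:C)%C.
have nt : normc zt = t by rewrite normc_real ger0_norm.
have cK : c <= K.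
  by apply: le_trans (Hc zt _ _) (HK zt _); rewrite nt //; lra.
(* By [bfactor_sqr], [q] bounds [1 - |bfactor a t|^2] from below for [|a| <= r]. *)
pose q := (1 - r ^+ 2) * (1 - t ^+ 2) / 4.
have q0 : 0 < q.
  by rewrite /q divr_gt0 // mulr_gt0 //; nra.
have q1 : q < 1.
  rewrite /q ltr_pdivrMr // mul1r.
  have : 0 <= 1 - r ^+ 2 by nra.
  have : 1 - r ^+ 2 <= 1 by nra.
  have : 1 - t ^+ 2 <= 1 by nra.
  nra.
have A0 : 0 < (c / (2 * K)) ^+ 2.
  rewrite exprn_gt0 // divr_gt0 // mulr_gt0 //; lra.
have [n Hn] := pow_small q0 q1 A0.
exists n => s u [Hs Hu fE]; rewrite leqNgt; apply/negP => /ltnW /Hn Hm.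
have Hsr a : a \in s -> normc a <= r.
  move=> ra; rewrite leNgt; apply/negP => H.
  have a1 := Hs a ra.
  have := Hc a (le_lt_trans rr H) a1; rewrite fE //.
  have /eqP -> : bprod s a == 0 by rewrite bprod_root.
  by rewrite mul0r normc0 leNgt c0.
have ubd : forall z, normc z < 1 -> normc (u z) <= 2 * K.
  apply: max_principle => // e e0.
  have h2 : 0 < 2^-1 :> R by rewrite invr_gt0.
  apply: near_bdryW (bprod_inner Hs h2) => z z1 Hb.
  have := HK z z1; rewrite fE // normcM => H.
  have := normc_ge0 (u z); nra.
have bt : normc (bprod s zt) ^+ 2 <= (1 - q) ^+ size s.
  have zt1 : normc zt < 1 by rewrite nt.
  rewrite /bprod; elim: (s) Hsr => [|a l IH] Hl; first by rewrite big_nil normc1 expr1n expr0.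
  rewrite big_cons normcM exprMn /= [(1 - q) ^+ _]exprS; apply: ler_pM; rewrite ?exprn_ge0 ?normc_ge0 //.
    have ar : normc a <= r by apply: Hl; rewrite mem_head.
    have a1 : normc a < 1 by apply: le_lt_trans r1.
    have := bfactor_sqr a1 zt1; have D := one_sub_le a1 zt1.
    have D0 : 0 < normc (1 - (a^*)%R * zt) by rewrite normc_gt0 one_sub_neq0.
    have a0 := normc_ge0 a.
    suff : q <= (1 - normc a ^+ 2) * (1 - normc zt ^+ 2) / normc (1 - (a^*)%R * zt) ^+ 2 by lra.
    rewrite nt /q; apply: ler_pM.
    - by apply: mulr_ge0; nra.
    - by rewrite invr_ge0.
    - by apply: ler_wpM2r; nra.
    - by rewrite lef_pV2 ?posrE ?exprn_gt0 //; nra.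
  by apply: IH => b bl; apply: Hl; rewrite in_cons bl orbT.
have := Hc zt; rewrite nt => /(_ (le_lt_trans rr rt) t1).
rewrite fE ?nt // normcM => Hz.
have := ubd zt; rewrite nt => /(_ t1) Hu2.
have K0 : 0 < 2 * K by lra.
have cb : c / (2 * K) <= normc (bprod s zt).
  rewrite ler_pdivrMr //; have := normc_ge0 (bprod s zt); nra.
have : (c / (2 * K)) ^+ 2 <= normc (bprod s zt) ^+ 2.
  by apply: lerXn2r; rewrite ?nnegrE ?normc_ge0 // divr_ge0 // ltW.
move=> H; have := le_lt_trans (le_trans H bt) Hm.
by rewrite ltxx.
Qed.

(** Zeros are split off one at a time; [zero_bound] makes this stop. *)
Lemma factor_zeros f (c : R) : bounded_analytic f -> 0 < c ->
  near_bdry (fun z => c <= normc (f z)) ->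
  exists s u, factored s u f /\ forall z, normc z < 1 -> u z != 0.
Proof.
move=> Hf c0 Hc; have [n Hn] := zero_bound Hf c0 Hc.
suff H : forall m s u, factored s u f -> (n - size s <= m)%N ->
    exists s u, factored s u f /\ forall z, normc z < 1 -> u z != 0.
  apply: (H n [::] f); last by rewrite subn0.
  by split=> // [|z _]; [case: Hf | rewrite /bprod big_nil mul1r].
elim=> [|m IH] s u Hsu Hm.
  exists s, u; split=> // z z1; apply/negP => /eqP uz0.
  have := Hn (z :: s).
  have [Hs Hu fE] := Hsu.
  have [g [Hg Hga]] := divided_difference (Hu z z1).
  move=> /(_ (fun w => (1 - (z^*)%R * w) * g w)); rewrite ltnNge -subn_eq0 -leqn0 Hm => H.
  suff : false by []; apply: H; split=> [a|w w1|w w1].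
  - by rewrite in_cons => /orP[/eqP ->|/Hs].
  - by apply: analyticM; [case: (ban_one_sub z) => + _; apply | apply/Hga/Hu].
  - rewrite fE //; have := Hg w; rewrite uz0 subr0 => ->.
    rewrite /bprod big_cons /bfactor; field.
    exact: one_sub_neq0.
have [|/existsNP [z /not_implyP [z1 /negP]]] := pselect (forall z, normc z < 1 -> u z != 0).
  by move=> Hnz; exists s, u.
rewrite negbK => /eqP uz0.
have [Hs Hu fE] := Hsu.
have [g [Hg Hga]] := divided_difference (Hu z z1).
apply: (IH (z :: s) (fun w => (1 - (z^*)%R * w) * g w)).
  split=> [a|w w1|w w1].
  - by rewrite in_cons => /orP[/eqP ->|/Hs].
  - by apply: analyticM; [case: (ban_one_sub z) => + _; apply | apply/Hga/Hu].
  - rewrite fE //; have := Hg w; rewrite uz0 subr0 => ->.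
    rewrite /bprod big_cons /bfactor; field.
    exact: one_sub_neq0.
by rewrite /= subnS -subn1 leq_subLR add1n.
Qed.

End BoundedAnalytic.

(** * Counting zeros by comparison near the circle *)

Section ZeroCount.
Variable R : realType.
Implicit Types (f g F G u v : R[i] -> R[i]) (z w x : R[i]).
Local Notation C := (R[i] : numClosedFieldType).

Lemma mulc_conj z : z * (z^*)%R = ((normc z ^+ 2)%:C)%C.
Proof. by rewrite rmorphXn /=; exact: esym (sqr_normc z). Qed.

(** Functions that become positive at the unit circle. *)
Definition near_pos f := exists (rho : R[i] -> R) (c0 c1 : R),
  [/\ 0 < c0, near_bdry (fun z => c0 <= rho z /\ rho z <= c1) &
   forall e : R, 0 < e -> near_bdry (fun z => normc (f z - ((rho z)%:C)%C) < e)].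

(** The quotient of [z / (1 - a^* z)^2] by the Blaschke factor of [a]; on the
  unit circle it is [1 / |1 - a^* z|^2]. *)
Definition pos_factor a z := z / ((z - a) * (1 - (a^*)%R * z)).

Lemma pos_factor_near_pos a : normc a < 1 -> near_pos (pos_factor a).
Proof.
move=> a1; have a0 := normc_ge0 a; pose d := 1 - normc a.
have d0 : 0 < d by rewrite subr_gt0.
exists (fun z => (normc (1 - (a^*)%R * z) ^+ 2)^-1), 4^-1, (d ^+ 2)^-1; split; first by rewrite invr_gt0.
  apply: near_bdryT => z z1.
  have n0 : 0 < normc (1 - (a^*)%R * z) by rewrite normc_gt0 one_sub_neq0.
  have := one_sub_ge a z1; have := one_sub_le a1 z1; rewrite -/d => H2 H1.
  by split; rewrite lef_pV2 ?posrE ?exprn_gt0 //; nra.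
move=> e e0; pose r := Num.max ((1 + normc a) / 2) (1 - e * d ^+ 3 / 4).
have d3 : 0 < d ^+ 3 by rewrite exprn_gt0.
exists r => [|z].
  by rewrite gt_max; apply/andP; split; [lra | rewrite gtrBl divr_gt0 // mulr_gt0].
rewrite gt_max => /andP[r1 r2] z1.
have za : z - a != 0.
  by rewrite -normc_gt0; have := normcBB z a; lra.
have n0 := one_sub_neq0 a1 z1.
have n0' : 1 - a * (z^*)%R != 0.
  rewrite -normc_eq0 -normcC rmorphB rmorph1 rmorphM /= conjCK normc_eq0 //.
have -> : pos_factor a z - (((normc (1 - (a^*)%R * z) ^+ 2)^-1)%:C)%C =
   a * ((1 - normc z ^+ 2)%:C)%C / ((z - a) * (1 - (a^*)%R * z) * (1 - a * (z^*)%R)).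
  have -> : ((1 - normc z ^+ 2)%:C)%C = 1 - z * (z^*)%R :> R[i].
    by rewrite rmorphB rmorph1 mulc_conj.
  have -> : (((normc (1 - (a^*)%R * z) ^+ 2)^-1)%:C)%C =
      ((1 - (a^*)%R * z) * (1 - a * (z^*)%R))^-1.
    rewrite (fmorphV (real_complex R)) /= -mulc_conj; congr (_ * _)^-1.
    by rewrite rmorphB rmorph1 rmorphM /= conjCK.
  by rewrite /pos_factor; field; rewrite za n0 n0'.
rewrite !normcM normcV !normcM normc_real.
have -> : normc (1 - a * (z^*)%R) = normc (1 - (a^*)%R * z).
  by rewrite -normcC rmorphB rmorph1 rmorphM /= conjCK.
have z0 := normc_ge0 z.
have zn : 0 <= 1 - normc z ^+ 2 by nra.
rewrite ger0_norm //.
set N := normc (1 - _); have HN : d <= N by exact: one_sub_ge.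
have Hz : d / 2 <= normc (z - a) by have := normcBB z a; rewrite /d; lra.
have dd : 0 < d / 2 * d * d by rewrite !mulr_gt0 // invr_gt0.
have D3 : d / 2 * d * d <= normc (z - a) * N * N.
  by apply: ler_pM; [nra | lra | apply: ler_pM; lra | ].
rewrite ltr_pdivrMr; last exact: lt_le_trans D3.
apply: lt_le_trans (_ : e * (d / 2 * d * d) <= _); last by rewrite ler_pM2l.
have -> : e * (d / 2 * d * d) = 2 * (e * d ^+ 3 / 4) by field.
nra.
Qed.

(** The two functions point in nearby directions at the unit circle. *)
Definition same_dir F G := exists c K : R, 0 < c /\
  near_bdry (fun z => [/\ c <= complex.Re (F z * ((G z)^*)%R), normc (F z) <= K & normc (G z) <= K]).

Lemma same_dir_sym F G : same_dir F G -> same_dir G F.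
Proof.
move=> [c [K [c0 H]]]; exists c, K; split=> //.
apply: near_bdryW H => z z1 [H1 H2 H3]; split=> //.
by move: H1; rewrite !Re_mul !ReC !ImC; lra.
Qed.

Lemma same_dir_ext F G F' : near_bdry (fun z => F z = F' z) ->
  same_dir F G -> same_dir F' G.
Proof.
move=> HF [c [K [c0 H]]]; exists c, K; split=> //.
by apply: near_bdryW (near_bdryI HF H) => z z1 [<-].
Qed.

Lemma same_dir_scale F G m : near_pos m -> same_dir F G ->
  same_dir (fun z => F z * m z) G.
Proof.
move=> [rho [c0 [c1 [c00 Hrho Hm]]]] [c [K [cp H]]].
pose e := Num.min 1 (c0 * c / (2 * (K ^+ 2 + 1))).
have K2 : 0 < 2 * (K ^+ 2 + 1) by rewrite mulr_gt0 // ltr_wpDl // sqr_ge0.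
have e0 : 0 < e by rewrite lt_min ltr01 divr_gt0 // mulr_gt0.
exists (c0 * c / 2), (Num.max K (K * (c1 + 1))); split; first by rewrite divr_gt0 // mulr_gt0.
apply: near_bdryW (near_bdryI (near_bdryI Hrho (Hm e e0)) H) => z z1 [[[r0 r1] He] [H1 H2 H3]].
have e1 : e <= 1 by rewrite ge_min lexx.
have e2 : e * (2 * (K ^+ 2 + 1)) <= c0 * c.
  by rewrite -ler_pdivlMr // ge_min lexx orbT.
have F0 := normc_ge0 (F z); have G0 := normc_ge0 (G z).
have rp : 0 < rho z by lra.
set d := m z - _ in He; have mE : m z = d + ((rho z)%:C)%C by rewrite /d subrK.
have d0 := normc_ge0 d.
split.
- have -> : F z * m z * ((G z)^*)%R = F z * ((G z)^*)%R * ((rho z)%:C)%C + F z * ((G z)^*)%R * d.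
    by rewrite mE; ring.
  rewrite ReD Re_mul Im_real mulr0 subr0 Re_real.
  have : - normc (F z * ((G z)^*)%R * d) <= complex.Re (F z * ((G z)^*)%R * d).
    by have := normc_Re (F z * ((G z)^*)%R * d); rewrite ler_norml => /andP[].
  rewrite !normcM normcC => Hd.
  have FG : normc (F z) * normc (G z) <= K ^+ 2 by rewrite expr2; apply: ler_pM.
  have : normc (F z) * normc (G z) * normc d <= K ^+ 2 * e.
    by apply: ler_pM => //; [exact: mulr_ge0 | exact: ltW].
  have : c0 * c <= rho z * complex.Re (F z * ((G z)^*)%R) by apply: ler_pM; lra.
  have K20 := sqr_ge0 K.
  nra.
- rewrite normcM le_max; apply/orP; right; apply: ler_pM => //; first exact: normc_ge0.
  by rewrite mE; apply: le_trans (normcD _ _) _; rewrite normc_real gtr0_norm //; lra.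
- by rewrite le_max H3.
Qed.

Definition circ_factors (s : seq R[i]) z := \prod_(a <- s) (z / (1 - (a^*)%R * z) ^+ 2).

(** Near the circle each Blaschke factor can be traded for
  [z / (1 - a^* z)^2], which has the same argument there. The zeros move to the
  origin, where those of two functions can be cancelled against each other. *)
Lemma same_dir_circ s u G : (forall a, a \in s -> normc a < 1) ->
  same_dir (fun z => bprod s z * u z) G -> same_dir (fun z => circ_factors s z * u z) G.
Proof.
elim: s u => [|a s IH] u Hs.
  apply: same_dir_ext; apply: near_bdryT => z _.
  by rewrite /bprod /circ_factors !big_nil.
have Ha : normc a < 1 by apply: Hs; rewrite mem_head.
have Hs' b : b \in s -> normc b < 1 by move=> bs; apply: Hs; rewrite in_cons bs orbT.
move=> H.
have {}H := same_dir_scale (pos_factor_near_pos Ha) H.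
have {}H : same_dir (fun z => bprod s z * (z / (1 - (a^*)%R * z) ^+ 2 * u z)) G.
  apply: same_dir_ext H; exists (Num.max (normc a) 0); first by rewrite gt_max Ha ltr01.
  move=> z; rewrite gt_max => /andP[az z0] z1.
  rewrite /bprod big_cons /bfactor /pos_factor; field.
  rewrite one_sub_neq0 // -normc_gt0.
  by have := normcBB z a; lra.
have {}H := IH _ Hs' H.
apply: same_dir_ext H; apply: near_bdryT => z z1.
by rewrite /circ_factors big_cons; ring.
Qed.

Lemma circ_factorsE s z : circ_factors s z = z ^+ size s * \prod_(a <- s) (1 - (a^*)%R * z) ^- 2.
Proof.
rewrite /circ_factors; elim: s => [|a s IH]; first by rewrite !big_nil mulr1.
by rewrite !big_cons IH /= [z ^+ _.+1]exprS; ring.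
Qed.

(** Move all zeros to the origin by [same_dir_circ]. If [F] had more of them
  than [G], the quotient [h] of the two functions would be analytic with
  [h 0 = 0], while its real part is bounded below by a positive constant near the
  circle. The maximum principle for [M - h] with [M] large excludes this. *)
Lemma zero_count_le s1 s2 u v F G : factored s1 u F -> factored s2 v G ->
  (forall z, normc z < 1 -> v z != 0) -> same_dir F G -> (size s1 <= size s2)%N.
Proof.
move=> [Hs1 Hu FE] [Hs2 Hv GE] v0 HFG; rewrite leqNgt; apply/negP => lt21.
have {}HFG : same_dir (fun z => bprod s1 z * u z) G.
  by apply: same_dir_ext HFG; apply: near_bdryT.
have {}HFG := same_dir_sym (same_dir_circ Hs1 HFG).
have {}HFG : same_dir (fun z => bprod s2 z * v z) (fun z => circ_factors s1 z * u z).
  by apply: same_dir_ext HFG; apply: near_bdryT.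
have {HFG} := same_dir_sym (same_dir_circ Hs2 HFG).
set F' := fun z => circ_factors s1 z * u z; set G' := fun z => circ_factors s2 z * v z.
move=> [c [K [c0 H]]].
pose W s z := \prod_(a <- s) (1 - (a^*)%R * z) ^- 2 : R[i].
pose W' s z := \prod_(a <- s) (1 - (a^*)%R * z) ^+ 2 : R[i].
have WW s z : (forall a, a \in s -> normc a < 1) -> normc z < 1 -> W s z * W' s z = 1.
  move=> + z1; elim: s => [|a s IH] Hs; first by rewrite /W /W' !big_nil mulr1.
  rewrite /W /W' !big_cons mulrACA -/(W s z) -/(W' s z) IH ?mulr1 ?mulVf //.
    by rewrite expf_neq0 // one_sub_neq0 // Hs // mem_head.
  by move=> b bs; apply: Hs; rewrite in_cons bs orbT.
have W'0 s z : (forall a, a \in s -> normc a < 1) -> normc z < 1 -> W' s z != 0.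
  move=> Hs z1; apply/negP => /eqP W0; have := WW s z Hs z1; rewrite W0 mulr0 => /eqP.
  by rewrite eq_sym oner_eq0.
have W'a s : analytic_disk (W' s).
  by move=> z z1; apply: analytic_prod => a; apply: analyticM; case: (ban_one_sub a) => + _; apply.
pose h z := z ^+ (size s1 - size s2) * (W' s2 z * u z * (W' s1 z * v z)^-1).
have hG z : normc z < 1 -> h z * G' z = F' z.
  move=> z1; rewrite /h /G' /F' !circ_factorsE -/(W s1 z) -/(W s2 z).
  have E1 : z ^+ size s1 = z ^+ (size s1 - size s2) * z ^+ size s2 by rewrite -exprD subnK // ltnW.
  have E2 : W s1 z = (W' s1 z)^-1 by apply: (mulIf (W'0 _ _ Hs1 z1)); rewrite WW // mulVf // W'0.
  have E3 : W s2 z = (W' s2 z)^-1 by apply: (mulIf (W'0 _ _ Hs2 z1)); rewrite WW // mulVf // W'0.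
  rewrite E1 E2 E3; field.
  by rewrite !W'0 // v0.
have han : analytic_disk h.
  move=> z z1; apply: analyticM.
    elim: (size s1 - size s2)%N => [|n IH].
      by apply: (analytic_near ltr01) (analytic_cst 1 z) => w _; rewrite expr0.
    by apply: (analytic_near ltr01) (analyticM (analytic_id z) IH) => w _; rewrite exprS.
  apply: analyticM; first by apply: analyticM; [exact: W'a | exact: Hu].
  apply: analyticV; first by rewrite mulf_neq0 ?W'0 ?v0.
  by apply: analyticM; [exact: W'a | exact: Hv].
have h0 : h 0 = 0 by rewrite /h expr0n subn_eq0 leqNgt lt21 mul0r.
(* [kp] is a lower bound of [Re h], and [1 / kp] an upper bound of [|h|]. *)
pose kp := c / (K ^+ 2 + c).
have kp0 : 0 < kp by rewrite divr_gt0 // ltr_wpDl // sqr_ge0.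
have Kc : 0 < K ^+ 2 + c by rewrite ltr_wpDl // sqr_ge0.
have Hh : near_bdry (fun z => kp <= complex.Re (h z) /\ normc (h z) <= kp^-1).
  apply: near_bdryW H => z z1 [H1 H2 H3]; rewrite -hG // in H1 H2.
  have -> : kp^-1 = (K ^+ 2 + c) / c by rewrite /kp invf_div.
  have G0 := normc_ge0 (G' z); have hn0 := normc_ge0 (h z).
  have G2 : normc (G' z) ^+ 2 <= K ^+ 2 by apply: lerXn2r; rewrite ?nnegrE //; exact: le_trans H3.
  move: H1; rewrite -mulrA mulc_conj Re_mul Re_real Im_real mulr0 subr0 => H1.
  move: H2; rewrite normcM => H2.
  have R1 := Re_le_normc (h z).
  have g0 : 0 < normc (G' z) ^+ 2.
    rewrite exprn_gt0 // lt_def G0 andbT; apply/negP => /eqP g0.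
    by move: H1; rewrite g0 expr0n mulr0 leNgt c0.
  have Rp : 0 < complex.Re (h z) by rewrite -(pmulr_lgt0 _ g0); lra.
  split.
    by rewrite /kp ler_pdivrMr //; nra.
  rewrite ler_pdivlMr //.
  have : normc (h z) * (complex.Re (h z) * normc (G' z) ^+ 2) <= K ^+ 2 .
    apply: le_trans (_ : (normc (h z) * normc (G' z)) ^+ 2 <= _).
      by rewrite exprMn expr2 -mulrA; apply: ler_wpM2l => //; apply: ler_wpM2r => //; exact: ltW.
    by apply: lerXn2r; rewrite ?nnegrE ?mulr_ge0 //; exact: le_trans H3.
  nra.
(* So large that [|M - h|^2 <= M^2 - 2 M kp + kp^-2 <= (M - kp / 2)^2]. *)
pose M := (kp^-1) ^+ 3.
have kk : kp * kp^-1 = 1 by rewrite divff // gt_eqF.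
have ki0 : 0 < kp^-1 by rewrite invr_gt0.
have Hk : forall z, normc z < 1 -> normc ((M%:C)%C - h z) <= M - kp / 2.
  apply: max_principle => [z z1|e e0].
    by apply: analyticB; [exact: analytic_cst | exact: han].
  apply: near_bdryW Hh => z z1 [H1 H2].
  have R1 := Re_le_normc (h z); have hn0 := normc_ge0 (h z).
  have k1 : kp <= kp^-1 by lra.
  have MK : M * kp = kp^-1 ^+ 2 by rewrite /M exprSr -mulrA [kp^-1 * kp]mulrC kk mulr1.
  have M0 : 0 < M by rewrite exprn_gt0.
  have kM : kp <= M.
    have : 1 <= kp^-1 by nra.
    rewrite /M !exprS expr0 mulr1; nra.
  suff : normc ((M%:C)%C - h z) <= M - kp / 2 by lra.
  rewrite -(@ler_pXn2r _ 2) ?nnegrE ?normc_ge0 //; last by lra.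
  rewrite normc2_sub normc_real gtr0_norm //.
  rewrite Re_mul Re_real Im_real mul0r subr0 ReC.
  have : normc (h z) ^+ 2 <= kp^-1 ^+ 2 by apply: lerXn2r; rewrite ?nnegrE // ltW.
  have : M * kp <= M * complex.Re (h z) by rewrite ler_pM2l.
  nra.
have := Hk 0; rewrite normc0 h0 subr0 normc_real => /(_ ltr01).
by have := ler_norm M; lra.
Qed.

Lemma zero_count s1 s2 u v F G : factored s1 u F -> factored s2 v G ->
  (forall z, normc z < 1 -> u z != 0) -> (forall z, normc z < 1 -> v z != 0) ->
  same_dir F G -> size s1 = size s2.
Proof.
move=> H1 H2 u0 v0 FG; apply/eqP; rewrite eqn_leq.
by rewrite (zero_count_le H1 H2 v0 FG) (zero_count_le H2 H1 u0 (same_dir_sym FG)).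
Qed.

End ZeroCount.

Local Open Scope sesquilinear_scope.

(** * The J-unitary matrix function *)

Section AdjointMatrix.
Variables (K : numClosedFieldType).

Lemma adjmxM m n p (A : 'M[K]_(m, n)) (B : 'M[K]_(n, p)) : (A *m B)^t* = B^t* *m A^t*.
Proof. by rewrite trmx_mul map_mxM. Qed.

Lemma adjmxB m n (A B : 'M[K]_(m, n)) : (A - B)^t* = A^t* - B^t*.
Proof. by apply/matrixP => i j; rewrite !mxE rmorphB. Qed.

Lemma adjmxD m n (A B : 'M[K]_(m, n)) : (A + B)^t* = A^t* + B^t*.
Proof. by apply/matrixP => i j; rewrite !mxE rmorphD. Qed.

Lemma adjmxZ m n c (A : 'M[K]_(m, n)) : (c *: A)^t* = c^* *: A^t*.
Proof. by apply/matrixP => i j; rewrite !mxE rmorphM. Qed.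

Lemma adjmx1 n : (1%:M : 'M[K]_n)^t* = 1%:M.
Proof. by rewrite trmx1 map_mx1. Qed.

End AdjointMatrix.

Section ThetaAlgebra.
Variables (K : numClosedFieldType) (N p : nat).
Implicit Types z : K.

(** Only the Stein combination [P - T P T'] enters besides the pencils, which
  is what lets the rank two right-hand side of the Stein equation be inserted. *)
Lemma pencil_identity (T P T' : 'M[K]_N) z :
  (1%:M - T) *m P *m (1%:M - z *: T') + (z - 1) *: (P - T *m P *m T') =
  (z%:M - T) *m P *m (1%:M - T').
Proof.
rewrite !mulmxBl !mulmxBr !mul1mx !mulmx1 mul_scalar_mx -!scalemxAr -!scalemxAl.
move: (T *m P *m T') (P *m T') (T *m P) => A B D.
by apply/matrixP => i j; rewrite !mxE; ring.
Qed.

Lemma kernel_identity (T P T' : 'M[K]_N) z z' :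
  (z - 1) *: ((1%:M - z' *: T) *m P *m (1%:M - T')) +
  (z' - 1) *: ((1%:M - T) *m P *m (1%:M - z *: T')) +
  ((z - 1) * (z' - 1)) *: (P - T *m P *m T') =
  (z * z' - 1) *: ((1%:M - T) *m P *m (1%:M - T')).
Proof.
rewrite !mulmxBl !mulmxBr !mul1mx !mulmx1 -!scalemxAr -!scalemxAl.
move: (T *m P *m T') (P *m T') (T *m P) => A B D.
by apply/matrixP => i j; rewrite !mxE; ring.
Qed.

(** The common computation of [theta_adj] and [theta_coadj]. *)
Lemma congruence_expand (J : 'M[K]_p) (S' U : 'M[K]_(p, N)) (V S : 'M[K]_(N, p))
    (A1 A2 A3 : 'M[K]_N) (a b : K) :
  J *m U = S' *m A1 -> V *m J = A2 *m S -> V *m J *m U = A3 ->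
  (1%:M + a *: (S' *m V)) *m J *m (1%:M + b *: (U *m S)) - J =
  S' *m (b *: A1 + a *: A2 + (b * a) *: A3) *m S.
Proof.
move=> H1 H2 H3; rewrite mulmxDl mul1mx -scalemxAl -[S' *m V *m J]mulmxA.
rewrite [in LHS]mulmxDl [J *m (1%:M + _)]mulmxDr mulmx1 -scalemxAr [J *m (U *m S)]mulmxA H1.
rewrite -scalemxAl [S' *m _ *m (1%:M + _)]mulmxDr mulmx1 -scalemxAr.
have -> : S' *m (V *m J) *m (U *m S) = S' *m A3 *m S by rewrite -H3 !mulmxA.
rewrite H2 !mulmxDr !mulmxDl -!scalemxAr -!scalemxAl !scalerDr !scalerA [S' *m (A2 *m S)]mulmxA.
move: (S' *m A1 *m S) (S' *m A2 *m S) (S' *m A3 *m S) => B1 B2 B3.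
by rewrite [a * b]mulrC; apply/matrixP => i j; rewrite !mxE; ring.
Qed.

Variables (T P : 'M[K]_N) (L : 'M[K]_(p, N)) (F : 'M[K]_(N, p)) (J : 'M[K]_p).
Let T' := T^t*.
Hypothesis FL : F *m L = P - T *m P *m T'.
Hypothesis JF : F^t* = J *m L.
Hypothesis JJ : J *m J = 1%:M.
Hypothesis Jadj : J^t* = J.
Hypothesis Pherm : P^t* = P.
Hypothesis Punit : P \in unitmx.
Hypothesis T1unit : 1%:M - T \in unitmx.

Definition resolvent z := invmx (1%:M - z *: T') *m invmx P *m invmx (1%:M - T).
Definition state z := resolvent z *m F.
Definition theta z := 1%:M + (z - 1) *: (L *m state z).

Lemma thetaE z : theta z = 1%:M + (z - 1) *: (L *m state z).
Proof. by []. Qed.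

Lemma conjB1 (z : K) : (z - 1)^* = z^* - 1.
Proof. by rewrite rmorphB rmorph1. Qed.

Lemma FJL : F = L^t* *m J.
Proof. by rewrite -{1}[F]trmxCK JF adjmxM Jadj. Qed.

Lemma stateK z : 1%:M - z *: T' \in unitmx ->
  (1%:M - T) *m P *m (1%:M - z *: T') *m resolvent z = 1%:M.
Proof.
move=> zu; rewrite /resolvent -!mulmxA (mulmxA (1%:M - z *: T')) mulmxV // mul1mx.
by rewrite (mulmxA P) mulmxV // mul1mx mulmxV.
Qed.

Lemma resolventK z : 1%:M - z *: T' \in unitmx ->
  resolvent z *m ((1%:M - T) *m P *m (1%:M - z *: T')) = 1%:M.
Proof. by move=> zu; apply: mulmx1C; exact: stateK. Qed.

Lemma state_eq z : 1%:M - z *: T' \in unitmx ->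
  (1%:M - T) *m P *m (1%:M - z *: T') *m state z = F.
Proof. by move=> zu; rewrite /state mulmxA stateK // mul1mx. Qed.

(** By [pencil_identity], multiplying [1 + (z - 1) L R(z) F] by [F] on the left
  produces the factor [z - T]. *)
Lemma theta_interp z : 1%:M - z *: T' \in unitmx ->
  F *m theta z = (z%:M - T) *m (P *m (1%:M - T') *m state z).
Proof.
move=> zu; rewrite thetaE mulmxDr mulmx1 -scalemxAr [F *m (L *m _)]mulmxA FL.
rewrite -{1}(state_eq zu) scalemxAl -mulmxDl pencil_identity.
by rewrite -!mulmxA.
Qed.

(** The right-hand side vanishes on the unit circle: there [theta] is
  [J]-unitary. *)
Lemma theta_adj z : 1%:M - z *: T' \in unitmx ->
  (theta z)^t* *m J *m theta z - J =
  (state z)^t* *m ((z * z^* - 1) *: ((1%:M - T) *m P *m (1%:M - T'))) *m state z.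
Proof.
move=> zu; rewrite -kernel_identity.
have FE := state_eq zu; set S := state z in FE *.
have JLE : J *m L = S^t* *m ((1%:M - z^* *: T) *m P *m (1%:M - T')).
  by rewrite -JF -FE !adjmxM !adjmxB !adjmx1 adjmxZ /T' trmxCK Pherm !mulmxA.
have LJE : L^t* *m J = F by rewrite -FJL.
rewrite thetaE -/S adjmxD adjmx1 adjmxZ adjmxM conjB1.
by apply: congruence_expand; rewrite ?LJE ?FE.
Qed.

(** The companion of [theta_adj] for the rows of [theta]. *)
Lemma theta_coadj z : 1%:M - z *: T' \in unitmx ->
  theta z *m J *m (theta z)^t* - J =
  L *m resolvent z *m ((z * z^* - 1) *: ((1%:M - T) *m P *m (1%:M - T'))) *m (L *m resolvent z)^t*.
Proof.
move=> zu; rewrite -kernel_identity; set Y := L *m resolvent z.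
have LE : Y *m ((1%:M - T) *m P *m (1%:M - z *: T')) = L.
  by rewrite /Y -mulmxA resolventK // mulmx1.
have LE' : (1%:M - z^* *: T) *m P *m (1%:M - T') *m Y^t* = L^t*.
  by rewrite -{1}LE !adjmxM !adjmxB !adjmx1 adjmxZ /T' trmxCK Pherm !mulmxA.
have FJE : F *m J = L^t* by rewrite FJL -mulmxA JJ mulmx1.
have JFE : J *m F^t* = L by rewrite JF mulmxA JJ mul1mx.
have thE : theta z = 1%:M + (z - 1) *: (Y *m F) by rewrite thetaE /state mulmxA.
rewrite thE adjmxD adjmx1 adjmxZ adjmxM conjB1.
rewrite [(z - 1) *: _ + (z^* - 1) *: _]addrC [(z - 1) * _]mulrC.
apply: congruence_expand.
- by rewrite JFE LE.
- by rewrite FJE LE'.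
- by rewrite -mulmxA JFE FL.
Qed.

(** If [z - T] is invertible, then by [theta_interp] the kernel of [theta z] lies
  in the kernel of [state z], on which [theta z] is the identity. *)
Lemma theta_inj z (v : 'cV[K]_p) : 1%:M - z *: T' \in unitmx ->
  1%:M - T' \in unitmx -> z%:M - T \in unitmx -> theta z *m v = 0 -> v = 0.
Proof.
move=> zu T'u zT tv.
have : (z%:M - T) *m (P *m ((1%:M - T') *m (state z *m v))) = 0.
  have -> : (z%:M - T) *m (P *m ((1%:M - T') *m (state z *m v))) = F *m theta z *m v.
    by rewrite theta_interp // !mulmxA.
  by rewrite -mulmxA tv mulmx0.
set y := state z *m v => /(congr1 (mulmx (invmx (z%:M - T)))).
rewrite mulKmx // mulmx0 => /(congr1 (mulmx (invmx P))); rewrite mulKmx // mulmx0.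
move=> /(congr1 (mulmx (invmx (1%:M - T')))); rewrite mulKmx // mulmx0 => S0.
by move: tv; rewrite thetaE mulmxDl mul1mx -scalemxAl -mulmxA -/y S0 mulmx0 scaler0 addr0.
Qed.

(** Formally [v] is the inverse of [theta z] applied to [u]; the inverse of
  [z - T] which occurs in it acts on [F u], where it is given by [phi]. In this
  form the equation holds at the eigenvalues of [T] as well. *)
Lemma theta_solve z (u : 'cV[K]_p) (phi : 'cV[K]_N) : 1%:M - z *: T' \in unitmx ->
  1%:M - T' \in unitmx -> (z%:M - T) *m phi = F *m u ->
  theta z *m (u - (z - 1) *: (L *m (invmx (1%:M - T') *m (invmx P *m phi)))) = u.
Proof.
move=> zu T'u Hphi; set y := invmx (1%:M - T') *m _.
have phiE : phi = P *m (1%:M - T') *m y.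
  by rewrite /y -mulmxA mulKVmx // mulKVmx.
have stE : state z *m u = y + (z - 1) *: (state z *m (L *m y)).
  have E : resolvent z *m (((1%:M - T) *m P *m (1%:M - z *: T') +
      (z - 1) *: (P - T *m P *m T')) *m y) = y + (z - 1) *: (state z *m (L *m y)).
    rewrite mulmxDl mulmxDr; congr (_ + _).
      by rewrite (mulmxA (resolvent z)) resolventK // mul1mx.
    by rewrite -scalemxAl -scalemxAr -FL /state -!mulmxA.
  by rewrite -E pencil_identity /state -mulmxA -Hphi phiE -!mulmxA.
rewrite thetaE mulmxDl mul1mx -scalemxAl mulmxBr -scalemxAr -[L *m state z *m u]mulmxA stE.
rewrite mulmxDr -!scalemxAr -[L *m state z *m (L *m y)]mulmxA.
move: (L *m y) (L *m _) => A1 A2.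
by rewrite addrK subrK.
Qed.

End ThetaAlgebra.

(** * Inertia of Hermitian matrices *)

Section Inertia.
Variable K : numClosedFieldType.

Definition qform n (Q : 'M[K]_n) (x : 'cV[K]_n) : K := (x^t* *m Q *m x) 0 0.

Lemma qform_congr n (Q S : 'M[K]_n) x : qform (S^t* *m Q *m S) x = qform Q (S *m x).
Proof. by rewrite /qform adjmxM !mulmxA. Qed.

Lemma qform_diag n (d : 'rV[K]_n) x :
  qform (diag_mx d) x = \sum_i d 0 i * (x i 0 * (x i 0)^*).
Proof.
rewrite /qform mul_mx_diag mxE; apply: eq_bigr => i _.
by rewrite !mxE; ring.
Qed.

(** If [diag e] had fewer negative entries, then the span of the negative basis
  vectors of [diag d] would contain a nonzero vector whose image under [S] has no
  component along the negative basis vectors of [diag e]. *)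
Lemma congr_diag_le n (S : 'M[K]_n) (e d : 'rV[K]_n) :
  (forall i, e 0 i \is Num.real) ->
  S^t* *m diag_mx e *m S = diag_mx d ->
  (#|[pred i : 'I_n | (d 0 i < 0)%R]| <= #|[pred i : 'I_n | (e 0 i < 0)%R]|)%N.
Proof.
move=> er SE; set A := [pred i : 'I_n | (d 0 i < 0)%R]; set B := [pred i : 'I_n | (e 0 i < 0)%R].
rewrite leqNgt; apply/negP => BA.
pose M := \matrix_(a < #|A|, b < #|B|) S (enum_val b) (enum_val a).
have kM : kermx M != 0.
  rewrite -mxrank_eq0 mxrank_ker -lt0n subn_gt0.
  by apply: leq_ltn_trans BA; exact: rank_leq_col.
have [u uM u0] : exists2 u : 'rV_#|A|, u *m M = 0 & u != 0.
  have /rowV0Pn [u uk u0] := kM.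
  by exists u => //; apply/sub_kermxP.
pose x := \col_i \sum_(a < #|A|) (if enum_val a == i then u 0 a else 0).
have xA a : x (enum_val a) 0 = u 0 a.
  rewrite mxE (bigD1 a) //= eqxx big1 ?addr0 // => b ba.
  by case: eqVneq => // /enum_val_inj ab; rewrite ab eqxx in ba.
have xnA i : i \notin A -> x i 0 = 0.
  move=> iA; rewrite mxE big1 // => a _; case: eqVneq => // ai.
  by move: iA; rewrite -ai enum_valP.
have SxB j : j \in B -> (S *m x) j 0 = 0.
  move=> jB; have /matrixP /(_ 0 (enum_rank_in jB j)) := uM.
  rewrite !mxE => H; rewrite -[RHS]H.
  transitivity (\sum_i \sum_(a < #|A|) S j i * (if enum_val a == i then u 0 a else 0)).
    by apply: eq_bigr => i _; rewrite mxE mulr_sumr.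
  rewrite exchange_big /=; apply: eq_bigr => a _.
  rewrite (bigD1 (enum_val a)) //= eqxx big1 ?addr0 => [|i]; last first.
    by rewrite eq_sym => /negPf ->; rewrite mulr0.
  by rewrite mxE enum_rankK_in // mulrC.
have [a ua0] : exists a, u 0 a != 0.
  apply/existsP; apply: contraR u0; rewrite negb_exists => /forallP H.
  by apply/eqP/rowP => a; rewrite mxE; apply/eqP; have := H a; rewrite negbK.
have : qform (diag_mx d) x < 0.
  rewrite qform_diag (bigD1 (enum_val a)) //= xA.
  apply: ltr_wnDr.
    apply: sumr_le0 => i _; have [iA|iA] := boolP (i \in A); last first.
      by rewrite xnA // mul0r mulr0.
    by rewrite nmulr_rle0 ?mul_conjC_ge0 //; move: iA; rewrite inE.
  rewrite nmulr_rlt0 ?mul_conjC_gt0 //.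
  by have := enum_valP a; rewrite inE.
rewrite -SE qform_congr qform_diag => /lt_geF /negP; apply.
apply: sumr_ge0 => j _; have [jB|jB] := boolP (j \in B).
  by rewrite SxB // mul0r mulr0.
rewrite mulr_ge0 ?mul_conjC_ge0 //.
by move: jB; rewrite inE -real_leNgt // real0.
Qed.

Lemma sylvester_inertia n (S : 'M[K]_n) (e d : 'rV[K]_n) :
  S \in unitmx ->
  (forall i, e 0 i \is Num.real) -> (forall i, d 0 i \is Num.real) ->
  S^t* *m diag_mx e *m S = diag_mx d ->
  #|[pred i : 'I_n | (d 0 i < 0)%R]| = #|[pred i : 'I_n | (e 0 i < 0)%R]|.
Proof.
move=> Su er dr SE; apply/eqP; rewrite eqn_leq (congr_diag_le er SE) /=.
apply: (@congr_diag_le _ (invmx S)) => //; rewrite -SE !mulmxA -adjmxM mulmxV //.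
by rewrite adjmx1 mul1mx -mulmxA mulmxV // mulmx1.
Qed.

Lemma count_prod_XsubC (rs ds : seq K) (p : pred K) :
  \prod_(r <- rs) ('X - r%:P) = \prod_(r <- ds) ('X - r%:P) -> count p rs = count p ds.
Proof.
move=> E; apply/permP; elim: rs ds E => [|r rs IH] ds E.
  case: ds E => // d ds /(congr1 (fun q : {poly K} => size q)).
  by rewrite !size_prod_XsubC.
have rds : r \in ds.
  by rewrite -root_prod_XsubC -E root_prod_XsubC mem_head.
rewrite perm_sym (permPl (perm_to_rem rds)) perm_cons perm_sym; apply: IH.
move: E; rewrite big_cons (perm_big _ (perm_to_rem rds)) big_cons.
by apply: mulfI; rewrite polyXsubC_eq0.
Qed.

Lemma char_poly_similar n (U A D : 'M[K]_n) : U \in unitmx ->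
  A = invmx U *m D *m U -> char_poly A = char_poly D.
Proof.
move=> Uu ->; rewrite /char_poly.
have -> : char_poly_mx (invmx U *m D *m U) =
    map_mx polyC (invmx U) *m char_poly_mx D *m map_mx polyC U.
  rewrite /char_poly_mx !map_mxM mulmxBr mulmxBl; congr (_ - _).
  by rewrite -mulmxA mul_scalar_mx -scalemxAr -map_mxM mulVmx // map_mx1 scalemx1.
rewrite !det_mulmx mulrAC -det_mulmx -map_mxM mulVmx //.
by rewrite map_mx1 det1 mul1r.
Qed.

Lemma sq_neg_similar n (U A : 'M[K]_n) (d : 'rV[K]_n) : U \in unitmx ->
  A = invmx U *m diag_mx d *m U -> sq_neg A = #|[pred i : 'I_n | (d 0 i < 0)%R]|.
Proof.
move=> Uu AE; rewrite /sq_neg; case: closed_field_poly_normal => rs /= rsE.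
have dE : char_poly A = \prod_(r <- [seq d 0 i | i <- enum 'I_n]) ('X - r%:P).
  rewrite (char_poly_similar Uu AE) char_poly_trig ?diag_mx_is_trig //.
  rewrite big_map big_enum /=; apply: eq_bigr => i _.
  by rewrite mxE eqxx mulr1n.
rewrite (@count_prod_XsubC rs [seq d 0 i | i <- enum 'I_n]).
  rewrite count_map cardE -size_filter; congr size.
  by rewrite /enum_mem -filter_predI; apply: eq_filter => i; rewrite /= inE andbT.
rewrite -dE rsE (monicP (char_poly_monic A)) scale1r //.
Qed.

(** Sylvester's law of inertia, with the spectral theorem giving one
  diagonalization of [P]. *)
Lemma sq_neg_congr n (P S : 'M[K]_n) (d : 'rV[K]_n) : P^t* = P -> S \in unitmx ->
  (forall i, d 0 i \is Num.real) -> S^t* *m P *m S = diag_mx d ->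
  sq_neg P = #|[pred i : 'I_n | (d 0 i < 0)%R]|.
Proof.
move=> Ph Su dr SE.
have Pherm : P \is hermsymmx.
  by apply/is_hermitianmxP; rewrite expr0 scale1r Ph.
have /orthomx_spectralP PE := hermitian_normalmx Pherm.
have er i : spectral_diag P 0 i \is Num.real.
  by have /mxOverP := hermitian_spectral_diag_real Pherm; apply.
move: PE er (spectral_unit P) (spectral_unitarymx P).
move: (spectralmx P) (spectral_diag P) => U e PE er Uu Uun.
rewrite (sq_neg_similar Uu PE); apply/esym.
apply: (@sylvester_inertia _ (U *m S)) => //; first by rewrite unitmx_mul Uu.
by rewrite -SE PE (invmx_unitary Uun) adjmxM !mulmxA.
Qed.

(** Completing the square: if [b y] were not 0, the form would be negative on
  the vector with first entry [- b y / al] and remaining entries [y]. *)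
Lemma psd_kernel n (Q : 'M[K]_(1 + n)) (b : 'M[K]_(1, n)) (al : K) (Q1 : 'M[K]_n) y :
  Q = block_mx al%:M b (b^t*) Q1 -> 0 < al -> (forall x, 0 <= qform Q x) ->
  qform Q1 y = 0 -> b *m y = 0.
Proof.
move=> QE al0 Qpsd Qy; set be := (b *m y) 0 0.
have byE : b *m y = be%:M by rewrite [LHS]mx11_scalar.
have alr : al^* = al by apply/CrealP; rewrite realE ltW.
have := Qpsd (col_mx (- be / al)%:M y).
rewrite /qform QE tr_col_mx map_row_mx mul_row_block mul_row_col.
rewrite mulmxDl mulmxDl.
have -> : (y^t* *m Q1 *m y) = 0.
  by rewrite [LHS]mx11_scalar -/(qform Q1 y) Qy; exact: raddf0.
have yb : y^t* *m b^t* = (be^*)%:M.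
  by rewrite -adjmxM byE; apply/matrixP => i j; rewrite !ord1 !mxE eqxx !mulr1n.
have te : ((- be / al)%:M : 'M[K]_1)^t* = (- be^* / al)%:M.
  by apply/matrixP => i j; rewrite !ord1 !mxE eqxx !mulr1n rmorphM rmorphN fmorphV /= alr.
rewrite te yb -!mulmxA byE -!scalar_mxM !mxE !eqxx !mulr1n addr0.
have -> : - be^* / al * (al * (- be / al)) + be^* * (- be / al) + - be^* / al * be =
   - (be * be^* / al) by field; rewrite gt_eqF.
rewrite oppr_ge0 pmulr_lle0 ?invr_gt0 // => H.
have : be * be^* == 0 by rewrite eq_le H mul_conjC_ge0.
by rewrite mul_conjC_eq0 => /eqP ->; exact: raddf0.
Qed.

(** The inertia theorem of Lyapunov, for an observable pair: [H] has as many
  positive and negative squares as [W] has eigenvalues in the right and left half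
  plane. With [W] triangular the first basis vector [e] is an eigenvector, and the
  form takes the value [2 h Re la] on it, which is positive by observability;
  eliminating [e] from [H] by a congruence leaves a problem of the same kind in
  one dimension less. *)
Lemma lyapunov_inertia n (W H : 'M[K]_n) : is_trig_mx W^T -> H^t* = H ->
  (forall x, 0 <= qform (H *m W + W^t* *m H) x) ->
  (forall x la, W *m x = la *: x -> qform (H *m W + W^t* *m H) x = 0 -> x = 0) ->
  exists2 S, S \in unitmx & exists2 d : 'rV[K]_n, S^t* *m H *m S = diag_mx d &
    forall i, d 0 i \is Num.real /\ 0 < d 0 i * (W i i + (W i i)^*).
Proof.
elim: n W H => [|n IH].
  move=> W H _ _ _ _; exists 1%:M; first exact: unitmx1.
  by exists 0 => [|[]//]; apply/matrixP => -[].
rewrite -[n.+1]/(1 + n)%N => W H Wt Hh Qpsd obs.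
pose la := W 0 0; pose h := H 0 0.
pose e : 'cV[K]_(1 + n) := col_mx 1%:M 0.
pose w := ursubmx (W : 'M_(1 + n)); pose W1 := drsubmx (W : 'M_(1 + n)).
have WE : W = block_mx la%:M w 0 W1 :> 'M_(1 + n).
  rewrite -[W in LHS](@submxK _ 1 n 1 n); congr block_mx.
    by apply/matrixP => i j; rewrite !ord1 !mxE eqxx mulr1n; congr (W _ _); exact: val_inj.
  apply/matrixP => i j; rewrite !mxE.
  by move/is_trig_mxP: Wt => /(_ (lshift n j) (rshift 1 i)); rewrite mxE; apply; rewrite /= ord1.
pose r := ursubmx (H : 'M_(1 + n)); pose H1 := drsubmx (H : 'M_(1 + n)).
have hr : h^* = h.
  by have /matrixP /(_ 0 0) := Hh; rewrite !mxE.
have HE : H = block_mx h%:M r (r^t*) H1 :> 'M_(1 + n).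
  rewrite -[H in LHS](@submxK _ 1 n 1 n); congr block_mx.
    by apply/matrixP => i j; rewrite !ord1 !mxE eqxx mulr1n; congr (H _ _); exact: val_inj.
  by rewrite -{1}Hh; apply/matrixP => i j; rewrite !mxE.
have H1h : H1^t* = H1.
  apply/matrixP => i j; have /matrixP /(_ (rshift 1 i) (rshift 1 j)) := Hh.
  by rewrite !mxE.
have We : W *m e = la *: e.
  rewrite WE /e mul_block_col mulmx0 mul0mx !mulmx1 !addr0 scale_col_mx scaler0.
  by rewrite scalemx1 mulmx0 addr0.
have e0 : e != 0.
  apply/negP => /eqP /matrixP /(_ (lshift n 0) 0); rewrite col_mxEu !mxE /= => /eqP.
  by rewrite oner_eq0.
have qe : qform (H *m W + W^t* *m H) e = h * (la + la^*).
  have : e^t* *m H *m e = h%:M.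
    rewrite HE /e tr_col_mx map_row_mx mul_row_block mul_row_col !trmx0 !map_mx0 !mul0mx !addr0.
    by rewrite mulmx0 addr0 mulmx1 trmx1 map_mx1 mul1mx.
  move=> eHe; rewrite /qform mulmxDr mulmxDl mxE !mulmxA.
  rewrite -[_ *m W *m e]mulmxA We -scalemxAr eHe.
  rewrite -(adjmxM W e) We adjmxZ -!scalemxAl eHe !mxE eqxx mulr1n.
  ring.
have al0 : 0 < h * (la + la^*).
  rewrite lt_def -qe Qpsd andbT; apply/negP => /eqP /(obs _ _ We) /eqP.
  by rewrite (negPf e0).
have h0 : h != 0 by apply/negP => /eqP hz; rewrite hz mul0r ltxx in al0.
(* The congruence that splits the first basis vector off [H]; it keeps [W]
  block triangular. *)
pose S0 : 'M[K]_(1 + n) := block_mx 1%:M (- h^-1 *: r) 0 1%:M.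
pose S0' : 'M[K]_(1 + n) := block_mx 1%:M (h^-1 *: r) 0 1%:M.
have SS : S0 *m S0' = 1%:M.
  rewrite mulmx_block !mulmx0 !mul0mx !mul1mx !mulmx1 !addr0 !add0r.
  by rewrite scaleNr subrr -scalar_mx_block.
have SS' : S0' *m S0 = 1%:M by exact: mulmx1C.
have S0u : S0 \in unitmx by case: (mulmx1_unit SS).
pose H1' := H1 - h^-1 *: (r^t* *m r).
have HE' : S0^t* *m H *m S0 = block_mx h%:M 0 0 H1'.
  rewrite HE /S0 tr_block_mx map_block_mx !trmx0 !map_mx0 !trmx1 !map_mx1 adjmxZ.
  rewrite rmorphN fmorphV /= hr.
  rewrite !mulmx_block !mul0mx !mulmx0 !mul1mx !mulmx1 !addr0 !scaleNr.
  have E1 : h%:M *m (- (h^-1 *: r)) + r = 0.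
    by rewrite mulmxN mul_scalar_mx scalerA divff // scale1r addNr.
  have E2 : - (h^-1 *: r^t*) *m h%:M + r^t* = 0.
    by rewrite mulNmx mul_mx_scalar scalerA divff // scale1r addNr.
  rewrite E1 E2 mul0mx add0r; congr block_mx.
  by rewrite mulNmx -scalemxAl addrC.
pose w' := la *: (- h^-1 *: r) + w + h^-1 *: (r *m W1).
have WE' : S0' *m W *m S0 = block_mx la%:M w' 0 W1.
  rewrite WE /S0 /S0' !mulmx_block !mul0mx !mulmx0 !mul1mx !mulmx1 !addr0 !add0r.
  by rewrite mul0mx add0r mul_scalar_mx -scalemxAl /w' addrA.
set Q := H *m W + W^t* *m H in Qpsd obs qe.
pose Q1 := H1' *m W1 + W1^t* *m H1'.
have QE' : S0^t* *m Q *m S0 = block_mx (h * (la + la^*))%:M (h *: w') ((h *: w')^t*) Q1.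
  have -> : S0^t* *m Q *m S0 = (S0^t* *m H *m S0) *m (S0' *m W *m S0) +
      (S0' *m W *m S0)^t* *m (S0^t* *m H *m S0).
    rewrite /Q mulmxDr mulmxDl !adjmxM; congr (_ + _).
      by rewrite !mulmxA -[_ *m S0 *m S0']mulmxA SS mulmx1.
    rewrite !mulmxA -[_ *m S0'^t* *m S0^t*]mulmxA -(adjmxM S0 S0') SS adjmx1 mulmx1 //.
  rewrite HE' WE' tr_block_mx map_block_mx trmx0 map_mx0 !mulmx_block.
  rewrite !mul0mx !mulmx0 !addr0 !add0r add_block_mx addr0 add0r.
  congr block_mx.
  - rewrite -scalar_mxM; apply/matrixP => i j; rewrite !ord1 !mxE eqxx !mulr1n big_ord1 !mxE eqxx !mulr1n; ring.
  - by rewrite mul_scalar_mx.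
  - by rewrite adjmxZ hr mul_mx_scalar.
have Qpsd' x : 0 <= qform (S0^t* *m Q *m S0) x by rewrite qform_congr.
have Q1E y : qform Q1 y = qform (S0^t* *m Q *m S0) (col_mx 0 y).
  rewrite QE' /qform tr_col_mx map_row_mx mul_row_block mul_row_col !trmx0 !map_mx0.
  by rewrite !mul0mx !mulmx0 !add0r.
have W1t : is_trig_mx W1^T.
  apply/is_trig_mxP => i j ij; rewrite !mxE.
  by move/is_trig_mxP: Wt => /(_ (rshift 1 i) (rshift 1 j)); rewrite mxE; apply; rewrite /= ltn_add2l.
have H1'h : H1'^t* = H1'.
  by rewrite /H1' adjmxB H1h adjmxZ fmorphV /= hr adjmxM trmxCK.
have [|y mu Wy Qy|S1 S1u [d1 d1E d1P]] := IH W1 H1' W1t H1'h.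
- by move=> y; rewrite -/Q1 Q1E.
- have wy : (h *: w') *m y = 0 by apply: (psd_kernel QE' al0 Qpsd').
  have w'y : w' *m y = 0.
    by apply/eqP; move/eqP: wy; rewrite -scalemxAl scaler_eq0 (negPf h0).
  have : S0 *m col_mx 0 y = 0.
    apply: (obs _ mu); last by rewrite -qform_congr -Q1E.
    have : S0' *m W *m S0 *m col_mx 0 y = mu *: col_mx 0 y.
      by rewrite WE' mul_block_col mulmx0 mul0mx !add0r w'y Wy scale_col_mx scaler0.
    move=> /(congr1 (mulmx S0)); rewrite -scalemxAr => <-.
    by rewrite !mulmxA SS mul1mx.
  move=> /(congr1 (mulmx S0')); rewrite mulmxA SS' mul1mx mulmx0 => /eqP.
  by rewrite -col_mx0 => /eqP /eq_col_mx [].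
exists (S0 *m block_mx 1%:M 0 0 S1).
  rewrite unitmx_mul S0u /= unitmxE det_ublock det1 mul1r -unitmxE //.
exists (row_mx h%:M d1) => [|i].
  rewrite adjmxM !mulmxA -[_ *m S0^t* *m H]mulmxA -[_ *m _ *m S0]mulmxA HE'.
  rewrite tr_block_mx map_block_mx !trmx0 !map_mx0 trmx1 map_mx1 !mulmx_block.
  rewrite !mul0mx !mulmx0 !mul1mx !mulmx1 !addr0 !add0r d1E diag_mx_row.
  by rewrite ?mul0mx; congr block_mx; apply/matrixP => i j; rewrite !ord1 !mxE eqxx !mulr1n.
rewrite mxE; case: splitP => j ij.
  have -> : i = 0 by apply: val_inj; rewrite /= ij ord1.
  by rewrite ord1 mxE eqxx mulr1n; split=> //; apply/CrealP.
have iE : i = rshift 1 j by apply: val_inj.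
by have := d1P j; rewrite !mxE iE.
Qed.

End Inertia.

(** * The zeros of the (2,2) entry *)

Section ThetaZeros.
Variables (K : numClosedFieldType) (N : nat).
Implicit Types z : K.

Lemma det_rank_one (u : 'cV[K]_N) (v : 'rV[K]_N) :
  \det (1%:M + u *m v) = 1 + (v *m u) 0 0.
Proof.
pose B : 'M[K]_(1 + N) := block_mx 1%:M (- v) u 1%:M.
have E1 : B = block_mx (1%:M : 'M_1) 0 u 1%:M *m block_mx 1%:M (- v) 0 (1%:M + u *m v).
  rewrite mulmx_block !mul0mx !mulmx0 !mul1mx !mulmx1 !addr0.
  by rewrite mulmxN addrC addrK.
have E2 : B = block_mx (1%:M + v *m u) (- v) 0 1%:M *m block_mx (1%:M : 'M_1) 0 u 1%:M.
  rewrite mulmx_block !mul0mx !mulmx0 !mul1mx !mulmx1 !add0r.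
  by rewrite mulNmx addrK.
have := congr1 determinant E1; rewrite {}E2 !det_mulmx !det_lblock !det_ublock !det1 !mul1r !mulr1.
by move=> <-; rewrite det_mx11 !mxE eqxx mulr1n.
Qed.

Variables (T P : 'M[K]_N) (E Cv : 'cV[K]_N).
Let T' := T^t*.
Hypothesis stein : P - T *m P *m T' = E *m E^t* - Cv *m Cv^t*.
Hypothesis Pherm : P^t* = P.
Hypothesis Punit : P \in unitmx.
Hypothesis T1unit : 1%:M - T \in unitmx.
Hypothesis T1'unit : 1%:M - T' \in unitmx.
Hypothesis observable : forall (x : 'cV[K]_N) (mu : K),
  T' *m x = mu *: x -> E^t* *m x = 0 -> x = 0.

Let D := invmx P *m invmx (1%:M - T) *m Cv *m Cv^t*.

(** Its eigenvalues are the images under [z |-> (z + 1) / (z - 1)] of the zeros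
  of the (2,2) entry times [\det (1%:M - z *: T')]; the eigenvalue 1 stands for
  a zero at infinity. *)
Definition zero_matrix := 1%:M + (2 : K) *: (invmx (1%:M - T') *m (T' + D)).

(** By the matrix determinant lemma [det_rank_one]. *)
Lemma theta22_det z : 1%:M - z *: T' \in unitmx ->
  \det (1%:M - z *: T') * (1 - (z - 1) * (Cv^t* *m (resolvent T P z *m Cv)) 0 0) =
  \det (1%:M - T') * \det ((2^-1 : K) *: ((1 + z)%:M + (1 - z) *: zero_matrix)).
Proof.
move=> zu.
have -> : 1 - (z - 1) * (Cv^t* *m (resolvent T P z *m Cv)) 0 0 =
   \det (1%:M + ((1 - z) *: (resolvent T P z *m Cv)) *m Cv^t*).
  rewrite det_rank_one -scalemxAr [in RHS]mxE; ring.
rewrite -!det_mulmx; congr determinant.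
rewrite mulmxDr mulmx1 -scalemxAl -scalemxAr /resolvent -/T'.
have -> : (1%:M - z *: T') *m (invmx (1%:M - z *: T') *m invmx P *m invmx (1%:M - T) *m Cv *m Cv^t*) = D.
  by rewrite !mulmxA mulmxV // mul1mx.
rewrite -scalemxAr mulmxDr -scalemxAr mul_mx_scalar /zero_matrix mulmxDr mulmx1 -scalemxAr mulKVmx //.
move: D => D'; apply/matrixP => i j; rewrite !mxE; field.
by [].
Qed.

Let H := (1%:M - T) *m P *m (1%:M - T').

(** The Stein equation after the Cayley transform. *)
Lemma zero_matrix_lyapunov :
  H *m zero_matrix + zero_matrix^t* *m H = (2 : K) *: (E *m E^t* + Cv *m Cv^t*).
Proof.
have Hh : H^t* = H by rewrite /H !adjmxM !adjmxB adjmx1 /T' trmxCK Pherm mulmxA.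
have HW : H *m zero_matrix = (1%:M - T) *m P *m (1%:M + T') + (2 : K) *: (Cv *m Cv^t*).
  have -> : 1%:M + T' = (1%:M - T') + (2 : K) *: T'.
    by apply/matrixP => i j; rewrite !mxE; ring.
  rewrite /zero_matrix mulmxDr mulmx1 [in RHS]mulmxDr -!scalemxAr -addrA; congr (_ + _).
  rewrite -scalerDr; congr (_ *: _).
  rewrite /H -[_ *m (1%:M - T') *m _]mulmxA mulKVmx // mulmxDr; congr (_ + _).
  rewrite /D !mulmxA -[(1%:M - T) *m P *m invmx P]mulmxA mulmxV // mulmx1 mulmxV // mul1mx //.
have WH : zero_matrix^t* *m H = (H *m zero_matrix)^t* by rewrite adjmxM Hh.
rewrite WH HW adjmxD adjmxZ !adjmxM [(1%:M - T)^t*]adjmxB [(1%:M + T')^t*]adjmxD adjmx1 /T' !trmxCK Pherm.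
have -> : (2 : K)^* = 2 by rewrite rmorph_nat.
have -> : (2 : K) *: (E *m E^t* + Cv *m Cv^t*) = (2 : K) *: (P - T *m P *m T') + (4 : K) *: (Cv *m Cv^t*).
  by rewrite stein; apply/matrixP => i j; rewrite !mxE; ring.
rewrite -/T' !mulmxBl !mulmxDr !mul1mx !mulmx1 mulmxDl mulmxDl mul1mx !mulmxA.
rewrite !mulmxN !mul1mx.
move: (T *m P *m T') (T *m P) (P *m T') (Cv *m _) => X1 X2 X3 X4.
by apply/matrixP => i j; rewrite !mxE; ring.
Qed.

Lemma add_conj_real (w : K) : w + w^* \is Num.real.
Proof. by rewrite CrealE rmorphD /= conjCK addrC. Qed.

Lemma row_form n (u x : 'cV[K]_n) : x^t* *m (u *m u^t*) *m x = ((u^t* *m x) 0 0 * ((u^t* *m x) 0 0)^*)%:M.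
Proof.
have -> : x^t* *m (u *m u^t*) *m x = (u^t* *m x)^t* *m (u^t* *m x).
  by rewrite adjmxM trmxCK !mulmxA.
by apply/matrixP => i j; rewrite !ord1 !mxE big_ord1 !mxE eqxx mulr1n mulrC.
Qed.

(** On a vector annihilated by the adjoint of [C] the matrix acts as the
  Cayley transform of [T']. *)
Lemma zero_matrix_observable (y : 'cV[K]_N) la : zero_matrix *m y = la *: y ->
  E^t* *m y = 0 -> Cv^t* *m y = 0 -> y = 0.
Proof.
move=> Wy Ex Cx; have Dy : D *m y = 0 by rewrite /D -mulmxA Cx mulmx0.
have {}Wy : T' *m y + y = la *: (y - T' *m y).
  have := congr1 (mulmx (1%:M - T')) Wy.
  rewrite /zero_matrix mulmxA mulmxDr mulmx1 -scalemxAr mulKVmx // mulmxDl -scalemxAl.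
  rewrite [(T' + D) *m y]mulmxDl Dy addr0 -scalemxAr mulmxBl mul1mx => <-.
  by apply/matrixP => i j; rewrite !mxE; ring.
have [la1|la1] := eqVneq (1 + la) 0.
  have {}la1 : la = -1 by apply/eqP; rewrite -subr_eq0 opprK addrC la1.
  move: Wy; rewrite la1; move: (T' *m y) => x Wy.
  apply/matrixP => i j; have /matrixP /(_ i j) := Wy; rewrite !mxE => H1.
  apply/eqP; have : 2 * y i j = 0.
    by rewrite -(subrr (-1 * (y i j - x i j))) -{1}H1; ring.
  by move/eqP; rewrite mulf_eq0 pnatr_eq0.
apply: (observable (mu := (la - 1) / (1 + la))) => //.
have : (1 + la) *: (T' *m y) = (la - 1) *: y.
  move: (T' *m y) Wy => x Wy.
  apply/matrixP => i j; have /matrixP /(_ i j) := Wy; rewrite !mxE => H1.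
  rewrite -[RHS]addr0 -(subrr (la * (y i j - x i j))) -{1}H1; ring.
move=> /(congr1 (fun X => (1 + la)^-1 *: X)); rewrite !scalerA mulVf // scale1r => ->.
by rewrite mulrC.
Qed.

(** Lyapunov's inertia theorem for [zero_matrix], made triangular by a unitary
  similarity. The numbers [lam] are its eigenvalues. *)
Lemma theta22_zeros : exists (c : K) (lam : 'I_N -> K),
  [/\ c != 0,
      forall z, 1%:M - z *: T' \in unitmx ->
        \det (1%:M - z *: T') * (1 - (z - 1) * (Cv^t* *m (resolvent T P z *m Cv)) 0 0) =
        c * \prod_i ((1 + z) + (1 - z) * lam i),
      forall i, lam i + (lam i)^* \is Num.real /\ lam i + (lam i)^* != 0 &
      sq_neg P = #|[pred i : 'I_N | (lam i + (lam i)^* < 0)%R]|].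
Proof.
have Hh : H^t* = H by rewrite /H !adjmxM !adjmxB adjmx1 /T' trmxCK Pherm mulmxA.
have [V Vu VW] : exists2 V : 'M[K]_N, V \in unitmx & is_trig_mx (V *m zero_matrix *m invmx V)^T.
  have [|U Uu Ut] := @cotrigonalization K N [:: zero_matrix^t*].
    by move=> A B; rewrite !inE => /eqP -> /eqP ->.
  exists U; first exact: unitarymx_unit.
  move: Ut; rewrite /= andbT /similar_to conjumx ?unitarymx_unit // invmx_unitary //.
  move=> /is_trig_mxP Ut; apply/is_trig_mxP => i j ij.
  have := Ut i j ij; rewrite -{1}[U]trmxCK -!adjmxM mulmxA mxE [in X in X -> _]mxE => /eqP.
  by rewrite conjC_eq0 [X in _ -> X = _]mxE => /eqP.
pose W := V *m zero_matrix *m invmx V.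
have WE : zero_matrix = invmx V *m W *m V.
  by rewrite /W !mulmxA mulVmx // mul1mx -mulmxA mulVmx // mulmx1.
pose H' := (invmx V)^t* *m H *m invmx V.
have H'h : H'^t* = H' by rewrite /H' adjmxM [(_ *m H)^t*]adjmxM trmxCK Hh mulmxA.
have QE : H' *m W + W^t* *m H' = (invmx V)^t* *m (H *m zero_matrix + zero_matrix^t* *m H) *m invmx V.
  rewrite /H' /W !adjmxM mulmxDr mulmxDl; congr (_ + _).
    by rewrite !mulmxA -[_ *m invmx V *m V]mulmxA mulVmx // mulmx1.
  rewrite !mulmxA -[_ *m V^t* *m (invmx V)^t*]mulmxA -(adjmxM (invmx V) V) mulVmx // adjmx1 mulmx1 //.
rewrite -/W in VW; clearbody W.
have qE x : qform (H' *m W + W^t* *m H') x =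
    2 * ((E^t* *m (invmx V *m x)) 0 0 * ((E^t* *m (invmx V *m x)) 0 0)^* +
         (Cv^t* *m (invmx V *m x)) 0 0 * ((Cv^t* *m (invmx V *m x)) 0 0)^*).
  rewrite QE qform_congr zero_matrix_lyapunov /qform -scalemxAr -scalemxAl mulmxDr mulmxDl.
  by rewrite !row_form [LHS]mxE [X in _ * X]mxE; congr (_ * (_ + _)); rewrite mxE eqxx mulr1n.
have [x|x la Wx|S Su [d dE dP]] := lyapunov_inertia VW H'h.
- by rewrite qE mulr_ge0 // addr_ge0 // mul_conjC_ge0.
- rewrite qE => /eqP; rewrite mulf_eq0 pnatr_eq0 /=.
  rewrite paddr_eq0 ?mul_conjC_ge0 // !mul_conjC_eq0 => /andP[/eqP Ex /eqP Cx].
  set y := invmx V *m x in Ex Cx.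
  have {}Ex : E^t* *m y = 0 by rewrite [LHS]mx11_scalar Ex; exact: raddf0.
  have {}Cx : Cv^t* *m y = 0 by rewrite [LHS]mx11_scalar Cx; exact: raddf0.
  have Wy : zero_matrix *m y = la *: y.
    by rewrite WE /y -!mulmxA mulKVmx // Wx -scalemxAr.
  have y0 : y = 0 by apply: zero_matrix_observable Wy Ex Cx.
  by move: (mulKVmx Vu x); rewrite -/y y0 mulmx0.
(* The constant collects the factors that [theta22_det] leaves. *)
exists (\det (1%:M - T') * 2^-1 ^+ N), (fun i => W i i); split=> [|z zu|i|].
- rewrite mulf_neq0 ?expf_neq0 ?invr_eq0 ?pnatr_eq0 //.
  by rewrite -unitfE -unitmxE.
- rewrite theta22_det // -mulrA; congr (_ * _); rewrite detZ; congr (_ * _).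
  have -> : (1 + z)%:M + (1 - z) *: zero_matrix = invmx V *m ((1 + z)%:M + (1 - z) *: W) *m V.
    rewrite mulmxDr mulmxDl -scalemxAr -scalemxAl -WE; congr (_ + _).
    by rewrite mul_mx_scalar -scalemxAl mulVmx // scalemx1.
  rewrite !det_mulmx mulrAC -det_mulmx mulVmx // det1 mul1r -det_tr det_trig.
    by apply: eq_bigr => i _; rewrite !mxE eqxx mulr1n.
  apply/is_trig_mxP => i j ij; rewrite !mxE; move/is_trig_mxP: VW => /(_ i j ij).
  by rewrite mxE => ->; rewrite mulr0 addr0 eq_sym -val_eqE /= ltn_eqF.
- have [_ dw] := dP i; split; first exact: add_conj_real.
  by apply/negP => /eqP w0; rewrite w0 mulr0 ltxx in dw.
(* [P] and [H] are congruent through [1 - T']. *)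
have Su' : (1%:M - T') *m invmx V *m S \in unitmx.
  by rewrite !unitmx_mul unitmx_inv T1'unit Vu.
rewrite (@sq_neg_congr _ _ P ((1%:M - T') *m invmx V *m S) d) // => [|i|].
- apply: eq_card => i; rewrite !inE; have [dr dw] := dP i.
  have wr : W i i + (W i i)^* \is Num.real by exact: add_conj_real.
  case: (real_ltgtP dr (real0 _)) dw => [d0|d0|->]; last by rewrite mul0r ltxx.
    by rewrite nmulr_rgt0 // => ->.
  rewrite pmulr_rgt0 // => w0; symmetry; apply/negbTE.
  by rewrite -real_leNgt ?real0 // ltW.
- by have [] := dP i.
- by rewrite -dE /H' /H !adjmxM adjmxB adjmx1 /T' trmxCK !mulmxA.
Qed.

End ThetaZeros.

(** * The Jordan block structure of the data *)

Section Blocks.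
Variable K : numClosedFieldType.

(** Coordinates are indexed by all of [nat], with value 0 beyond the dimension,
  so that the recursion of a Jordan block needs no boundary case at the last
  row. *)
Definition entry m (v : 'cV[K]_m) (l : nat) : K :=
  if insub l is Some j then v j 0 else 0.

Lemma entry_ord m (v : 'cV[K]_m) (j : 'I_m) : entry v j = v j 0.
Proof. by rewrite /entry valK. Qed.

Lemma entry_sum m (v : 'cV[K]_m) c :
  \sum_(i < m) (if i == c :> nat then v i 0 else 0) = entry v c.
Proof.
rewrite -big_mkcond /entry /=; case: insubP => [j _ jc | cm].
  by rewrite (big_pred1 j) // => i /=; rewrite -jc val_eqE.
rewrite big_pred0 // => i; apply/negP => /eqP ic.
by move: cm; rewrite -ic ltn_ord.
Qed.

Definition prev_entry m (v : 'cV[K]_m) (l : nat) : K :=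
  if l is l'.+1 then entry v l' else 0.

Lemma jordan_mul m (a : K) (v : 'cV[K]_m) (l : 'I_m) :
  (jordan m a *m v) l 0 = a * entry v l + prev_entry v l.
Proof.
rewrite mxE.
have -> : \sum_j jordan m a l j * v j 0 =
  \sum_(j < m) ((a * (if j == l :> nat then v j 0 else 0)) +
     (if (l == j.+1 :> nat) then v j 0 else 0)).
  apply: eq_bigr => j _; rewrite mxE -val_eqE eq_sym.
  case: eqP => [->|_]; first by rewrite (ltn_eqF (ltnSn l)) addr0.
  by case: ifP; rewrite !(mulr0, mul1r, mul0r, add0r).
rewrite big_split -big_distrr entry_sum /=; congr (_ + _).
case: (l : nat) => [|l'] /=; first by rewrite big1.
by rewrite -entry_sum; apply: eq_bigr => j _; rewrite eqSS eq_sym.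
Qed.

Lemma jordan_adj_mul m (a : K) (v : 'cV[K]_m) (l : 'I_m) :
  ((jordan m a)^t* *m v) l 0 = a^* * entry v l + entry v l.+1.
Proof.
rewrite mxE.
have -> : \sum_j (jordan m a)^t* l j * v j 0 =
  \sum_(j < m) ((a^* * (if j == l :> nat then v j 0 else 0)) +
     (if (j == l.+1 :> nat) then v j 0 else 0)).
  apply: eq_bigr => j _; rewrite !mxE -val_eqE.
  case: eqP => [->|_]; first by rewrite (ltn_eqF (ltnSn l)) addr0.
  by case: ifP; rewrite ?rmorph1 ?rmorph0 !(mulr0, mul1r, mul0r, add0r).
by rewrite big_split -big_distrr !entry_sum.
Qed.

Variables (k : nat) (z : 'I_k -> K) (n : 'I_k -> nat).
Hypothesis hz : forall i, in_disk (z i).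
Let N := (\sum_i n i)%N.
Let T : 'M[K]_N := T_mx z n.
Let T' := T^t*.

Definition node (p : 'I_N) : K := z (@tagnat.sig1 k n p).

Lemma node_disk p : in_disk (node p).
Proof. exact: hz. Qed.

Lemma T_trig : is_trig_mx T.
Proof.
apply/is_trig_mxblockP; split => [i j ij|i].
  by rewrite -val_eqE (ltn_eqF ij).
rewrite eqxx conform_mx_id; apply/is_trig_mxP => a b ab.
by rewrite mxE -val_eqE !ltn_eqF // ltnW.
Qed.

Lemma T'E p q : T' p q = (T q p)^*.
Proof. by rewrite [LHS]mxE mxE. Qed.

Lemma T_diag p : T p p = node p.
Proof. by rewrite mxE eqxx conform_mx_id mxE eqxx. Qed.

Lemma det_pencil (a w : K) : \det (a%:M - w *: T) = \prod_(p < N) (a - w * node p).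
Proof.
rewrite det_trig.
  by apply: eq_bigr => p _; rewrite mxE [(a%:M : 'M_N) p p]mxE eqxx mxE [(w *: T) p p]mxE T_diag.
apply/is_trig_mxP => i j ij; have /is_trig_mxP/(_ i j ij) T0 := T_trig.
by rewrite mxE [(a%:M : 'M_N) i j]mxE -val_eqE (ltn_eqF ij) mxE [(w *: T) i j]mxE T0 mulr0 subr0.
Qed.

Lemma det_pencil_adj (w : K) : \det (1%:M - w *: T') = \prod_(p < N) (1 - w * (node p)^*).
Proof.
have -> : 1%:M - w *: T' = (1%:M - w^* *: T)^t* by rewrite adjmxB adjmx1 adjmxZ conjCK.
rewrite det_map_mx det_tr det_pencil rmorph_prod.
by apply: eq_bigr => p _; rewrite rmorphB rmorph1 rmorphM /= conjCK.
Qed.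

Lemma one_sub_mul_neq0 (w a : K) : `|w| <= 1 -> `|a| < 1 -> 1 - w * a != 0.
Proof.
move=> w1 a1; rewrite subr_eq0 eq_sym; apply/eqP => /(congr1 Num.norm).
rewrite normrM normr1 => H.
by have := ler_pM (normr_ge0 w) (normr_ge0 a) w1 (lexx _); rewrite H mul1r => /(lt_le_trans a1); rewrite ltxx.
Qed.

Lemma pencil_adj_unit (w : K) : `|w| <= 1 -> 1%:M - w *: T' \in unitmx.
Proof.
move=> w1; rewrite unitmxE det_pencil_adj unitfE prodf_seq_neq0.
by apply/allP => p _; apply: one_sub_mul_neq0; rewrite // norm_conjC; exact: node_disk.
Qed.

Lemma pencil_unit (w : K) : (forall i, w != z i) -> w%:M - T \in unitmx.
Proof.
move=> wz; rewrite unitmxE -[T]scale1r det_pencil unitfE prodf_seq_neq0.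
by apply/allP => p _; rewrite /= mul1r subr_eq0; exact: wz.
Qed.

Lemma one_sub_T_unit : 1%:M - T \in unitmx.
Proof.
apply: pencil_unit => i; apply/eqP => H.
by have := hz i; rewrite /in_disk -H normr1 ltxx.
Qed.

Lemma one_sub_T'_unit : 1%:M - T' \in unitmx.
Proof. by rewrite -[T']scale1r; apply: pencil_adj_unit; rewrite normr1. Qed.

(** [T] is lower triangular with diagonal entries of modulus less than 1, so an
  induction on the sum of the indices determines all the entries. *)
Lemma stein_unique (D : 'M[K]_N) : D = T *m D *m T' -> D = 0.
Proof.
move=> DE; apply/matrixP => p q; rewrite [RHS]mxE.
have [m] := ubnP (p + q); elim: m p q => // m IH p q pq.
have /is_trig_mxP Ttr := T_trig.
have : D p q = T p p * (T q q)^* * D p q.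
  rewrite {1}DE mxE (bigD1 q) //= [X in _ + X]big1 ?addr0.
    rewrite mxE (bigD1 p) //= [X in _ + X]big1 ?addr0 => [|a ap].
      by rewrite T'E; ring.
    have [pa|ap'] := ltnP p a; first by rewrite Ttr // mul0r.
    rewrite IH ?mulr0 //; rewrite ltnS in pq; apply: leq_trans pq.
    by rewrite ltn_add2r ltn_neqAle ap' andbT.
  move=> b bq; have [qb|bq'] := ltnP q b; first by rewrite T'E Ttr // rmorph0 mulr0.
  rewrite mxE big1 ?mul0r // => a _.
  have [pa|ap'] := ltnP p a; first by rewrite Ttr // mul0r.
  rewrite IH ?mulr0 //; rewrite ltnS in pq; apply: leq_trans pq.
  by rewrite -addnS leq_add // ltn_neqAle bq' andbT.
rewrite !T_diag => /eqP; rewrite -subr_eq0 -{1}[D p q]mul1r -mulrBl mulf_eq0 => /orP[|/eqP //].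
rewrite (negbTE (one_sub_mul_neq0 _ _)) // ?norm_conjC; last exact: node_disk.
by apply: ltW; exact: node_disk.
Qed.

Lemma stein_hermitian (P Q : 'M[K]_N) : Q^t* = Q -> P - T *m P *m T' = Q -> P^t* = P.
Proof.
move=> Qh PQ; apply/eqP; rewrite -subr_eq0; apply/eqP; apply: stein_unique.
have PQ' : P^t* - T *m P^t* *m T' = Q.
  by rewrite -[RHS]Qh -PQ adjmxB !adjmxM /T' trmxCK mulmxA.
apply/eqP; rewrite -subr_eq0; apply/eqP.
have -> : P^t* - P - T *m (P^t* - P) *m T' =
    (P^t* - T *m P^t* *m T') - (P - T *m P *m T').
  rewrite mulmxBr mulmxBl !opprB [LHS]addrACA [RHS]addrACA; congr (_ + _); exact: addrC.
by rewrite PQ PQ' subrr.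
Qed.

Lemma T_mul_block (x : 'cV[K]_N) i (j : 'I_(n i)) :
  submxcol (T *m x) i j 0 = z i * entry (submxcol x i) j + prev_entry (submxcol x i) j.
Proof. by rewrite -{1}[x]submxcolK mul_mxdiag_mxcol mxcolK jordan_mul. Qed.

Lemma T'_mul_block (x : 'cV[K]_N) i (j : 'I_(n i)) :
  submxcol (T' *m x) i j 0 = (z i)^* * entry (submxcol x i) j + entry (submxcol x i) j.+1.
Proof.
have -> : T' = \mxdiag_i (jordan (n i) (z i))^t*.
  rewrite /T' /T /T_mx tr_mxdiag; apply/matrixP => p q; rewrite !mxE.
  case: eqP => [e|_]; last by rewrite !mxE rmorph0.
  by move: (tagnat.sig2 q); rewrite -e => s; rewrite !conform_mx_id !mxE.
by rewrite -{1}[x]submxcolK mul_mxdiag_mxcol mxcolK jordan_adj_mul.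
Qed.

Let E : 'cV[K]_N := E_mx K n.

Lemma E_adj_mul (x : 'cV[K]_N) : (E^t* *m x) 0 0 = \sum_i entry (submxcol x i) 0.
Proof.
rewrite -{1}[x]submxcolK /E /E_mx tr_mxcol.
have -> : map_mx Num.conj (\mxrow_i (\col_(j < n i) (j == 0 :> nat)%:R)^T) =
  \mxrow_i (\row_(j < n i) ((j == 0 :> nat)%:R : K)).
  by apply/matrixP => a b; rewrite !mxE rmorph_nat.
rewrite mul_mxrow_mxcol summxE; apply: eq_bigr => i _; rewrite mxE -entry_sum.
by apply: eq_bigr => j _; rewrite !mxE; case: eqP; rewrite ?mul1r ?mul0r.
Qed.

Hypothesis hinj : injective z.

(** An eigenvector of [T'] has all its mass in the first entry of the block of
  its eigenvalue, and [E] reads these first entries; distinct nodes have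
  distinct eigenvalues. *)
Lemma T'_observable (x : 'cV[K]_N) (mu : K) :
  T' *m x = mu *: x -> E^t* *m x = 0 -> x = 0.
Proof.
move=> Tx Ex.
have rec i (j : 'I_(n i)) :
    entry (submxcol x i) j.+1 = (mu - (z i)^*) * entry (submxcol x i) j.
  have := T'_mul_block x j.
  have -> : submxcol (T' *m x) i j 0 = mu * entry (submxcol x i) j.
    by rewrite Tx entry_ord !mxE.
  by move=> H; rewrite mulrBl H addrAC subrr add0r.
have zero i : mu != (z i)^* -> forall j, entry (submxcol x i) j = 0.
  move=> mui j.
  have [m] := ubnP (n i - j)%N; elim: m j => // m IH j jm.
  have [nj|jn] := leqP (n i) j.
    by rewrite /entry insubF // ltnNge nj.
  have /eqP := rec i (Ordinal jn); rewrite IH /=; last first.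
    by rewrite ltnS in jm; apply: leq_trans jm; rewrite subnS prednK // subn_gt0.
  by rewrite eq_sym mulf_eq0 subr_eq0 (negbTE mui) => /eqP.
have {}zero i j : entry (submxcol x i) j = 0.
  have [mui|/zero //] := eqVneq mu (z i)^*.
  case: j => [|j].
    have := congr1 (fun M : 'M_1 => M 0 0) Ex; rewrite E_adj_mul mxE (bigD1 i) //= big1 ?addr0 //.
    move=> l li; apply: zero; rewrite mui; apply: contra_neq li => e.
    by apply: hinj; rewrite -[z l]conjCK -e conjCK.
  have [nj|jn] := leqP (n i) j.
    by rewrite /entry insubF // ltnNge leqW.
  by rewrite (rec i (Ordinal jn)) mui subrr mul0r.
rewrite -[x]submxcolK; apply/matrixP => a b; rewrite !ord1 mxE.
by have := zero (tagnat.sig1 a) (tagnat.sig2 a); rewrite entry_ord mxE => ->; rewrite mxE.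
Qed.

Variable fd : forall i, 'I_(n i) -> K.
Let Cv : 'cV[K]_N := C_mx fd.

(** Division by [w - T] is successive division by the [w - z i]. *)
Lemma pencil_blocks (phi : 'cV[K]_N) (w a b : K) :
  (w%:M - T) *m phi = a *: E - b *: Cv <->
  forall i (j : 'I_(n i)), (w - z i) * entry (submxcol phi i) j - prev_entry (submxcol phi i) j =
    (j == 0 :> nat)%:R * a - b * fd j.
Proof.
have lhs i (j : 'I_(n i)) : submxcol ((w%:M - T) *m phi) i j 0 =
   (w - z i) * entry (submxcol phi i) j - prev_entry (submxcol phi i) j.
  have TE := T_mul_block phi j.
  have -> : submxcol ((w%:M - T) *m phi) i = w *: submxcol phi i - submxcol (T *m phi) i.
    by rewrite mulmxBl mul_scalar_mx; apply/matrixP => s t; rewrite !mxE.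
  by rewrite mxE [X in _ + X]mxE TE mxE -entry_ord; ring.
have rhs i (j : 'I_(n i)) : submxcol (a *: E - b *: Cv) i j 0 =
   (j == 0 :> nat)%:R * a - b * fd j.
  have -> : submxcol (a *: E - b *: Cv) i = a *: submxcol E i - b *: submxcol Cv i.
    by apply/matrixP => s t; rewrite !mxE.
  by rewrite /E /Cv /E_mx /C_mx !mxcolK !mxE; ring.
split=> [H i j|H]; first by rewrite -lhs H rhs.
apply/mxcolP => i; apply/matrixP => j l; rewrite !ord1.
by rewrite lhs rhs.
Qed.

End Blocks.

(** * The identities in terms of the entries of Theta *)

Section ThetaEntries.
Variables (K : numClosedFieldType) (k : nat) (z : 'I_k -> K) (n : 'I_k -> nat).
Variable fd : forall i, 'I_(n i) -> K.
Hypothesis hz : forall i, in_disk (z i).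
Hypothesis hinj : injective z.
Let N := (\sum_i n i)%N.
Variable P : 'M[K]_N.
Hypothesis hP : is_pick_matrix z fd P.
Hypothesis hdet : \det P != 0.

Let T : 'M[K]_N := T_mx z n.
Let T' := T^t*.
Let E : 'cV[K]_N := E_mx K n.
Let Cv : 'cV[K]_N := C_mx fd.
Let L : 'M[K]_(1 + 1, N) := col_mx (E^t*) (Cv^t*).
Let F : 'M[K]_(N, 1 + 1) := row_mx E (- Cv).
Let J : 'M[K]_(1 + 1) := block_mx 1%:M 0 0 (- 1%:M).
Let H : 'M[K]_N := (1%:M - T) *m P *m (1%:M - T').
Let Th := Theta z fd P.

Definition numer (s b : K -> K) w := Th w 0 0 * s w + Th w 0 1 * b w.
Definition denom (s b : K -> K) w := Th w 1 0 * s w + Th w 1 1 * b w.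

Lemma pick_herm : P^t* = P.
Proof.
apply: (stein_hermitian hz) hP.
by rewrite adjmxB !adjmxM !trmxCK.
Qed.

Lemma pick_unit : P \in unitmx.
Proof. by rewrite unitmxE unitfE. Qed.

Let T1 : 1%:M - T \in unitmx := one_sub_T_unit n hz.
Let T1' : 1%:M - T' \in unitmx := one_sub_T'_unit n hz.

Lemma input_output : F *m L = P - T *m P *m T'.
Proof. by rewrite mul_row_col mulNmx -hP. Qed.

Lemma input_adj : F^t* = J *m L.
Proof.
rewrite /F /J /L mul_block_col !mul1mx !mul0mx addr0 add0r mulNmx mul1mx.
rewrite tr_row_mx map_col_mx; congr col_mx.
by apply/matrixP => i j; rewrite !mxE rmorphN.
Qed.

Lemma signature_sqr : J *m J = 1%:M.
Proof.
rewrite /J mulmx_block !mulmx0 !mul0mx !mulmx1 !addr0 add0r mulmxN mulmx1 opprK.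
by rewrite -scalar_mx_block.
Qed.

Lemma signature_adj : J^t* = J.
Proof.
rewrite /J tr_block_mx map_block_mx !trmx0 !map_mx0 adjmx1; congr block_mx.
by apply/matrixP => i j; rewrite !mxE eq_sym rmorphN rmorph_nat.
Qed.

Let hFL := input_output.
Let hJF := input_adj.
Let hJJ := signature_sqr.
Let hJadj := signature_adj.
Let hPh := pick_herm.
Let hPu := pick_unit.

Let th w : 'M[K]_(1 + 1) := theta T P L F w.

Lemma Theta_theta w : Th w = th w.
Proof. by rewrite /Th /Theta /th /theta /state /resolvent !mulmxA. Qed.

Definition pair_col (a b : K) : 'cV[K]_(1 + 1) := col_mx a%:M b%:M.

Lemma I2_0 : (0 : 'I_(1 + 1)) = lshift 1 0.
Proof. exact: val_inj. Qed.

Lemma I2_1 : (1 : 'I_(1 + 1)) = rshift 1 0.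
Proof. exact: val_inj. Qed.

Lemma pair_colE (v : 'cV[K]_(1 + 1)) : v = pair_col (v 0 0) (v 1 0).
Proof.
rewrite -[v]vsubmxK I2_0 I2_1 col_mxEu col_mxEd /pair_col; congr col_mx;
by apply/matrixP => i j; rewrite !ord1 [RHS]mxE mulr1n.
Qed.

Lemma pair_col0 a b : pair_col a b 0 0 = a.
Proof. by rewrite I2_0 col_mxEu mxE mulr1n. Qed.

Lemma pair_col1 a b : pair_col a b 1 0 = b.
Proof. by rewrite I2_1 col_mxEd mxE mulr1n. Qed.

Lemma sum_I2 (f : 'I_(1 + 1) -> K) : \sum_i f i = f 0 + f 1.
Proof. by rewrite big_split_ord !big_ord1 I2_0 I2_1. Qed.

Lemma th_pair w a b : th w *m pair_col a b =
  pair_col (Th w 0 0 * a + Th w 0 1 * b) (Th w 1 0 * a + Th w 1 1 * b).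
Proof.
rewrite Theta_theta [LHS]pair_colE; congr pair_col;
by rewrite mxE sum_I2 pair_col0 pair_col1.
Qed.

Lemma J_form (v : 'cV[K]_(1 + 1)) :
  (v^t* *m J *m v) 0 0 = v 0 0 * (v 0 0)^* - v 1 0 * (v 1 0)^*.
Proof.
rewrite [v]pair_colE pair_col0 pair_col1; move: (v 0 0) (v 1 0) => a b.
rewrite /pair_col tr_col_mx map_row_mx /J mul_row_block !mulmx0 addr0 add0r mulmx1.
rewrite mulmxN mulmx1 mul_row_col !mxE !big_ord1 !mxE !mulr1n; ring.
Qed.

Lemma F_pair a b : F *m pair_col a b = a *: E - b *: Cv.
Proof. by rewrite /F /pair_col mul_row_col mulNmx !mul_mx_scalar. Qed.

(** The remainder whose blocks are the successive Taylor remainders of the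
  interpolation conditions. *)
Definition remainder w a b : 'cV[K]_N :=
  P *m (1%:M - T') *m state T P F w *m pair_col a b.

Lemma remainder_blocks w a b : `|w| <= 1 ->
  forall i (j : 'I_(n i)),
    (w - z i) * entry (submxcol (remainder w a b) i) j
      - prev_entry (submxcol (remainder w a b) i) j =
    (j == 0 :> nat)%:R * (Th w 0 0 * a + Th w 0 1 * b)
      - (Th w 1 0 * a + Th w 1 1 * b) * fd j.
Proof.
move=> w1; apply/(pencil_blocks z fd); rewrite -F_pair -th_pair mulmxA.
rewrite (theta_interp hFL hPu T1); last exact: pencil_adj_unit.
by rewrite /remainder !mulmxA.
Qed.

(** The identity [theta_adj] on the column [(a, b)]. *)
Lemma denom_defect w a b : `|w| <= 1 ->
  let x := Th w 0 0 * a + Th w 0 1 * b in let y := Th w 1 0 * a + Th w 1 1 * b in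
  let u := state T P F w *m pair_col a b in
  (x * x^* - y * y^*) - (a * a^* - b * b^*) = (w * w^* - 1) * (u^t* *m H *m u) 0 0.
Proof.
move=> w1 x y u.
have w1u : 1%:M - w *: T' \in unitmx by exact: pencil_adj_unit.
have := theta_adj hFL hJF hJadj hPh hPu T1 w1u.
move=> /(congr1 (fun M => ((pair_col a b)^t* *m M *m pair_col a b) 0 0)).
have -> : (pair_col a b)^t* *m ((th w)^t* *m J *m th w - J) *m pair_col a b =
   (pair_col x y)^t* *m J *m pair_col x y - (pair_col a b)^t* *m J *m pair_col a b.
  by rewrite /x /y -th_pair mulmxBr mulmxBl [(_ *m pair_col a b)^t*]adjmxM !mulmxA.
rewrite mxE [X in _ + X]mxE !J_form !pair_col0 !pair_col1 => ->.
rewrite -/H /u [(_ *m pair_col a b)^t*]adjmxM.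
by rewrite -!scalemxAr -!scalemxAl -!scalemxAr -!scalemxAl mxE !mulmxA.
Qed.

Lemma diag_congr p q (X : 'M[K]_(p, q)) (M : 'M[K]_q) i :
  (X *m M *m X^t*) i i = (row i X *m M *m (row i X)^t*) 0 0.
Proof.
rewrite -row_mul mxE [RHS]mxE; apply: eq_bigr => j _.
by rewrite [in RHS]mxE; congr (_ * _); rewrite !mxE.
Qed.

(** The (2,2) entry of [theta_coadj]. *)
Lemma theta_row_defect w : `|w| <= 1 ->
  let r := row 1 (L *m resolvent T P w) in
  Th w 1 0 * (Th w 1 0)^* - Th w 1 1 * (Th w 1 1)^* + 1 =
  (w * w^* - 1) * (r *m H *m r^t*) 0 0.
Proof.
move=> w1 r.
have w1u : 1%:M - w *: T' \in unitmx by exact: pencil_adj_unit.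
have := theta_coadj hFL hJF hJJ hJadj hPh hPu T1 w1u.
move=> /(congr1 (fun M : 'M_(1 + 1) => M 1 1)); rewrite [RHS]diag_congr -/r.
rewrite -!scalemxAr -!scalemxAl [RHS]mxE -/H => <-.
rewrite [RHS]mxE [X in _ = _ + X]mxE diag_congr; congr (_ + _); last first.
  by rewrite /J I2_1 block_mxEdr !mxE opprK.
have := J_form ((row 1 (th w))^t*); rewrite !trmxCK => ->.
have rE j : ((row 1 (th w))^t*) j 0 = (Th w 1 j)^*.
  by rewrite Theta_theta; move: (th w) => M; rewrite !mxE.
by rewrite !rE !conjCK; ring.
Qed.

Lemma theta_inj_pair w a b : `|w| <= 1 -> (forall i, w != z i) ->
  Th w 0 0 * a + Th w 0 1 * b = 0 -> Th w 1 0 * a + Th w 1 1 * b = 0 -> a = 0 /\ b = 0.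
Proof.
move=> w1 wz x0 y0.
have : pair_col a b = 0.
  apply: (theta_inj hFL hPu T1 (pencil_adj_unit n hz w1) T1' (pencil_unit n wz)).
  rewrite -/(th w) th_pair x0 y0 [RHS]pair_colE !mxE //.
by move=> e; split; [rewrite -(pair_col0 a b)|rewrite -(pair_col1 a b)]; rewrite e mxE.
Qed.

Lemma theta_solve_pair w (phi : 'cV[K]_N) s b : `|w| <= 1 ->
  (forall i (j : 'I_(n i)),
    (w - z i) * entry (submxcol phi i) j - prev_entry (submxcol phi i) j =
    (j == 0 :> nat)%:R * s - b * fd j) ->
  let y := invmx (1%:M - T') *m (invmx P *m phi) in
  let s0 := s - (w - 1) * (E^t* *m y) 0 0 in
  let b0 := b - (w - 1) * (Cv^t* *m y) 0 0 in
  Th w 0 0 * s0 + Th w 0 1 * b0 = s /\ Th w 1 0 * s0 + Th w 1 1 * b0 = b.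
Proof.
move=> w1 /(pencil_blocks z fd) phiE y s0 b0.
have := theta_solve hFL hPu T1 (pencil_adj_unit n hz w1) T1' (u := pair_col s b) (phi := phi).
rewrite F_pair => /(_ phiE); rewrite -/y.
have -> : pair_col s b - (w - 1) *: (L *m y) = pair_col s0 b0.
  rewrite /L mul_col_mx /s0 /b0; move: (_^t* *m y) (_^t* *m y) => u v.
  rewrite scale_col_mx opp_col_mx add_col_mx; congr col_mx;
  by apply/matrixP => i j; rewrite !ord1 !mxE !mulr1n.
rewrite -/(th w) th_pair => e; split.
  by have := congr1 (fun v : 'cV_(1 + 1) => v 0 0) e; rewrite !pair_col0.
by have := congr1 (fun v : 'cV_(1 + 1) => v 1 0) e; rewrite !pair_col1.
Qed.

Lemma Theta11E w : Th w 1 1 = 1 - (w - 1) * (Cv^t* *m (resolvent T P w *m Cv)) 0 0.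
Proof.
rewrite Theta_theta /th /theta mxE [X in _ + X]mxE /L /F /state.
rewrite mul_mx_row mul_col_mx I2_1 col_mxEd mul_mx_row row_mxEr.
have oppE (M : 'M[K]_1) : (- M) 0 0 = - M 0 0 by rewrite mxE.
by rewrite !mulmxN oppE mulrN mxE eqxx.
Qed.

Lemma Theta22_zeros : exists (c : K) (lam : 'I_N -> K), [/\ c != 0,
  forall w, `|w| <= 1 -> \prod_(p < N) (1 - w * (node (n := n) z p)^*) * Th w 1 1 =
     c * \prod_i ((1 + w) + (1 - w) * lam i),
  forall i, lam i + (lam i)^* \is Num.real /\ lam i + (lam i)^* != 0 &
  sq_neg P = #|[pred i : 'I_N | (lam i + (lam i)^* < 0%R)%R]|].
Proof.
have [c [lam [c0 H1 H2 H3]]] := theta22_zeros hP hPh hPu T1 T1' (T'_observable hinj).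
exists c, lam; split => // w w1.
by rewrite -(det_pencil_adj z n) Theta11E -H1 //; exact: pencil_adj_unit.
Qed.

End ThetaEntries.

(** * Theta on the disk *)

Section MatrixBounds.
Variable R : realType.
Local Notation C := (R[i] : numClosedFieldType).

Definition bounded_analytic_mx m n (M : C -> 'M[C]_(m, n)) :=
  forall i j, bounded_analytic (fun w => M w i j).

Lemma ban_mx_cst m n (A : 'M[C]_(m, n)) : bounded_analytic_mx (fun=> A).
Proof. by move=> i j; exact: ban_cst. Qed.

Lemma ban_mxM m n p (A : C -> 'M[C]_(m, n)) (B : C -> 'M[C]_(n, p)) :
  bounded_analytic_mx A -> bounded_analytic_mx B ->
  bounded_analytic_mx (fun w => A w *m B w).
Proof.
move=> hA hB i j; apply: (@ban_ext _ (fun w => \sum_l A w i l * B w l j)) => [w _|].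
  by rewrite mxE.
by apply: ban_sum => l; apply: banM.
Qed.

Lemma ban_mxD m n (A B : C -> 'M[C]_(m, n)) :
  bounded_analytic_mx A -> bounded_analytic_mx B ->
  bounded_analytic_mx (fun w => A w + B w).
Proof.
move=> hA hB i j; apply: (@ban_ext _ (fun w => A w i j + B w i j)) => [w _|].
  by rewrite mxE.
exact: banD.
Qed.

Lemma ban_mxZ m n (c : C -> C) (A : C -> 'M[C]_(m, n)) :
  bounded_analytic c -> bounded_analytic_mx A ->
  bounded_analytic_mx (fun w => c w *: A w).
Proof.
move=> hc hA i j; apply: (@ban_ext _ (fun w => c w * A w i j)) => [w _|].
  by rewrite mxE.
exact: banM.
Qed.

Lemma ban_det n (A : C -> 'M[C]_n) : bounded_analytic_mx A ->
  bounded_analytic (fun w => \det (A w)).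
Proof.
move=> hA; apply: ban_sum => s; apply: banM; first exact: ban_cst.
by apply: ban_prod => i; exact: hA.
Qed.

Lemma ban_adj n (A : C -> 'M[C]_n) : bounded_analytic_mx A ->
  bounded_analytic_mx (fun w => \adj (A w)).
Proof.
move=> hA i j; apply: (@ban_ext _ (fun w => cofactor (A w) j i)) => [w _|].
  by rewrite mxE.
apply: banM; first exact: ban_cst.
apply: ban_det => a b; apply: (@ban_ext _ (fun w => A w (lift j a) (lift i b))) => [w _|].
  by rewrite !mxE.
exact: hA.
Qed.

Lemma ban_mx_bound m n (M : C -> 'M[C]_(m, n)) : bounded_analytic_mx M ->
  exists2 K : R, 0 <= K & forall w i j, normc w < 1 -> normc (M w i j) <= K.
Proof.
move=> hM.
have /choice [Kf HK] (ij : 'I_m * 'I_n) : exists K : R, forall w, normc w < 1 -> normc (M w ij.1 ij.2) <= K.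
  by have [_ [K HK]] := hM ij.1 ij.2; exists K.
exists (\sum_ij `|Kf ij|); first by apply: sumr_ge0 => ij _; exact: normr_ge0.
move=> w i j w1; apply: le_trans (HK (i, j) w w1) _; apply: le_trans (ler_norm _) _.
by rewrite (bigD1 (i, j)) //= lerDl; apply: sumr_ge0 => ij _; exact: normr_ge0.
Qed.

Variables (k : nat) (z : 'I_k -> C) (n : 'I_k -> nat).
Variable fd : forall i, 'I_(n i) -> C.
Hypothesis hz : forall i, in_disk (z i).
Let N := (\sum_i n i)%N.
Variable P : 'M[C]_N.
Hypothesis hP : is_pick_matrix z fd P.
Hypothesis hdet : \det P != 0.
Let T : 'M[C]_N := T_mx z n.
Let T' := T^t*.
Let E : 'cV[C]_N := E_mx C n.
Let Cv : 'cV[C]_N := C_mx fd.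
Let L : 'M[C]_(1 + 1, N) := col_mx (E^t*) (Cv^t*).
Let F : 'M[C]_(N, 1 + 1) := row_mx E (- Cv).
Let Th := Theta z fd P.

Lemma disk_le1 (w : C) : normc w < 1 -> `|w| <= 1.
Proof. by move=> w1; apply: ltW; exact/in_diskE. Qed.

(** Cramer's rule; the determinant is the product of the [1 - w z_i^*]. *)
Lemma ban_invmx_pencil : bounded_analytic_mx (fun w => invmx (1%:M - w *: T')).
Proof.
move=> i j; apply: (@ban_ext _ (fun w : C => (\prod_(p < N) (1 - (node (n := n) z p)^* * w)^-1) * \adj (1%:M - w *: T') i j)).
  move=> w w1; rewrite /invmx (pencil_adj_unit n hz (disk_le1 w1)) [RHS]mxE det_pencil_adj prodfV.
  by congr (_^-1 * _); apply: eq_bigr => p _; rewrite [w * _]mulrC.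
apply: banM.
  by apply: ban_prod => p; apply: ban_one_subV; exact/in_diskE/node_disk.
apply: ban_adj => a b; apply: (@ban_ext _ (fun w : C => (1%:M : 'M_N) a b - w * T' a b)).
  by move=> w _; rewrite !mxE.
by apply: banB; [exact: ban_cst|apply: banM; [exact: ban_id|exact: ban_cst]].
Qed.

Lemma ban_resolvent : bounded_analytic_mx (fun w => resolvent T P w).
Proof.
apply: ban_mxM; last exact: ban_mx_cst.
by apply: ban_mxM; [exact: ban_invmx_pencil|exact: ban_mx_cst].
Qed.

Lemma ban_state : bounded_analytic_mx (fun w => state T P F w).
Proof. by apply: ban_mxM; [exact: ban_resolvent|exact: ban_mx_cst]. Qed.

Lemma ban_Theta i j : bounded_analytic (fun w => Th w i j).
Proof.
apply: (@ban_ext _ (fun w => theta T P L F w i j)) => [w _|]; first by rewrite /Th Theta_theta.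
apply: ban_mxD; first exact: ban_mx_cst.
apply: ban_mxZ; first exact: ban_sub.
by apply: ban_mxM; [exact: ban_mx_cst|exact: ban_state].
Qed.

Lemma ban_remainder (a b : C -> C) : bounded_analytic a -> bounded_analytic b ->
  bounded_analytic_mx (fun w => remainder z fd P w (a w) (b w)).
Proof.
move=> ha hb; apply: ban_mxM.
  by apply: ban_mxM; [exact: ban_mx_cst|exact: ban_state].
move=> i j; rewrite !ord1 -(splitK i); case: (fintype.split i) => l.
  by apply: (@ban_ext _ a) => // w _; rewrite col_mxEu mxE !ord1 mulr1n.
by apply: (@ban_ext _ b) => // w _; rewrite col_mxEd mxE !ord1 mulr1n.
Qed.

Lemma sub_one_normc w : w * w^* - 1 = - ((1 - normc w ^+ 2)%:C)%C :> C.
Proof. by rewrite mulc_conj rmorphB rmorph1 opprB. Qed.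

Lemma normc_form_bound m (y : 'cV[C]_m) (M : 'M[C]_m) (K Q : R) : 0 <= K -> 0 <= Q ->
  (forall i, normc (y i 0) <= K) -> (forall i j, normc (M i j) <= Q) ->
  normc ((y^t* *m M *m y) 0 0) <= m%:R * (m%:R * (K * Q * K)).
Proof.
move=> K0 Q0 yK MQ.
have bound (f : 'I_m -> C) (B : R) : (forall i, normc (f i) <= B) -> normc (\sum_i f i) <= m%:R * B.
  move=> fB; apply: le_trans (normc_sum _ _ _) _.
  apply: le_trans (ler_sum _ (fun i _ => fB i)) _.
  by rewrite sumr_const card_ord mulr_natl.
rewrite mxE; apply: (bound _ _) => i; rewrite normcM mulrA.
apply: ler_pM; rewrite ?normc_ge0 //.
rewrite mxE; apply: (bound _ _) => j; rewrite normcM !mxE normcC.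
by apply: ler_pM; rewrite ?normc_ge0.
Qed.

Let H : 'M[C]_N := (1%:M - T) *m P *m (1%:M - T').

Lemma form_bound (y : C -> 'cV[C]_N) (K : R) : 0 <= K ->
  (forall w i, normc w < 1 -> normc (y w i 0) <= K) ->
  exists2 Q : R, 0 <= Q & forall w, normc w < 1 ->
   normc ((w * w^* - 1) * (((y w)^t* *m H *m y w) 0 0)) <= Q * (1 - normc w ^+ 2).
Proof.
move=> K0 yK; have [Q Q0 HQ] := ban_mx_bound (ban_mx_cst H).
exists (N%:R * (N%:R * (K * Q * K))); first by rewrite !mulr_ge0.
move=> w w1; rewrite normcM sub_one_normc normcN normc_real ger0_norm; last first.
  by rewrite subr_ge0 expr_le1 ?normc_ge0 // ltW.
rewrite mulrC; apply: ler_wpM2r; first by rewrite subr_ge0 expr_le1 ?normc_ge0 // ltW.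
apply: normc_form_bound => // [i|i j]; first exact: yK.
by apply: HQ 0 _ _ _; rewrite normc0 ltr01.
Qed.

Lemma Theta_row_bound : exists2 Q : R, 0 <= Q & forall w, normc w < 1 ->
  `| normc (Th w 1 1) ^+ 2 - normc (Th w 1 0) ^+ 2 - 1 | <= Q * (1 - normc w ^+ 2).
Proof.
have [K K0 HK] := ban_mx_bound (ban_mxM (ban_mx_cst L) ban_resolvent).
have [|Q Q0 HQ] := @form_bound (fun w => (row 1 (L *m resolvent T P w))^t*) K K0.
  by move=> w i w1; rewrite 2!mxE normcC mxE; exact: HK.
exists Q => // w w1; have := HQ w w1; rewrite trmxCK.
have := theta_row_defect hz hP hdet (disk_le1 w1); rewrite -/Th /= => <-.
rewrite !mulc_conj -rmorphB -(rmorph1 (real_complex R)) -rmorphD normc_real.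
by rewrite -normrN opprD opprB.
Qed.

Lemma Theta_pair_bound (s b : C -> C) (M : R) : 0 <= M ->
  (forall w, normc w < 1 -> normc (s w) <= M) ->
  (forall w, normc w < 1 -> normc (b w) <= M) ->
  exists2 Q : R, 0 <= Q & forall w, normc w < 1 ->
  `| (normc (numer z fd P s b w) ^+ 2 - normc (denom z fd P s b w) ^+ 2)
     - (normc (s w) ^+ 2 - normc (b w) ^+ 2) | <= Q * (1 - normc w ^+ 2).
Proof.
move=> M0 sM bM; have [K K0 HK] := ban_mx_bound ban_state.
have [||Q Q0 HQ] := @form_bound (fun w => state T P F w *m pair_col (s w) (b w)) (K * M + K * M).
- by rewrite addr_ge0 // mulr_ge0.
- move=> w i w1; rewrite mxE sum_I2 pair_col0 pair_col1.
  apply: le_trans (normcD _ _) _; rewrite !normcM.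
  by apply: lerD; apply: ler_pM; rewrite ?normc_ge0 //; [exact: HK|exact: sM|exact: HK|exact: bM].
exists Q => // w w1; have := HQ w w1.
have := denom_defect hz hP hdet (s w) (b w) (disk_le1 w1); rewrite /= => <-.
by rewrite -/Th -/(numer z fd P s b w) -/(denom z fd P s b w) !mulc_conj -!rmorphB normc_real.
Qed.

End MatrixBounds.

(** * Schur functions and Blaschke products *)

Section SchurBlaschke.
Variable R : realType.
Local Notation C := (R[i] : numClosedFieldType).
Implicit Types (f g F G s b u : R[i] -> R[i]) (z w : R[i]).

Lemma norm_normc z : (`|z| : C) = ((normc z)%:C)%C.
Proof. by []. Qed.

Lemma norm_le1 z : ((`|z| : C) <= 1) = (normc z <= 1).
Proof. by rewrite norm_normc -(rmorph1 (real_complex R)) lecR. Qed.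

Lemma norm_eq1 z : ((`|z| : C) = 1) <-> normc z = 1.
Proof.
rewrite norm_normc -(rmorph1 (real_complex R)); split=> [|->//].
by move=> /(congr1 (@complex.Re R)).
Qed.

Definition bounded_by1 f := forall z, normc z < 1 -> normc (f z) <= 1.

Lemma schurP s : @schur C s <-> analytic_disk s /\ bounded_by1 s.
Proof.
split=> [hs|[h1 h2] z /in_diskE z1].
  by split=> z /in_diskE /hs [h1 h2] //; rewrite -norm_le1.
by split; [exact: h1|rewrite norm_le1; exact: h2].
Qed.

Lemma ban_schur s : analytic_disk s -> bounded_by1 s -> bounded_analytic s.
Proof. by move=> h1 h2; split=> //; exists 1. Qed.

Lemma blaschkeP m b : @blaschke C m b <-> exists c (l : seq R[i]),
  [/\ normc c = 1, forall a, a \in l -> normc a < 1, size l = m &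
      forall z, normc z < 1 -> b z = c * bprod l z].
Proof.
split=> [[c [a [c1 a1 bE]]]|[c [l [c1 l1 lm bE]]]].
  exists c, [seq a j | j <- enum 'I_m]; split.
  - exact/norm_eq1.
  - by move=> x /mapP [j _ ->]; exact/in_diskE.
  - by rewrite size_map size_enum_ord.
  - by move=> z /in_diskE z1; rewrite bE // /bprod big_map big_enum.
exists c, (fun j => nth 0 l j); split; first exact/norm_eq1.
  by move=> j; apply/in_diskE/l1; rewrite mem_nth // lm.
by move=> z /in_diskE z1; rewrite bE // /bprod (big_nth 0) big_mkord lm.
Qed.

Lemma near_bdry_small (Q e : R) : 0 <= Q -> 0 < e ->
  near_bdry (fun z => Q * (1 - normc z ^+ 2) <= e).
Proof.
move=> Q0 e0; exists (1 - e / (2 * (Q + 1))) => [|z zr z1].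
  by rewrite gtrBl divr_gt0 // mulr_gt0 // ltr_wpDl.
have n0 := normc_ge0 z.
have h : 1 - normc z ^+ 2 <= e / (Q + 1).
  have : 2 * (1 - normc z) <= e / (Q + 1).
    have -> : e / (Q + 1) = 2 * (e / (2 * (Q + 1))) by field; lra.
    by rewrite ler_pM2l //; lra.
  by apply: le_trans; nra.
apply: le_trans (ler_wpM2l Q0 h) _.
rewrite mulrA ler_pdivrMr; last lra.
by rewrite mulrDr mulr1 mulrC lerDl ltW.
Qed.

(** Dividing by the zero-free factor of [G] instead of [G]
  keeps the bound by 1, since the Blaschke factor has modulus nearly 1 near
  the circle. *)
Lemma schur_quotient F G (c : R) : bounded_analytic F -> bounded_analytic G ->
  0 < c -> near_bdry (fun z => c <= normc (G z)) ->
  (forall e : R, 0 < e -> near_bdry (fun z => normc (F z) ^+ 2 <= normc (G z) ^+ 2 + e)) ->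
  exists l u, [/\ factored l u G, forall z, normc z < 1 -> u z != 0,
    analytic_disk (fun z => F z / u z) & bounded_by1 (fun z => F z / u z)].
Proof.
move=> [hF _] hG c0 cG FG; have [l [u [lu u0]]] := factor_zeros hG c0 cG.
have [l1 hu GE] := lu.
have hFu : analytic_disk (fun z => F z / u z).
  by move=> z z1; apply: analyticM; [exact: hF|apply: analyticV; [exact: u0|exact: hu]].
exists l, u; split=> //; apply: max_principle => // e e0.
have ce : 0 < c * e by exact: mulr_gt0.
have := near_bdryI cG (FG _ (exprn_gt0 2 ce)).
apply: near_bdryW => z z1 [cGz FGz].
have up : 0 < normc (u z) by rewrite normc_gt0 u0.
have Gu : normc (G z) <= normc (u z).
  by rewrite GE // normcM ler_piMl ?normc_ge0 // bprod_le1.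
have FGe : normc (F z) <= normc (G z) + c * e.
  rewrite -ler_sqr; [|by rewrite nnegrE normc_ge0|by rewrite nnegrE addr_ge0 ?normc_ge0 // ltW].
  apply: le_trans FGz _; rewrite sqrrD lerD2r lerDl mulrn_wge0 // mulr_ge0 ?normc_ge0 //.
  exact: ltW.
rewrite normcM normcV // ler_pdivrMr //; apply: le_trans FGe _.
by rewrite mulrDl mul1r lerD // [e * _]mulrC ler_pM2r //; exact: le_trans cGz Gu.
Qed.

Lemma factored_mul l1 l2 u1 u2 F G : factored l1 u1 F -> factored l2 u2 G ->
  factored (l1 ++ l2) (fun z => u1 z * u2 z) (fun z => F z * G z).
Proof.
move=> [h1 a1 e1] [h2 a2 e2]; split.
- by move=> a; rewrite mem_cat => /orP[/h1|/h2].
- by move=> z z1; apply: analyticM; [exact: a1|exact: a2].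
- by move=> z z1; rewrite e1 // e2 // /bprod big_cat /=; ring.
Qed.

(** The Moebius map [w |-> (w + 1) / (w - 1)] takes the left half plane to the
  disk. *)
Lemma cayley_modulus (la : R[i]) :
  normc (1 + la) ^+ 2 - normc (1 - la) ^+ 2 = 4 * complex.Re la.
Proof. by rewrite !normc_sqr; case: la => x y /=; ring. Qed.

Lemma cayley_factor (la : R[i]) : complex.Re la < 0 ->
  let a := (la + 1) / (la - 1) in
  [/\ normc a < 1, 1 - la != 0 & forall w,  (1 + w) + (1 - w) * la = (w - a) * (1 - la)].
Proof.
move=> la0 a.
have lt : normc (1 + la) < normc (1 - la).
  rewrite -ltr_sqr ?nnegrE ?normc_ge0 // -subr_lt0 cayley_modulus; lra.
have l1 : 1 - la != 0.
  by rewrite -normc_gt0; apply: le_lt_trans lt; exact: normc_ge0.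
have l1' : la - 1 != 0 by rewrite -oppr_eq0 opprB.
split=> //.
  rewrite /a normcM normcV // ltr_pdivrMr ?normc_gt0 // mul1r addrC.
  by rewrite -[la - 1]opprB normcN.
by move=> w; rewrite /a; field.
Qed.

Lemma cayley_neq0 (la w : R[i]) : 0 < complex.Re la -> normc w < 1 ->
  (1 + w) + (1 - w) * la != 0.
Proof.
move=> la0 w1.
have lt : normc (1 - la) < normc (1 + la).
  rewrite -ltr_sqr ?nnegrE ?normc_ge0 // -subr_gt0 cayley_modulus; lra.
have -> : (1 + w) + (1 - w) * la = (1 + la) + w * (1 - la) by ring.
rewrite -normc_gt0; apply: lt_le_trans (normcDB _ _).
rewrite subr_gt0 normcM; apply: le_lt_trans lt.
by rewrite ler_piMl ?normc_ge0 // ltW.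
Qed.

End SchurBlaschke.

(** * The zeros of the denominators *)

Section Denominators.
Variable R : realType.
Local Notation C := (R[i] : numClosedFieldType).
Variables (k : nat) (z : 'I_k -> C) (n : 'I_k -> nat).
Variable fd : forall i, 'I_(n i) -> C.
Hypothesis hz : forall i, in_disk (z i).
Hypothesis hinj : injective z.
Let N := (\sum_i n i)%N.
Variable P : 'M[C]_N.
Hypothesis hP : is_pick_matrix z fd P.
Hypothesis hdet : \det P != 0.
Let Th := Theta z fd P.
Let num := numer z fd P.
Let den := denom z fd P.
Implicit Types (s b u : R[i] -> R[i]) (w : R[i]).

(** By [theta22_zeros] each eigenvalue in the left half plane contributes one
  zero in the disk and the others contribute none. *)
Lemma Theta22_factored : exists l u, [/\ factored l u (fun w => Th w 1 1),
  forall w, normc w < 1 -> u w != 0 & size l = sq_neg P].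
Proof.
have [c [lam [c0 ThE lamR sqE]]] := Theta22_zeros hz hinj hP hdet.
have lamE i : lam i + (lam i)^* = ((2 * complex.Re (lam i))%:C)%C :> C.
  by case: (lam i) => x y; apply/eqP; rewrite eq_complex /=; apply/andP; split; apply/eqP; ring.
have neg0 i : (lam i + (lam i)^* < 0 :> C) = (complex.Re (lam i) < 0).
  by rewrite lamE -(rmorph0 (real_complex R)) ltcR pmulr_rlt0.
have Re0 i : complex.Re (lam i) != 0.
  by have [_] := lamR i; apply: contra => /eqP r0; rewrite lamE r0 mulr0.
(* The eigenvalues with a zero in the disk; [a i] is the zero, and [v i] what
  remains of the factor. *)
pose neg := [pred i : 'I_N | complex.Re (lam i) < 0].
pose a i := (lam i + 1) / (lam i - 1).
pose v i : R[i] -> R[i] :=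
  if i \in neg then fun w => (1 - ((a i)^*)%R * w) * (1 - lam i)
  else fun w => (1 + w) + (1 - w) * lam i.
pose q w := \prod_(p < N) (1 - ((node (n := n) z p)^*)%R * w)^-1.
exists [seq a i | i <- enum neg], (fun w => q w * c * \prod_i v i w).
have av i : i \in neg -> normc (a i) < 1 by move=> /cayley_factor[].
have nodeN p : normc (node (n := n) z p) < 1 by exact/in_diskE/node_disk.
split; last first.
- rewrite size_map -cardE sqE; apply: eq_card => i.
  by rewrite !inE neg0.
- move=> w w1; rewrite !mulf_neq0 //.
    by apply/prodf_neq0 => p _; rewrite invr_eq0 one_sub_neq0.
  apply/prodf_neq0 => i _; rewrite /v; case: ifPn => ineg.
    by have [_ l1 _] := cayley_factor ineg; rewrite mulf_neq0 // one_sub_neq0 ?av.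
  apply: cayley_neq0 => //; rewrite lt_neqAle eq_sym Re0 /=.
  by move: ineg; rewrite inE -leNgt.
split.
- by move=> x xl; have [ i ] := mapP xl; rewrite mem_enum => /av ai ->.
- move=> w w1; apply: analyticM; first apply: analyticM.
  + apply: analytic_prod => p; apply: analyticV; first exact: one_sub_neq0.
    exact: (ban_one_sub _).1.
  + exact: analytic_cst.
  + apply: analytic_prod => i; rewrite /v; case: ifP => _.
      by apply: analyticM; [exact: (ban_one_sub _).1|exact: analytic_cst].
    apply: analyticD; first by apply: analyticD; [exact: analytic_cst|exact: analytic_id].
    apply: analyticM; last exact: analytic_cst.
    by apply: analyticB; [exact: analytic_cst|exact: analytic_id].
- move=> w w1.
  have q0 : \prod_(p < N) (1 - w * (node (n := n) z p)^*)%R != 0.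
    by apply/prodf_neq0 => p _; rewrite mulrC one_sub_neq0.
  have -> : Th w 1 1 = q w * (c * \prod_i ((1 + w) + (1 - w) * lam i)).
    rewrite -ThE; last exact: disk_le1.
    rewrite mulrA /q prodfV; under eq_bigr do rewrite mulrC.
    by rewrite mulVf ?mul1r.
  have -> : \prod_i ((1 + w) + (1 - w) * lam i) =
     bprod [seq a i | i <- enum neg] w * \prod_i v i w.
    rewrite /bprod big_map big_enum [X in _ = X * _]big_mkcond -big_split /=.
    apply: eq_bigr => i _; rewrite /v; case: ifPn => [ineg|_]; last by rewrite mul1r.
    have [_ _ ->] := cayley_factor ineg.
    by rewrite /bfactor mulrA divfK // one_sub_neq0 ?av.
  ring.
Qed.

Lemma ban_numer s b : bounded_analytic s -> bounded_analytic b -> bounded_analytic (num s b).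
Proof. by move=> hs hb; apply: banD; apply: banM => //; exact: ban_Theta. Qed.

Lemma ban_denom s b : bounded_analytic s -> bounded_analytic b -> bounded_analytic (den s b).
Proof. by move=> hs hb; apply: banD; apply: banM => //; exact: ban_Theta. Qed.

(** On the circle [|Theta22| ^ 2 = 1 + |Theta21| ^ 2], so [Theta22 B] dominates
  [Theta21 S] there. *)
Lemma denom_dominated s b : bounded_analytic s -> bounded_analytic b ->
  bounded_by1 s -> bounded_by1 b -> inner_like b ->
  exists2 c : R, 0 < c & near_bdry (fun w =>
    normc (Th w 1 0 * s w) + c <= normc (Th w 1 1 * b w) /\ 2^-1 <= normc (Th w 1 1 * b w)).
Proof.
move=> hs hb s1 b1 bin.
have [M M1 HM] : exists2 M : R, 1 <= M &
    forall w, normc w < 1 -> normc (Th w 1 0) <= M /\ normc (Th w 1 1) <= M.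
  have [_ [K HK]] := ban_Theta fd hz P 1 0; have [_ [K' HK']] := ban_Theta fd hz P 1 1.
  exists (1 + `|K| + `|K'|) => [|w w1]; first by rewrite -addrA lerDl addr_ge0.
  have [h1 h2] := (HK w w1, HK' w w1); have [e1 e2] := (ler_norm K, ler_norm K').
  have [p1 p2] := (normr_ge0 K, normr_ge0 K').
  by split; [apply: le_trans h1 _|apply: le_trans h2 _]; lra.
have M0 : 0 < M by lra.
have [Q Q0 HQ] := Theta_row_bound hz hP hdet.
(* Near the circle [|Theta22| - |Theta21|] is at least [1 / (4 M)]; this
  [e] makes the loss from [|b| < 1] at most half of it. *)
pose e : R := (8 * M ^+ 2)^-1.
have MM : 1 <= M ^+ 2 by rewrite expr2; nra.
have e0 : 0 < e by rewrite invr_gt0; lra.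
have e8 : e <= 8^-1 by rewrite lef_pV2 ?posrE; lra.
have eM : M * e = (8 * M)^-1 by rewrite /e; field; lra.
have half0 : 0 < 2^-1 :> R by rewrite invr_gt0.
exists ((8 * M)^-1); first by rewrite invr_gt0; lra.
have := near_bdryI (near_bdry_small Q0 half0) (bin e e0).
apply: near_bdryW => w w1 [small be].
have [yM xM] := HM w w1; have := HQ w w1; rewrite ler_norml => /andP[row _].
have [sw bw] := (s1 w w1, b1 w w1).
rewrite !normcM; move: small be yM xM row sw bw.
have [x0 y0] := (normc_ge0 (Th w 1 1), normc_ge0 (Th w 1 0)).
have [s0 b0] := (normc_ge0 (s w), normc_ge0 (b w)).
rewrite -/Th; move: x0 y0 s0 b0.
move: (normc (Th w 1 1)) (normc (Th w 1 0)) (normc (s w)) (normc (b w)) (Q * _) => x y s' be q.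
move=> x0 y0 s0 b0 q2 ebe yM xM row sw bw.
have xy : 2^-1 <= (x - y) * (x + y) by rewrite -subr_sqr; lra.
have x7 : 7 / 10 <= x by rewrite leNgt; apply/negP => x7; move: xy; apply/negP; rewrite -ltNge; nra.
have yx : y <= x by rewrite leNgt; apply/negP => yx; move: xy; apply/negP; rewrite -ltNge; nra.
have xyM : 2 * (8 * M)^-1 <= x - y.
  have -> : 2 * (8 * M)^-1 = 2^-1 / (2 * M) by field; lra.
  rewrite ler_pdivrMr; last lra.
  by apply: le_trans xy _; apply: ler_wpM2l; lra.
have xb : x * (1 - e) <= x * be by apply: ler_wpM2l.
have ys : y * s' <= y by rewrite ler_piMr.
have xe : x * e <= M * e by apply: ler_wpM2r => //; exact: ltW.
split; first by rewrite eM in xe; lra.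
apply: le_trans xb; have : 7 / 10 * (1 - e) <= x * (1 - e) by apply: ler_wpM2r; lra.
by apply: le_trans; lra.
Qed.

(** By [denom_dominated] the denominator points in nearby directions to
  [Theta22 b] at the circle, so the two have equally many zeros. *)
Lemma denom_count s b lb ub : bounded_analytic s -> bounded_analytic b ->
  bounded_by1 s -> bounded_by1 b -> inner_like b ->
  factored lb ub b -> (forall w, normc w < 1 -> ub w != 0) ->
  (exists2 c : R, 0 < c & near_bdry (fun w => c <= normc (den s b w))) /\
  forall l v, factored l v (den s b) -> (forall w, normc w < 1 -> v w != 0) ->
    size l = (sq_neg P + size lb)%N.
Proof.
move=> hs hb s1 b1 bin bF ub0; have [c c0 dom] := denom_dominated hs hb s1 b1 bin.
split.
  exists c => //; apply: near_bdryW dom => w _ [h _].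
  rewrite /den /denom addrC; apply: le_trans (normcDB _ _); rewrite -/Th; lra.
move=> l v lv v0; have [lt [ut [ltF ut0 lts]]] := Theta22_factored.
rewrite -lts -size_cat; apply: (zero_count lv (factored_mul ltF bF)) => // [w w1|].
  by rewrite mulf_neq0 ?ut0 ?ub0.
have [_ [K HK]] := ban_denom hs hb.
have [_ [K' HK']] := banM (ban_Theta fd hz P 1 1) hb.
exists (c / 2), (`|K| + `|K'|); split; first lra.
apply: near_bdryW dom => w w1 [h1 h2]; have h3 := HK w w1; have h4 := HK' w w1.
have [p1 p2] := (normr_ge0 K, normr_ge0 K'); have [e1 e2] := (ler_norm K, ler_norm K').
split; [|by apply: le_trans h3 _; lra|by apply: le_trans h4 _; rewrite -/Th; lra].
rewrite {h3 h4}/den /denom -/Th mulrDl ReD.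
move: (Th w 1 0 * s w) (Th w 1 1 * b w) h1 h2 => A G h1 h2.
rewrite mulc_conj Re_real; have : - (normc A * normc G) <= complex.Re (A * (G^*)%R).
  have := Re_le_normc (- (A * (G^*)%R)); rewrite normcN normcM normcC.
  by move: (A * _) => [x y] /=; lra.
by move: h1 h2; have := normc_ge0 A; move: (complex.Re _) (normc A) (normc G) => r a g; nra.
Qed.

End Denominators.

(** * Meromorphic quotients and Taylor remainders *)

Section MeromorphicExtension.
Variable R : realType.
Local Notation C := (R[i] : numClosedFieldType).
Implicit Types (f g h s b u : R[i] -> R[i]) (z w : R[i]).

Lemma mero_near g h z (r : R) : 0 < r ->
  (forall w, w != z -> normc (w - z) < r -> g w = h w) ->
  @meromorphic_ext C g z = @meromorphic_ext C h z.
Proof.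
move=> r0 gh; rewrite /meromorphic_ext.
suff -> : ((g : C -> C) @ (z : C)^') = ((h : C -> C) @ (z : C)^') by [].
apply/funext => A; apply/propext; split=> /dnbhsCP [t t0 H]; apply/dnbhsCP;
  exists (Num.min r t); rewrite ?lt_min ?r0 // => w wz; rewrite lt_min => /andP[wr wt].
  by rewrite /= -gh //; exact: H.
by rewrite /= gh //; exact: H.
Qed.

Lemma mero_limit g z l : (forall e : R, 0 < e -> exists2 r : R, 0 < r &
    forall w, w != z -> normc (w - z) < r -> normc (g w - l) < e) ->
  @meromorphic_ext C g z = Some l.
Proof.
move=> H; have gl : (g : C -> C) @ (z : C)^' --> (l : C).
  by apply/cvgCP => e /H [r r0 Hr]; apply/dnbhsCP; exists r.
rewrite /meromorphic_ext asboolT; last by apply/cvg_ex; exists l.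
by congr Some; apply: cvg_lim.
Qed.

Lemma mero_analytic g z : @analytic_at C g z -> @meromorphic_ext C g z = Some (g z).
Proof.
move=> /analytic_continuous gz; apply: mero_limit => e /gz [r r0 H].
by exists r => // w _; exact: H.
Qed.

Lemma small_step z (r : R) : 0 < r -> exists2 w, w != z & normc (w - z) < r.
Proof.
move=> r0; exists (z + ((r / 2)%:C)%C).
  rewrite -subr_eq0 addrAC subrr add0r -normc_gt0 normc_real normr_gt0.
  by rewrite gt_eqF // divr_gt0.
by rewrite addrAC subrr add0r normc_real ger0_norm; lra.
Qed.

(** A finite limit of [s / b] would force [s z = 0]. *)
Lemma mero_pole s b z : @analytic_at C s z -> @analytic_at C b z -> b z = 0 -> s z != 0 ->
  (exists2 r : R, 0 < r & forall w, w != z -> normc (w - z) < r -> b w != 0) ->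
  @meromorphic_ext C (fun w => s w / b w) z = None.
Proof.
move=> /analytic_continuous sz /analytic_continuous bz bz0 sz0 [r r0 br].
rewrite /meromorphic_ext asboolF // => /cvg_ex [l /cvgCP H].
have [t t0 Ht] : exists2 t : R, 0 < t & forall w, w != z -> normc (w - z) < t -> normc (s w / b w - l) < 1.
  by have /dnbhsCP := H 1 ltr01.
have l0 := normc_ge0 l.
have sp : 0 < normc (s z) by rewrite normc_gt0.
have e0 : 0 < normc (s z) / (2 * (normc l + 1)) by rewrite divr_gt0 // mulr_gt0 //; lra.
have [r1 r10 H1] := bz _ e0.
have [|r2 r20 H2] := sz (normc (s z) / 2); first by rewrite divr_gt0.
have [|w wz] := @small_step z (Num.min (Num.min r t) (Num.min r1 r2)).
  by rewrite !lt_min r0 t0 r10 r20.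
rewrite !lt_min -!andbA => /and4P[wr wt w1 w2].
have bw := br w wz wr.
have := Ht w wz wt; have := H1 w w1; have := H2 w w2; rewrite bz0 subr0.
move=> h2 h1 h3.
have sw : s w = (s w / b w - l + l) * b w by rewrite subrK divfK.
have : normc (s w) <= (1 + normc l) * normc (b w).
  rewrite sw normcM ler_wpM2r ?normc_ge0 //; apply: le_trans (normcD _ _) _.
  by rewrite lerD2r ltW.
have : normc (s z) / 2 <= normc (s w).
  have := normcDB (s z) (s w - s z); rewrite [s z + _]addrC subrK; lra.
move: h1; rewrite ltr_pdivlMr; last lra.
by move: (normc_ge0 (b w)); move: (normc (s z)) (normc (s w)) (normc (b w)) (normc l) sp => x y q p; lra.
Qed.

(** The points [w] are moreover in the disk, which spares its intersection with
  a second neighbourhood. *)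
Definition isolated_zeros b := forall z, normc z < 1 ->
  exists2 r : R, 0 < r & forall w, w != z -> normc (w - z) < r -> normc w < 1 /\ b w != 0.

Lemma avoid_seq z (l : seq R[i]) : exists2 r : R, 0 < r &
  forall w, w != z -> normc (w - z) < r -> w \notin l.
Proof.
elim: l => [|a l [r r0 IH]]; first by exists 1.
have [az|az] := eqVneq a z.
  by exists r => // w wz wr; rewrite az inE negb_or wz IH.
exists (Num.min r (normc (a - z))); first by rewrite lt_min r0 normc_gt0 subr_eq0.
move=> w wz; rewrite lt_min => /andP[wr wa]; rewrite inE negb_or IH // andbT.
by apply: contraTneq wa => ->; rewrite ltxx.
Qed.

Lemma disk_nbhd z : normc z < 1 -> exists2 r : R, 0 < r & forall w, normc (w - z) < r -> normc w < 1.
Proof.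
move=> z1; exists (1 - normc z) => [|w]; first lra.
have := normcD (w - z) z; rewrite subrK; lra.
Qed.

Lemma factored_isolated l u b : factored l u b -> (forall z, normc z < 1 -> u z != 0) ->
  isolated_zeros b.
Proof.
move=> [l1 _ bE] u0 z z1; have [r r0 H] := avoid_seq z l; have [t t0 Ht] := disk_nbhd z1.
exists (Num.min r t); first by rewrite lt_min r0 t0.
move=> w wz; rewrite lt_min => /andP[wr /Ht w1]; split=> //.
by rewrite bE // mulf_neq0 ?u0 // bprod_root // H.
Qed.

Lemma mero_ratio s b z : analytic_disk s -> analytic_disk b -> isolated_zeros b ->
  (b z = 0 -> s z != 0) -> normc z < 1 ->
  @meromorphic_ext C (fun w => s w / b w) z = if b z == 0 then None else Some (s z / b z).
Proof.
move=> hs hb iso sb z1; case: eqP => bz.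
  apply: mero_pole => //; [exact: hs|exact: hb|exact: sb|].
  by have [r r0 H] := iso z z1; exists r => // w wz /(H w wz)[].
apply: mero_analytic; apply: analyticM; first exact: hs.
by apply: analyticV; [exact/eqP|exact: hb].
Qed.

Lemma blaschke_facts m b : @blaschke C m b -> [/\ bounded_analytic b, bounded_by1 b, inner_like b &
  exists l (c : R[i]), [/\ size l = m, c != 0 & factored l (fun=> c) b]].
Proof.
move=> /blaschkeP [c [l [c1 l1 lm bE]]].
have bN z : normc z < 1 -> normc (b z) = normc (bprod l z) by move=> /bE ->; rewrite normcM c1 mul1r.
have hb : bounded_analytic (fun z => c * bprod l z).
  by apply: banM; [exact: ban_cst|exact: ban_bprod].
split.
- by apply: ban_ext hb => z z1; rewrite bE.
- by move=> z z1; rewrite bN // bprod_le1.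
- by move=> e /(bprod_inner l1); apply: near_bdryW => z z1; rewrite bN.
exists l, c; split=> //; first by rewrite -normc_gt0 c1.
split=> // [z _|z z1]; first exact: analytic_cst.
by rewrite bE // mulrC.
Qed.

Lemma blaschke_bprod l : (forall a, a \in l -> normc a < 1) -> @blaschke C (size l) (bprod l).
Proof.
move=> l1; apply/blaschkeP; exists 1, l; split=> // [|z _]; last by rewrite mul1r.
by rewrite (normc_nat R 1).
Qed.

Lemma no_common_zerosP s b : @no_common_zeros C s b <->
  forall z, normc z < 1 -> b z = 0 -> s z != 0.
Proof.
split=> H z.
  move=> /in_diskE z1 bz; apply/eqP => sz; exact: (H z z1).
by move=> /in_diskE z1 [sz /(H z z1)]; rewrite sz eqxx.
Qed.

Lemma punctured_eq f g z (r : R) : 0 < r -> @analytic_at C f z -> @analytic_at C g z ->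
  (forall w, w != z -> normc (w - z) < r -> f w = g w) -> f z = g z.
Proof.
move=> r0 fz gz fg; have := mero_near r0 fg.
by rewrite (mero_analytic fz) (mero_analytic gz); case.
Qed.

(** Division by [w - z] does no harm near the circle. *)
Lemma ban_divide f g z : normc z < 1 -> bounded_analytic f -> analytic_disk g ->
  (forall w, f w = (w - z) * g w) -> bounded_analytic g.
Proof.
move=> z1 [_ [K HK]] hg fE; apply: (@ban_bdry _ _ (2 * `|K| / (1 - normc z))) => //.
have r1 : (1 + normc z) / 2 < 1 by lra.
apply: near_bdryW (near_bdry_ge r1) => w w1 wr.
have wz : (1 - normc z) / 2 <= normc (w - z).
  have := normcBB w z; lra.
have := HK w w1; rewrite fE normcM => h.
rewrite ler_pdivlMr; last lra.
have := ler_norm K; have := normc_ge0 (g w); move: (normc (g w)) (normc (w - z)) h wz => G W h wz g0 kn.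
have : (1 - normc z) / 2 * G <= W * G by exact: ler_wpM2r.
lra.
Qed.

(** If [s] agrees with [g b] near [z], then subtracting from [s] the Taylor
  polynomials of [g] times [b] leaves functions divisible by powers of [w - z]:
  near [z] they are [b] times the Taylor tails of [g]. *)
Lemma numerator_tails n : forall s b g z a (K B r : R),
  bounded_analytic s -> bounded_analytic b -> normc z < 1 -> 0 < r ->
  (forall w, normc (w - z) < r -> s w = g w * b w) -> expands g z a K B ->
  exists chi : nat -> R[i] -> R[i], [/\ chi 0%N = s,
    forall m, (m <= n)%N -> bounded_analytic (chi m) &
    forall m w, (m < n)%N -> chi m w - a m * b w = (w - z) * chi m.+1 w].
Proof.
elim: n => [|n IH] s b g z a K B r hs hb z1 r0 sE gE.
  by exists (fun=> s); split.
have a0 := expands0 gE.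
have [g1 [[K1 [B1 g1E]] gg1]] := expands_tail gE.
have hf : bounded_analytic (fun w => s w - a 0%N * b w).
  by apply: banB => //; apply: banM => //; exact: ban_cst.
have f0 : s z - a 0%N * b z = 0.
  by rewrite a0 sE ?subrr // normc0.
have [s1 [fs1 s1an]] := divided_difference (hf.1 z z1).
have fE w : s w - a 0%N * b w = (w - z) * s1 w by rewrite -fs1 f0 subr0.
have hs1 : bounded_analytic s1.
  by apply: (ban_divide z1 hf) => // w w1; apply: s1an; exact: hf.1.
have s1E w : w != z -> normc (w - z) < r -> s1 w = g1 w * b w.
  move=> wz wr; apply: (mulfI (_ : w - z != 0)); first by rewrite subr_eq0.
  by rewrite -fE sE // mulrA -gg1; ring.
have s1E' w : normc (w - z) < r -> s1 w = g1 w * b w.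
  have [->|wz] := eqVneq w z; last exact: s1E.
  move=> _; apply: (@punctured_eq s1 (fun w => g1 w * b w) z r) => //.
    exact: hs1.1.
  by apply: analyticM; [exact: expands_analytic g1E|exact: hb.1].
have [chi [c0 ch cE]] := IH s1 b g1 z (fun m => a m.+1) K1 B1 r hs1 hb z1 r0 s1E' g1E.
exists (fun m => if m is m'.+1 then chi m' else s); split=> // [[|m] // mn|[|m] w mn].
- exact: ch.
- by rewrite c0 fE.
- exact: cE.
Qed.

(** As [tails_expand] asks for exact divisions on the whole plane, the chain is
  continued arbitrarily outside the disk of radius [r]. *)
Lemma tails_expand_near n (psi : nat -> R[i] -> R[i]) (c : nat -> R[i]) z (r : R) : 0 < r ->
  @analytic_at C (psi n) z ->
  (forall m w, (m < n)%N -> normc (w - z) < r -> psi m w - c m = (w - z) * psi m.+1 w) ->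
  exists g, (forall w, normc (w - z) < r -> g w = psi 0%N w) /\
    exists a K B, expands g z a K B /\ forall m, (m < n)%N -> a m = c m.
Proof.
move=> r0 an H.
pose F := fix F m w := if m is m'.+1 then (F m' w - c m') / (w - z) else 0.
pose psi' m w := if normc (w - z) < r then psi m w else F m w.
have E m w : normc (w - z) < r -> psi' m w = psi m w by rewrite /psi' => ->.
exists (psi' 0%N); split; first exact: E.
apply: tails_expand; first by apply: (analytic_near r0) an => w /E ->.
move=> m w mn; rewrite /psi'; case: ifPn => [wr|wr]; first exact: H.
have wz : w - z != 0 by apply: contraNneq wr => ->; rewrite normc0.
by rewrite /= mulrC divfK.
Qed.

End MeromorphicExtension.

(** * The parametrization *)

Section Parametrization.
Variable R : realType.
Local Notation C := (R[i] : numClosedFieldType).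
Variables (k : nat) (z : 'I_k -> C) (n : 'I_k -> nat).
Variable fd : forall i, 'I_(n i) -> C.
Hypothesis hz : forall i, in_disk (z i).
Hypothesis hinj : injective z.
Let N := (\sum_i n i)%N.
Variable P : 'M[C]_N.
Hypothesis hP : is_pick_matrix z fd P.
Hypothesis hdet : \det P != 0.
Variable kappa : nat.
Hypothesis hkappa : (sq_neg P <= kappa)%N.
Let Th := Theta z fd P.
Let num := numer z fd P.
Let den := denom z fd P.
Implicit Types (s b u S B : R[i] -> R[i]) (w : R[i]) (f : R[i] -> option R[i]).

Let nodeD i : normc (z i) < 1.
Proof. exact/in_diskE. Qed.

Lemma abs_defect (p q x y t : R) : `|(p - q) - (x - y)| <= t ->
  x - y <= p - q + t /\ p - q <= x - y + t.
Proof. by rewrite ler_norml => /andP[h1 h2]; split; lra. Qed.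

Lemma eighth_lt_half (L : R) : 1 <= L ->
  L * (2 * (8 * L)^-1) + L * (8 * L)^-1 < 1 - 2^-1.
Proof.
move=> L1; have -> : L * (2 * (8 * L)^-1) + L * (8 * L)^-1 = 3 / 8 by field; lra.
lra.
Qed.

Lemma lftE S B : lft Th S B = @meromorphic_ext C (fun w => num S B w / den S B w).
Proof. by []. Qed.

(** Near the circle the defect in the hypothesis is negligible and [b] has
  modulus nearly 1. *)
Lemma defect_le F G s b (Q : R) : bounded_by1 s -> inner_like b -> 0 <= Q ->
  (forall w, normc w < 1 -> normc (F w) ^+ 2 - normc (G w) ^+ 2 <=
     normc (s w) ^+ 2 - normc (b w) ^+ 2 + Q * (1 - normc w ^+ 2)) ->
  forall e : R, 0 < e -> near_bdry (fun w => normc (F w) ^+ 2 <= normc (G w) ^+ 2 + e).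
Proof.
move=> s1 bin Q0 FG e e0.
have e2 : 0 < e / 2 by lra.
have e4 : 0 < Num.min (e / 4) 1 by rewrite lt_min ltr01 andbT; lra.
apply: near_bdryW (near_bdryI (near_bdry_small Q0 e2) (bin _ e4)) => w w1 [h1 h2].
have := FG w w1; have := s1 w w1; have := normc_ge0 (s w).
have m1 : Num.min (e / 4) 1 <= e / 4 by rewrite ge_min lexx.
have m2 : Num.min (e / 4) 1 <= 1 by rewrite ge_min lexx orbT.
move: (normc (s w)) (normc (b w)) (normc (F w) ^+ 2) (normc (G w) ^+ 2) h1 h2 => x y p q.
move: (Q * _) (Num.min _ _) m1 m2 => t m m1 m2 h1 h2 x0 x1 h.
have : x ^+ 2 <= 1 by rewrite expr_le1.
have : (1 - m) * (1 - m) <= y * y by apply: ler_pM => //; lra.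
rewrite -!expr2; nra.
Qed.

(** If [B] were small near the circle, then so would be [S], and hence also
  [den S B], a combination of the two with bounded coefficients. *)
Lemma second_input_ge S B :
  (forall e : R, 0 < e -> near_bdry (fun w => normc (S w) ^+ 2 <= normc (B w) ^+ 2 + e)) ->
  inner_like (den S B) ->
  exists2 c : R, 0 < c & near_bdry (fun w => c <= normc (B w)).
Proof.
move=> SB denin.
have [[_ [K1 H1]] [_ [K2 H2]]] := (ban_Theta fd hz P 1 0, ban_Theta fd hz P 1 1).
pose L : R := 1 + `|K1| + `|K2|.
have [p1 p2] := (normr_ge0 K1, normr_ge0 K2); have [q1 q2] := (ler_norm K1, ler_norm K2).
have L1 : 1 <= L by rewrite /L; lra.
have [K1L K2L] : K1 <= L /\ K2 <= L by rewrite /L; split; lra.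
have half0 : 0 < 2^-1 :> R by lra.
pose d : R := (8 * L)^-1; have d0 : 0 < d by rewrite invr_gt0; lra.
exists d => //.
apply: near_bdryW (near_bdryI (SB _ (exprn_gt0 2 d0)) (denin _ half0)) => w w1 [h1 h2].
rewrite leNgt; apply/negP => Bd.
have h3 := le_trans (H1 w w1) K1L; have h4 := le_trans (H2 w w1) K2L.
have [n1 n2] := (normc_ge0 (S w), normc_ge0 (B w)).
have [t1 t2] := (normc_ge0 (Th w 1 0), normc_ge0 (Th w 1 1)).
have Sd : normc (S w) <= 2 * d.
  have d2 : 0 <= 2 * d by rewrite mulr_ge0 // ltW.
  rewrite -ler_sqr //; apply: le_trans h1 _.
  have Bd2 : normc (B w) ^+ 2 <= d ^+ 2 by rewrite ler_sqr ?nnegrE // ltW.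
  apply: le_trans (lerD Bd2 (lexx _)) _; rewrite exprMn.
  by move: (d ^+ 2) (sqr_ge0 d) => x x0; lra.
have : normc (den S B w) <= L * (2 * d) + L * d.
  apply: le_trans (normcD _ _) _; rewrite !normcM.
  by apply: lerD; apply: ler_pM => //; exact: ltW.
by move=> /(le_trans h2); rewrite leNgt (eighth_lt_half L1).
Qed.

(** A common zero is excluded at the nodes by the hypothesis on the
  denominator, and elsewhere by the injectivity of [Theta]. *)
Lemma num_den_neq0 S B w : normc w < 1 -> (S w = 0 -> B w != 0) ->
  (forall i, den S B (z i) != 0) -> num S B w = 0 -> den S B w != 0.
Proof.
move=> w1 SB hden n0; apply/eqP => d0.
have wz i : w != z i by apply: contraTneq (hden i) => <-; rewrite d0 eqxx.
have [S0 B0] := theta_inj_pair hz hP hdet (disk_le1 w1) wz n0 d0.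
by have := SB S0; rewrite B0 eqxx.
Qed.

(** The Blaschke factor of the denominator has degree [kappa] by the zero count,
  and the quotient of the numerator by the zero-free factor is a Schur
  function. *)
Lemma parameters_gen_schur S B f : schur S -> blaschke (kappa - sq_neg P) B ->
  no_common_zeros S B -> (forall i, den S B (z i) != 0) ->
  (forall w, in_disk w -> f w = lft Th S B w) -> @gen_schur C kappa f.
Proof.
move=> /schurP [Sa S1] hB /no_common_zerosP SB hden fE.
have [Bb B1 Bin [lB [cB [lBs cB0 BF]]]] := blaschke_facts hB.
have Sb := ban_schur Sa S1.
have [[c c0 cden] count] := denom_count hz hinj hP hdet Sb Bb S1 B1 Bin BF (fun _ _ => cB0).
have numb : bounded_analytic (num S B) by exact: ban_numer.
have denb : bounded_analytic (den S B) by exact: ban_denom.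
have [Q Q0 HQ] := Theta_pair_bound hz hP hdet ler01 S1 B1.
have [|l [u [lu u0 sa s1]]] := schur_quotient numb denb c0 cden.
  apply: defect_le S1 Bin Q0 _ => w w1.
  by case: (abs_defect (HQ w w1)).
have [l1 ua denE] := lu.
exists (fun w => num S B w / u w), (bprod l); split.
- by apply/(@schurP R); split; [exact: sa|exact: s1].
- by rewrite -(subnKC hkappa) -lBs -(count _ _ lu u0); exact: blaschke_bprod.
- apply/no_common_zerosP => w w1 b0.
  have d0 : den S B w = 0 by rewrite denE // b0 mul0r.
  rewrite mulf_neq0 ?invr_eq0 ?u0 //; apply: contraTneq isT => n0.
  have := num_den_neq0 w1 _ hden n0; rewrite d0 eqxx => -> // S0.
  by apply: contraTneq isT => /(SB w w1); rewrite S0 eqxx.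
- move=> w /[dup] wd /in_diskE w1; rewrite (fE w wd) lftE.
  have [r r0 Hr] := disk_nbhd w1.
  apply: (mero_near r0) => v _ /Hr v1.
  rewrite (denE v v1).
  by have uv := u0 v v1; rewrite invfM mulrCA [LHS]mulrC.
Qed.

(** The Taylor remainders of [num / den] at a node are the entries of
  [remainder] divided by [den]. *)
Lemma parameters_solution S B f : schur S -> blaschke (kappa - sq_neg P) B ->
  no_common_zeros S B -> (forall i, den S B (z i) != 0) ->
  (forall w, in_disk w -> f w = lft Th S B w) -> IP_solution kappa z fd f.
Proof.
move=> hS hB hSB hden fE; split; first exact: parameters_gen_schur hS hB hSB hden fE.
move=> i.
have /schurP [Sa S1] := hS; have [Bb B1 Bin _] := blaschke_facts hB.
have Sb := ban_schur Sa S1.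
have [numa _] : bounded_analytic (num S B) by exact: ban_numer.
have [dena _] : bounded_analytic (den S B) by exact: ban_denom.
have := ban_remainder fd hz P Sb Bb; set phi := fun w => _; rewrite -/phi => phib.
have [r r0 Hr] : exists2 r : R, 0 < r & forall w, normc (w - z i) < r ->
    normc w < 1 /\ den S B w != 0.
  have [r r0 Hr] := disk_nbhd (nodeD i).
  have dp : 0 < normc (den S B (z i)) by rewrite normc_gt0.
  have [t t0 Ht] := analytic_continuous (dena _ (nodeD i)) dp.
  exists (Num.min r t) => [|w]; first by rewrite lt_min r0 t0.
  rewrite lt_min => /andP[/Hr w1 /Ht wt]; split=> //.
  by apply: contraTneq wt => ->; rewrite sub0r normcN ltxx.
pose c j := if insub j is Some j' then fd (i := i) j' else 0.
(* [psi] is the chain of Taylor remainders of [num / den] at [z i]. *)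
pose psi j w := if j is j'.+1 then entry (submxcol (phi w) i) j' / den S B w
  else num S B w / den S B w.
have cE (j : 'I_(n i)) : c j = fd j by rewrite /c valK.
have phia j : analytic_at (fun w => entry (submxcol (phi w) i) j : C) (z i).
  rewrite /entry; case: insubP => [j' _ _|_]; last exact: analytic_cst.
  have [ph _] := phib (tagnat.Rank i j') 0.
  apply: (@analytic_near _ (fun w => phi w (tagnat.Rank i j') 0) _ _ 1) => // [w _|].
    by rewrite [RHS]mxE.
  exact: ph.
have [||g [gE [a [K [M [aE ac]]]]]] := @tails_expand_near R (n i) psi c (z i) r r0.
- have psia m : @analytic_at C (psi m) (z i); last exact: psia.
  case: m => [|m].
    by apply: analyticM; [exact: numa|apply: analyticV; [exact: hden|exact: dena]].
  by apply: analyticM; [exact: phia|apply: analyticV; [exact: hden|exact: dena]].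
- move=> m w mn wr; have [w1 d0] := Hr w wr.
  have := remainder_blocks hz hP hdet (S w) (B w) (disk_le1 w1) (Ordinal mn).
  rewrite -/(phi w) -/Th -/(num S B w) -/(den S B w) -(cE (Ordinal mn)) /=.
  have dI : (den S B w)^-1 * den S B w = 1 by rewrite mulVf.
  case: m mn => [|m] mn /=; rewrite ?mul1r ?mul0r ?subr0 ?sub0r => e.
    by rewrite mulrA e mulrBl mulrAC mulfV // mul1r.
  have e' : (w - z i) * entry (submxcol (phi w) i) m.+1 =
      entry (submxcol (phi w) i) m - den S B w * c m.+1.
    by rewrite -e [RHS]addrC subrK.
  by rewrite mulrA e' mulrBl [den S B w * _ / _]mulrAC mulfV // mul1r.
exists g; split.
- apply/nbhsCP; exists r => // w wr; have [w1 d0] := Hr w wr.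
  rewrite fE; last by apply/in_diskE; exact: w1.
  rewrite lftE mero_analytic; first by rewrite gE.
  by apply: analyticM; [exact: numa|apply: analyticV; [exact: d0|exact: dena]].
- exact: expands_analytic aE.
- by move=> j; rewrite (derive1n_expands j aE) ac ?cE.
Qed.

(** The remainders [chi] at all the nodes form the column [phi] with
  [(w - T) phi = s E - b C], to which [theta_solve_pair] applies. *)
Lemma solution_parameters f : IP_solution kappa z fd f ->
  exists S B, [/\ schur S, blaschke (kappa - sq_neg P) B, no_common_zeros S B,
    forall i, den S B (z i) != 0 & forall w, in_disk w -> f w = lft Th S B w].
Proof.
move=> [[s [b [/schurP [sa s1] hb /no_common_zerosP sb fE]]] hf].
have [bb b1 bin [lb [cb [lbs cb0 bF]]]] := blaschke_facts hb.
have [ba _] := bb; have sbd := ban_schur sa s1.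
have biso := factored_isolated bF (fun _ _ => cb0).
have fval w : normc w < 1 -> f w = if b w == 0 then None else Some (s w / b w).
  by move=> w1; rewrite fE; [apply: mero_ratio => //; exact: sb|exact/in_diskE].
have bz i : b (z i) != 0.
  have [g [/nbhsCP [r r0 fg] _ _]] := hf i.
  have := fg (z i); rewrite subrr normc0 fval // => /(_ r0).
  by case: eqP.
have tails i : exists chi : nat -> R[i] -> R[i], [/\ chi 0%N = s,
    forall m, (m <= n i)%N -> bounded_analytic (chi m) &
    forall (m : 'I_(n i)) w, chi m w - fd m * b w = (w - z i) * chi m.+1 w].
  have [g [/nbhsCP [r r0 fg] ga gd]] := hf i.
  have [a [K [M gE]]] := analytic_expands ga.
  have [t t0 Ht] := disk_nbhd (nodeD i).
  have rt : 0 < Num.min r t by rewrite lt_min r0 t0.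
  have sE w : normc (w - z i) < Num.min r t -> s w = g w * b w.
    rewrite lt_min => /andP[/fg + /Ht w1]; rewrite fval //.
    by case: eqP => // /eqP bw [<-]; rewrite divfK.
  have [chi [c0 cb' cE]] := numerator_tails (n i) sbd bb (nodeD i) rt sE gE.
  exists chi; split=> // m w; rewrite -cE //; congr (_ - _ * _).
  have /eqP := gd m; rewrite (derive1n_expands m gE).
  have fact0 : (m`!%:R : R[i]) != 0.
    by rewrite -normc_gt0 normc_nat ltr0n fact_gt0.
  by move=> /eqP /(mulfI fact0).
have /choice [chi Hchi] := tails.
pose phi w : 'cV[C]_N := \mxcol_i \col_(j < n i) chi i j.+1 w.
have phib : bounded_analytic_mx phi.
  move=> p q; apply: (@ban_ext _ (fun w => chi (tagnat.sig1 p) (tagnat.sig2 p).+1 w)).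
    by move=> w _; rewrite !mxE.
  by have [_ cb' _] := Hchi (tagnat.sig1 p); apply: cb'; exact: ltn_ord.
have entryE w i j : (j < n i)%N -> entry (submxcol (phi w) i) j = chi i j.+1 w.
  by move=> jn; rewrite -[j]/(nat_of_ord (Ordinal jn)) entry_ord mxcolK mxE.
have blocks w i (j : 'I_(n i)) :
    (w - z i) * entry (submxcol (phi w) i) j - prev_entry (submxcol (phi w) i) j =
    (j == 0 :> nat)%:R * s w - b w * fd j.
  have [c0 _ cE] := Hchi i; rewrite entryE // -cE.
  case: j => [[|j] jn] /=; first by rewrite c0 subr0 mul1r mulrC.
  by rewrite entryE ?(ltnW jn) // mul0r sub0r addrAC subrr add0r mulrC.
pose T := T_mx z n; pose Y w := invmx (1%:M - T^t*) *m (invmx P *m phi w).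
(* The parameters before their common factor is divided out, by
  [theta_solve_pair]. *)
pose S0 w := s w - (w - 1) * ((E_mx C n)^t* *m Y w) 0 0.
pose B0 w := b w - (w - 1) * ((C_mx fd)^t* *m Y w) 0 0.
have Yb : bounded_analytic_mx Y.
  apply: ban_mxM; first exact: ban_mx_cst.
  by apply: ban_mxM; [exact: ban_mx_cst|exact: phib].
have rowb (A : 'rV[C]_N) : bounded_analytic (fun w : R[i] => (w - 1) * (A *m Y w) 0 0).
  apply: banM; first exact: ban_sub.
  by apply: ban_mxM; [exact: ban_mx_cst|exact: Yb].
have S0b : bounded_analytic S0 by apply: banB => //; exact: rowb.
have B0b : bounded_analytic B0 by apply: banB => //; exact: rowb.
have numE w : normc w < 1 -> num S0 B0 w = s w /\ den S0 B0 w = b w.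
  by move=> w1; exact: (theta_solve_pair hz hP hdet (disk_le1 w1) (blocks w)).
have [M M1 [SM BM]] : exists2 M : R, 1 <= M & (forall w, normc w < 1 -> normc (S0 w) <= M) /\
    (forall w, normc w < 1 -> normc (B0 w) <= M).
  have [_ [K1 H1]] := S0b; have [_ [K2 H2]] := B0b.
  exists (1 + `|K1| + `|K2|); first by rewrite -addrA lerDl addr_ge0.
  have [p1 p2] := (normr_ge0 K1, normr_ge0 K2); have [q1 q2] := (ler_norm K1, ler_norm K2).
  by split=> w w1; [apply: le_trans (H1 w w1) _|apply: le_trans (H2 w w1) _]; lra.
have SB e : 0 < e -> near_bdry (fun w => normc (S0 w) ^+ 2 <= normc (B0 w) ^+ 2 + e).
  move: e; have [Q Q0 HQ] := Theta_pair_bound hz hP hdet (le_trans ler01 M1) SM BM.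
  apply: (defect_le s1 bin Q0) => w w1.
  have := HQ w w1; rewrite -/num -/den; have [-> ->] := numE w w1.
  by case/abs_defect.
have bin0 : inner_like (den S0 B0).
  by move=> e e0; apply: near_bdryW (bin e e0) => w w1; have [_ ->] := numE w w1.
have [c c0 B0c] := second_input_ge SB bin0.
(* The zero-free factor [u] of [B0] is divided out of both parameters. *)
have [lB [u [lu u0 Sa S1]]] := schur_quotient S0b B0b c0 B0c SB.
have [lB1 ua B0E] := lu.
pose S w := S0 w / u w.
have Sb := ban_schur Sa S1.
have Bb := ban_bprod lB1; have B1 w (w1 : normc w < 1) := bprod_le1 lB1 w1.
have linE w : normc w < 1 -> num S (bprod lB) w = s w / u w /\ den S (bprod lB) w = b w / u w.
  move=> w1; have [<- <-] := numE w w1; rewrite /num /den /numer /denom B0E //.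
  by have uw := u0 w w1; split; rewrite /S; field.
have BF : factored lB (fun=> 1) (bprod lB).
  by split; [exact: lB1|move=> w _; exact: analytic_cst|move=> w _; rewrite mulr1].
have [_ count] := denom_count hz hinj hP hdet Sb Bb S1 B1 (bprod_inner lB1) BF (fun _ _ => oner_neq0 _).
have lBs : size lB = (kappa - sq_neg P)%N.
  have hu : factored lb (fun w => cb / u w) (den S (bprod lB)).
    have [lb1 _ bE] := bF; split; first exact: lb1.
      move=> w w1; apply: analyticM; first exact: analytic_cst.
      by apply: analyticV; [exact: u0|exact: ua].
    by move=> w w1; have [_ ->] := linE w w1; rewrite bE // mulrA.
  have hu0 w : normc w < 1 -> cb / u w != 0.
    by move=> w1; rewrite mulf_neq0 ?invr_eq0 ?u0.
  by rewrite -lbs (count _ _ hu hu0) addKn.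
exists S, (bprod lB); split.
- by apply/(@schurP R); split; [exact: Sa|exact: S1].
- by rewrite -lBs; exact: blaschke_bprod.
- apply/no_common_zerosP => w w1 Bw; apply/eqP => Sw.
  have [] := linE w w1; rewrite /num /den /numer /denom Bw Sw !mulr0 addr0.
  move=> /esym/eqP; rewrite mulf_eq0 invr_eq0 (negbTE (u0 w w1)) orbF => sw.
  move=> /esym/eqP; rewrite mulf_eq0 invr_eq0 (negbTE (u0 w w1)) orbF => /eqP /(sb w w1).
  by rewrite sw.
- by move=> i; have [_ ->] := linE _ (nodeD i); rewrite mulf_neq0 ?invr_eq0 ?u0.
- move=> w /[dup] wd /in_diskE w1; rewrite (fE w wd) lftE.
  have [r r0 Hr] := disk_nbhd w1.
  apply: (mero_near r0) => v _ /Hr v1; have [ne de] := linE v v1.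
  rewrite ne de.
  by have uv := u0 v v1; rewrite invfM invrK mulrACA mulVf // mulr1.
Qed.

(** The parameters of the two descriptions correspond by [e = S / B]. *)
Lemma ratio_parameter S B (e : R[i] -> option R[i]) m : schur S -> blaschke m B ->
  no_common_zeros S B ->
  (forall w, in_disk w -> e w = @meromorphic_ext C (fun v => S v / B v) w) ->
  (forall i, den S B (z i) != 0 <->
     affine_neq0 (Th (z i) 1 0) (Th (z i) 1 1) (e (z i)) \/
     [/\ e (z i) = None, Th (z i) 1 0 != 0 & Th (z i) 1 1 = 0]) /\
  (forall w, in_disk w -> lft_mero Th e w = lft Th S B w).
Proof.
move=> /schurP [Sa S1] hB /no_common_zerosP SB eE.
have [[Ba _] B1 Bin [lB [cB [lBs cB0 BF]]]] := blaschke_facts hB.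
have iso := factored_isolated BF (fun _ _ => cB0).
have eval w : normc w < 1 -> e w = if B w == 0 then None else Some (S w / B w).
  by move=> w1; rewrite eE; [apply: mero_ratio => //; exact: SB|exact/in_diskE].
split=> [i|w /in_diskE w1].
  rewrite eval // /den /denom -/Th; have [B0|B0] := eqVneq (B (z i)) 0.
    have S0 := SB _ (nodeD i) B0.
    rewrite B0 mulr0 addr0 mulf_eq0 (negbTE S0) orbF; split=> [|[|[]]] //.
    by left.
  have -> : Th (z i) 1 0 * S (z i) + Th (z i) 1 1 * B (z i) =
     (Th (z i) 1 0 * (S (z i) / B (z i)) + Th (z i) 1 1) * B (z i) by field.
  by rewrite mulf_eq0 (negbTE B0) orbF; split=> [|[|[]]] //; left.
have [r r0 Hr] := iso w w1; apply: (mero_near r0) => v vw /(Hr v vw) [v1 Bv].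
rewrite /finite_part eval // (negbTE Bv) /= !mulr1.
have split2 x y : Th v x 0 * S v + Th v x y * B v = (Th v x 0 * (S v / B v) + Th v x y) * B v.
  by field.
by rewrite !split2 invfM mulrACA mulfV // mulr1.
Qed.

End Parametrization.

Theorem theorem1p1 (R : realType) (kappa k : nat) (hk : (0 < k)%N)
    (z : 'I_k -> R[i]) (hz : forall i, in_disk (z i)) (hinj : injective z)
    (n : 'I_k -> nat) (hn : forall i, (0 < n i)%N)
    (fd : forall i : 'I_k, 'I_(n i) -> R[i])
    (P : 'M[R[i]]_(\sum_i n i)) (hP : is_pick_matrix z fd P)
    (hkappa : (sq_neg P <= kappa)%N) (hdet : \det P != 0) :
  let Th := Theta z fd P in
  forall f : R[i] -> option R[i],
    (IP_solution kappa z fd f <->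
       exists S B : R[i] -> R[i],
         [/\ schur S, blaschke (kappa - sq_neg P) B, no_common_zeros S B,
             (forall i, Th (z i) 1 0 * S (z i) + Th (z i) 1 1 * B (z i) != 0) &
             (forall w, in_disk w -> f w = lft Th S B w)])
    /\
    (IP_solution kappa z fd f <->
       exists e : R[i] -> option R[i],
         [/\ gen_schur (kappa - sq_neg P) e,
             (forall i,
                affine_neq0 (Th (z i) 1 0) (Th (z i) 1 1) (e (z i)) \/
                [/\ e (z i) = None, Th (z i) 1 0 != 0 & Th (z i) 1 1 = 0]) &
             (forall w, in_disk w -> f w = lft_mero Th e w)]).
Proof.
move=> Th f.
have pairs : IP_solution kappa z fd f <-> exists S B : R[i] -> R[i],
    [/\ schur S, blaschke (kappa - sq_neg P) B, no_common_zeros S B,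
      (forall i, Th (z i) 1 0 * S (z i) + Th (z i) 1 1 * B (z i) != 0) &
      (forall w, in_disk w -> f w = lft Th S B w)].
  split=> [|[S [B [hS hB hSB hden fE]]]].
    exact: (solution_parameters hz hinj hP hdet).
  exact: (parameters_solution hz hinj hP hdet hkappa hS hB hSB hden fE).
split; first exact: pairs.
apply: (iff_trans pairs); split=> [[S [B [hS hB hSB hden fE]]]|[e [[S [B [hS hB hSB eE]]] he fE]]].
  pose e := meromorphic_ext (fun v => S v / B v).
  have [cond lftE'] := ratio_parameter fd hz P hS hB hSB (fun w _ => erefl (e w)).
  exists e; split=> [|i|w wd].
  - by exists S, B; split; [exact: hS|exact: hB|exact: hSB|move=> w _; exact: erefl].
  - exact/cond/hden.
  - by rewrite (fE w wd) (lftE' w wd).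
have [cond lftE'] := ratio_parameter fd hz P hS hB hSB eE.
exists S, B; split; [exact: hS|exact: hB|exact: hSB| |].
- by move=> i; apply/cond; exact: he.
- by move=> w wd; rewrite fE ?lftE'.
Qed.
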